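(* (i) Let $S:\{f\in C^\infty[0,1]:f(0)=f(1)=f'(1)=0\}\to C^\infty[0,1]$ be given by $Sf=\left(-i\frac{\mathrm{d}}{\mathrm{d}x}\right)^3f=i f'''$, and let $\Gamma^{\pm}$ and $F_\lambda^{\pm}$ be the finite interval contours and functionals defined in the context. Then $\{F_\lambda^+:\lambda\in\Gamma^+\}\cup\{F_\lambda^-:\lambda\in\Gamma^-\}$ is a family of type II augmented eigenfunctions of $S$ up to integration along $\Gamma^+\cup\Gamma^-$ (with $I=(0,1)$), with eigenvalues $\lambda^3$. (ii) Let $S:\{f\in\mathcal{E}[0,\infty):f(0)=0\}\to\mathcal{S}[0,\infty)$ be given by $Sf=\left(-i\frac{\mathrm{d}}{\mathrm{d}x}\right)^3f=i f'''$, and let $\Gamma^{\pm}$ and $F_\lambda^{\pm}$ be the half-line contours and functionals defined in the context. Then $\{F_\lambda^+:\lambda\in\Gamma^+\}\cup\{F_\lambda^-:\lambda\in\Gamma^-\}$ is a family of type II augmented eigenfunctions of $S$ up to integration along $\Gamma^+\cup\Gamma^-$ (with $I=(0,\infty)$), with eigenvalues $\lambda^3$.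
   Context: Notation: $\alpha=e^{2\pi i/3}$; $\mathbb{C}^+$ and $\mathbb{C}^-$ are the open upper and lower half-planes. The boundary of a domain is oriented so that the domain lies to its left. Integrals along unbounded contours are improper integrals, and $\int_{\Gamma^+\cup\Gamma^-}=\int_{\Gamma^+}+\int_{\Gamma^-}$. Type II augmented eigenfunctions. Let $I$ be an open real interval, $C$ a space of functions on the closure of $I$ with sufficient smoothness and decay conditions, $C'$ its dual, $\Phi\subseteq C$, and $L:\Phi\to C$ a linear operator. Let $\gamma$ be an oriented contour in $\mathbb{C}$. A family $\{E_\lambda:\lambda\in\gamma\}$ of functionals $E_\lambda\in C'$ is a family of type II augmented eigenfunctions of $L$ up to integration along $\gamma$, with eigenvalues $z(\lambda)$, if there are remainder functionals $R_\lambda\in C'$ with $$E_\lambda(L\phi)=z(\lambda)E_\lambda(\phi)+R_\lambda(\phi)\quad\text{for all }\phi\in\Phi,\ \lambda\in\gamma,$$ and $$\int_\gamma\frac{e^{i\lambda x}}{z(\lambda)}R_\lambda(\phi)\,\mathrm{d}\lambda=0\quad\text{for all }\phi\in\Phi,\ x\in I.$$ Function spaces. $\mathcal{S}[0,\infty)$ is the Schwartz class of rapidly decaying smooth functions restricted to the half-line $[0,\infty)$. For some fixed arbitrarily small $\epsilon>0$, $\mathcal{E}[0,\infty)=\{f\in\mathcal{S}[0,\infty):f(x)=O(e^{-\epsilon x})\text{ as }x\to\infty\}$. Finite interval contours and functionals. $\Gamma^{\pm}$ is the oriented boundary of $\{\lambda\in\mathbb{C}^{\pm}:\operatorname{Im}(\lambda^3)>0,\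 |\lambda|>1\}$. Put $\Delta(\lambda)=e^{-i\lambda}+\alpha e^{-i\alpha\lambda}+\alpha^2e^{-i\alpha^2\lambda}$, $$\phi^+(x,\lambda)=\frac{1}{2\pi\Delta(\lambda)}\left[e^{-i\lambda x}(\alpha e^{-i\alpha\lambda}+\alpha^2e^{-i\alpha^2\lambda})-(\alpha e^{-i\alpha\lambda x}+\alpha^2e^{-i\alpha^2\lambda x})e^{-i\lambda}\right],$$ $$\phi^-(x,\lambda)=\frac{-e^{-i\lambda}}{2\pi\Delta(\lambda)}\left[e^{-i\lambda x}+\alpha e^{-i\alpha\lambda x}+\alpha^2e^{-i\alpha^2\lambda x}\right],$$ and $F_\lambda^{\pm}(f)=\int_0^1\phi^{\pm}(x,\lambda)f(x)\,\mathrm{d}x$ for $\lambda\in\Gamma^{\pm}$. Half-line contours and functionals. $\Gamma^+$ is the oriented boundary of $\{\lambda\in\mathbb{C}^+:\operatorname{Re}(-i\lambda^3)<0,\ |\lambda|>1\}$. $\Gamma^-$ is $\mathbb{R}$, traversed from $-\infty$ to $+\infty$, but perturbed away from $0$ along a small semicircular arc in $\mathbb{C}^+$ centred at $0$, of radius less than $\epsilon$. Put $$\phi^+(x,\lambda)=\frac{1}{2\pi}\left[\alpha e^{-i\alpha\lambda x}+\alpha^2e^{-i\alpha^2\lambda x}\right],\qquad\phi^-(x,\lambda)=\frac{1}{2\pi}e^{-i\lambda x},$$ and $F_\lambda^{\pm}(f)=\int_0^\infty\phi^{\pm}(x,\lambda)f(x)\,\mathrm{d}x$ for $\lambda\in\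Gamma^{\pm}$.
   Formalization: In (ii), C is taken to be the f in S[0,∞) with f=O(e^{-cx}) for all c<ε, not S[0,∞), since F^-_λ diverges on part of S[0,∞) for λ on the arc; the arc's radius is also taken less than 1 so that Γ^+ and Γ^- are disjoint. *)

(* Defs.v *)
From Stdlib Require Import Reals Lra Psatz List Classical ClassicalEpsilon.
From Coquelicot Require Import Coquelicot.
Import ListNotations.

Open Scope R_scope.

(** ** Complex exponential and cube root of unity *)

Definition Cexp (z : C) : C :=
  (exp (Re z) * cos (Im z), exp (Re z) * sin (Im z)).

Definition alpha : C := Cexp (2 * PI * Ci / 3)%C.

(** ** Functions on real intervals

    A function on a set [D] of reals is represented by a map [R -> C] whose
    values outside [D] play no role.  Derivatives are taken within [D], hence
    are one-sided at the end points of an interval. *)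

Definition is_deriv_on (D : R -> Prop) (f : R -> C) (x : R) (l : C) : Prop :=
  filterdiff (U := R_NormedModule) (V := C_R_NormedModule) f
    (within D (locally x)) (fun y : R => scal y (l : C_R_NormedModule)).

Fixpoint deriv_on (D : R -> Prop) (n : nat) (f : R -> C) : R -> C :=
  match n with
  | O => f
  | S m => fun x =>
      iota (fun l : C_R_CompleteNormedModule => is_deriv_on D (deriv_on D m f) x l)
  end.

Definition smooth_on (D : R -> Prop) (f : R -> C) : Prop :=
  forall (n : nat) (x : R), D x -> exists l : C, is_deriv_on D (deriv_on D n f) x l.

Definition whole (x : R) : Prop := True.

(** The open interval (a,b), with [a] and [b] possibly infinite, and its
    closure in [R]. *)
Definition itv (a b : Rbar) (x : R) : Prop := Rbar_lt a x /\ Rbar_lt x b.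
Definition clitv (a b : Rbar) (x : R) : Prop := Rbar_le a x /\ Rbar_le x b.

Definition sup_on (D : R -> Prop) (h : R -> R) : Rbar :=
  Lub_Rbar (fun y => exists x, D x /\ y = h x).

Definition lin_comb (c : C) (f : R -> C) (d : C) (g : R -> C) : R -> C :=
  fun x => (c * f x + d * g x)%C.

Definition subspace (P : (R -> C) -> Prop) : Prop :=
  P (fun _ => RtoC 0) /\
  forall c d f g, P f -> P g -> P (lin_comb c f d g).

(** ** Locally convex function spaces and their duals *)

Record fun_space := FunSpace {
  carrier : (R -> C) -> Prop;
  sn_index : Type;
  seminorm : sn_index -> (R -> C) -> Rbar
}.

Definition functional := (R -> C) -> C.

Definition linear_functional (X : fun_space) (E : functional) : Prop :=
  forall c d f g, carrier X f -> carrier X g ->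
    E (lin_comb c f d g) = (c * E f + d * E g)%C.

(** Continuity for the topology generated by the seminorms of [X]. *)
Definition continuous_functional (X : fun_space) (E : functional) : Prop :=
  forall f, carrier X f -> forall e : R, 0 < e ->
    exists (l : list (sn_index X)) (d : R), 0 < d /\
      forall g, carrier X g ->
        (forall i, In i l -> Rbar_lt (seminorm X i (fun x => (g x - f x)%C)) d) ->
        Cmod (E g - E f) < e.

Definition dual (X : fun_space) (E : functional) : Prop :=
  linear_functional X E /\ continuous_functional X E.

Definition linear_operator (D : R -> Prop) (Phi : (R -> C) -> Prop) (X : fun_space)
    (L : (R -> C) -> (R -> C)) : Prop :=
  subspace (carrier X) /\ subspace Phi /\
  (forall f, Phi f -> carrier X f) /\
  (forall f, Phi f -> carrier X (L f)) /\
  (forall c d f g, Phi f -> Phi g ->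
     forall x, D x -> L (lin_comb c f d g) x = lin_comb c (L f) d (L g) x).

(** ** Oriented contours *)

(** [curve t] for [t] running from [start] to [finish]; the parameter may
    decrease and either end may be infinite. *)
Record path := Path { curve : R -> C; start : Rbar; finish : Rbar }.

Definition contour := list path.

Definition on_path (p : path) (z : C) : Prop :=
  exists t : R,
    (clitv (start p) (finish p) t \/ clitv (finish p) (start p) t) /\
    z = curve p t.

Definition on_contour (g : contour) (z : C) : Prop :=
  exists p, In p g /\ on_path p z.

Definition end_filter (e : Rbar) : (R -> Prop) -> Prop :=
  match e with
  | Finite r => at_point r
  | _ => Rbar_locally e
  end.

Definition is_path_int (p : path) (f : C -> C) (v : C) : Prop :=
  is_RInt_gen (V := C_R_NormedModule)
    (fun t => (f (curve p t) * deriv_on whole 1 (curve p) t)%C)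
    (end_filter (start p)) (end_filter (finish p)) v.

Fixpoint is_contour_int (g : contour) (f : C -> C) (v : C) : Prop :=
  match g with
  | nil => v = RtoC 0
  | p :: g' => exists v1 v2,
      is_path_int p f v1 /\ is_contour_int g' f v2 /\ v = (v1 + v2)%C
  end.

(** ** Type II augmented eigenfunctions *)

Definition typeII_augmented_eigenfunctions (a b : Rbar) (X : fun_space)
    (Phi : (R -> C) -> Prop) (L : (R -> C) -> (R -> C))
    (gamma : contour) (E : C -> functional) (z : C -> C) : Prop :=
  linear_operator (clitv a b) Phi X L /\
  (forall lam, on_contour gamma lam -> dual X (E lam)) /\
  exists Rem : C -> functional,
    (forall lam, on_contour gamma lam -> dual X (Rem lam)) /\
    (forall phi lam, Phi phi -> on_contour gamma lam ->
       E lam (L phi) = (z lam * E lam phi + Rem lam phi)%C) /\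
    (forall phi x, Phi phi -> itv a b x ->
       is_contour_int gamma
         (fun lam => Cexp (Ci * lam * x) / z lam * Rem lam phi)%C (RtoC 0)).

(** The family {Fp_lam : lam in gp} U {Fm_lam : lam in gm}, for contours [gp]
    and [gm] without common point (see [fi_Gamma_disjoint] and
    [hl_Gamma_disjoint] for the two uses). *)
Definition union_family (gp : contour) (Fp Fm : C -> functional) : C -> functional :=
  fun lam => if excluded_middle_informative (on_contour gp lam) then Fp lam else Fm lam.

(** (-i d/dx)^3 f = i f''', since (-i)^3 = i. *)
Definition opS (D : R -> Prop) (f : R -> C) : R -> C :=
  fun x => (Ci * deriv_on D 3 f x)%C.

(** ** Contours *)

Definition ray (th : R) (t : R) : C := (t * Cexp (Ci * th))%C.
Definition circ (r : R) (t : R) : C := (r * Cexp (Ci * t))%C.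

(** Boundary of {th1 < arg lam < th2, |lam| > 1} with this domain on its left:
    in along the ray at [th2], clockwise along the unit circle, out along the
    ray at [th1]. *)
Definition sector_boundary (th1 th2 : R) : contour :=
  [ Path (ray th2) p_infty 1;
    Path (circ 1) th2 th1;
    Path (ray th1) 1 p_infty ].

(** The oriented boundaries of the next three domains are the contours below;
    see [fi_Gamma_p_spec], [fi_Gamma_m_spec] and [hl_Gamma_p_spec]. *)
Definition fi_Dp (lam : C) : Prop := 0 < Im lam /\ Im (lam * lam * lam)%C > 0 /\ Cmod lam > 1.
Definition fi_Dm (lam : C) : Prop := Im lam < 0 /\ Im (lam * lam * lam)%C > 0 /\ Cmod lam > 1.
Definition hl_Dp (lam : C) : Prop :=
  0 < Im lam /\ Re (- Ci * (lam * lam * lam))%C < 0 /\ Cmod lam > 1.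

Definition fi_Gamma_p : contour :=
  sector_boundary 0 (PI / 3) ++ sector_boundary (2 * PI / 3) PI.
Definition fi_Gamma_m : contour := sector_boundary (4 * PI / 3) (5 * PI / 3).

Definition hl_Gamma_p : contour := sector_boundary (PI / 3) (2 * PI / 3).

Definition hl_Gamma_m (rho : R) : contour :=
  [ Path RtoC m_infty (- rho);
    Path (circ rho) PI 0;
    Path RtoC rho p_infty ].

(** ** Finite interval *)

Definition unit_itv : R -> Prop := clitv 0 1.

Definition Cinf01 : fun_space := {|
  carrier := smooth_on unit_itv;
  sn_index := nat;
  seminorm := fun k f => sup_on unit_itv (fun x => Cmod (deriv_on unit_itv k f x))
|}.

Definition fi_Phi (f : R -> C) : Prop :=
  carrier Cinf01 f /\ f 0 = RtoC 0 /\ f 1 = RtoC 0 /\ deriv_on unit_itv 1 f 1 = RtoC 0.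

Definition Delta (lam : C) : C :=
  (Cexp (- Ci * lam) + alpha * Cexp (- Ci * alpha * lam)
   + alpha * alpha * Cexp (- Ci * (alpha * alpha) * lam))%C.

Definition fi_phi_p (x : R) (lam : C) : C :=
  (/ (2 * PI * Delta lam) *
   (Cexp (- Ci * lam * x) *
      (alpha * Cexp (- Ci * alpha * lam)
       + alpha * alpha * Cexp (- Ci * (alpha * alpha) * lam))
    - (alpha * Cexp (- Ci * alpha * lam * x)
       + alpha * alpha * Cexp (- Ci * (alpha * alpha) * lam * x))
      * Cexp (- Ci * lam)))%C.

Definition fi_phi_m (x : R) (lam : C) : C :=
  (- Cexp (- Ci * lam) / (2 * PI * Delta lam) *
   (Cexp (- Ci * lam * x) + alpha * Cexp (- Ci * alpha * lam * x)
    + alpha * alpha * Cexp (- Ci * (alpha * alpha) * lam * x)))%C.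

Definition int01 (h : R -> C) : C := RInt (V := C_R_CompleteNormedModule) h 0 1.

Definition fi_F_p (lam : C) : functional := fun f => int01 (fun x => fi_phi_p x lam * f x)%C.
Definition fi_F_m (lam : C) : functional := fun f => int01 (fun x => fi_phi_m x lam * f x)%C.

(** ** Half-line *)

Definition half_line : R -> Prop := clitv 0 p_infty.

Definition schwartz (g : R -> C) : Prop :=
  smooth_on whole g /\
  forall m k : nat, exists K : R, forall x : R,
    Rabs x ^ m * Cmod (deriv_on whole k g x) <= K.

Definition schwartz_half (f : R -> C) : Prop :=
  exists g, schwartz g /\ forall x, half_line x -> f x = g x.

Definition bigO_exp (c : R) (f : R -> C) : Prop :=
  exists K X : R, forall x : R, X <= x -> half_line x -> Cmod (f x) <= K * exp (- c * x).

Definition Eexp (eps : R) (f : R -> C) : Prop := schwartz_half f /\ bigO_exp eps f.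

Definition hl_Phi (eps : R) (f : R -> C) : Prop := Eexp eps f /\ f 0 = RtoC 0.

(** The ambient space: a subspace of the Schwartz class on the half-line.  Some
    exponential decay is needed for the functionals attached to the semicircle
    of [hl_Gamma_m] to be defined; on the other hand f = O(exp (- eps x)) does
    not pass to derivatives of f, which are only O(exp (- c x)) for all
    c < eps. *)
Definition Shalf (eps : R) : fun_space := {|
  carrier := fun f => schwartz_half f /\ forall c, c < eps -> bigO_exp c f;
  sn_index := (nat * nat + {c : R | c < eps})%type;
  seminorm := fun i f =>
    match i with
    | inl (m, k) => sup_on half_line (fun x => x ^ m * Cmod (deriv_on half_line k f x))
    | inr c => sup_on half_line (fun x => exp (proj1_sig c * x) * Cmod (f x))
    end
|}.

Definition hl_phi_p (x : R) (lam : C) : C :=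
  (/ (2 * PI) * (alpha * Cexp (- Ci * alpha * lam * x)
                 + alpha * alpha * Cexp (- Ci * (alpha * alpha) * lam * x)))%C.

Definition hl_phi_m (x : R) (lam : C) : C :=
  (/ (2 * PI) * Cexp (- Ci * lam * x))%C.

Definition int_half_line (h : R -> C) : C :=
  RInt_gen (V := C_R_CompleteNormedModule) h (at_point 0) (Rbar_locally p_infty).

Definition hl_F_p (lam : C) : functional :=
  fun f => int_half_line (fun x => hl_phi_p x lam * f x)%C.
Definition hl_F_m (lam : C) : functional :=
  fun f => int_half_line (fun x => hl_phi_m x lam * f x)%C.

(** ** The contours as oriented boundaries *)

Definition frontier (D : C -> Prop) (z : C) : Prop :=
  forall e : R, 0 < e ->
    (exists w, Cmod (w - z) < e /\ D w) /\ (exists w, Cmod (w - z) < e /\ ~ D w).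

(** The contour traces the topological boundary of [D], and at every interior
    parameter of each of its paths a short step to the left of the direction of
    travel enters [D]. *)
Definition oriented_boundary (D : C -> Prop) (g : contour) : Prop :=
  (forall z, on_contour g z <-> frontier D z) /\
  (forall p t, In p g ->
     (itv (start p) (finish p) t ->
      exists d : R, 0 < d /\ forall s : R, 0 < s < d ->
        D (curve p t + s * (Ci * deriv_on whole 1 (curve p) t))%C) /\
     (itv (finish p) (start p) t ->
      exists d : R, 0 < d /\ forall s : R, 0 < s < d ->
        D (curve p t + s * (Ci * - deriv_on whole 1 (curve p) t))%C)).

Lemma is_deriv_on_whole (f : R -> C) (x : R) (l : C) :
  is_deriv_on whole f x l <-> is_derive (V := C_R_NormedModule) f x l.
Proof.
assert (HW : forall P, within whole (locally x) P <-> locally x P).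
{ intros P; unfold within; split; apply filter_imp; [intros y H; apply H; exact I | now intros]. }
unfold is_deriv_on, is_derive, filterdiff; split; intros [Hl H]; split; trivial;
  intros y Hy eps.
- apply HW, H; intros P HP; apply HW, Hy, HP.
- apply HW, H; intros P HP; apply HW, Hy, HP.
Qed.

Lemma is_derive_C_unique (f : R -> C) (x : R) (l1 l2 : C) :
  is_derive (V := C_R_NormedModule) f x l1 ->
  is_derive (V := C_R_NormedModule) f x l2 -> l1 = l2.
Proof.
intros H1 H2.
assert (Hf : forall l : C, is_derive (V := C_R_NormedModule) f x l ->
   is_derive (fun t => fst (f t)) x (fst l) /\ is_derive (fun t => snd (f t)) x (snd l)).
{ intros l Hl; split.
  - apply (filterdiff_comp' (U := R_NormedModule) (V := C_R_NormedModule) (W := R_NormedModule)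
      f (fun z => fst z) x _ (fun z => fst z) Hl).
    apply filterdiff_linear, is_linear_fst.
  - apply (filterdiff_comp' (U := R_NormedModule) (V := C_R_NormedModule) (W := R_NormedModule)
      f (fun z => snd z) x _ (fun z => snd z) Hl).
    apply filterdiff_linear, is_linear_snd. }
destruct (Hf _ H1) as [A1 B1], (Hf _ H2) as [A2 B2].
apply is_derive_unique in A1; apply is_derive_unique in A2.
apply is_derive_unique in B1; apply is_derive_unique in B2.
destruct l1, l2; simpl in *; congruence.
Qed.

Lemma deriv_on_whole_1 (f : R -> C) (x : R) (l : C) :
  is_derive (V := C_R_NormedModule) f x l -> deriv_on whole 1 f x = l.
Proof.
intros H; apply (iota_unique (V := C_R_CompleteNormedModule)).
- intros y Hy; apply (is_derive_C_unique f x); trivial; now apply is_deriv_on_whole.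
- now apply is_deriv_on_whole.
Qed.

Lemma is_derive_pair (f g : R -> R) (x a b : R) :
  is_derive f x a -> is_derive g x b ->
  is_derive (V := C_R_NormedModule) (fun t => (f t, g t)) x (a, b).
Proof.
intros Hf Hg.
assert (E : forall u v : R,
  plus (scal u ((1, 0) : C_R_NormedModule)) (scal v ((0, 1) : C_R_NormedModule)) = (u, v)).
{ intros u v; unfold plus, scal; simpl; unfold prod_plus, prod_scal; simpl.
  unfold plus, scal; simpl; unfold mult; simpl; f_equal; ring. }
rewrite <- (E a b).
apply (is_derive_ext (fun t =>
  plus (scal (f t) ((1, 0) : C_R_NormedModule)) (scal (g t) ((0, 1) : C_R_NormedModule)))).
{ intros t; apply E. }
apply (is_derive_plus (V := C_R_NormedModule)); now apply (is_derive_scal_l (V := C_R_NormedModule)).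
Qed.

Lemma Cexp_i (t : R) : Cexp (Ci * t)%C = (cos t, sin t).
Proof.
unfold Cexp; simpl.
replace (0 * t - 1 * 0) with 0 by ring; replace (0 * 0 + 1 * t) with t by ring.
rewrite exp_0; f_equal; ring.
Qed.

Lemma ray_pair (th t : R) : ray th t = (t * cos th, t * sin th).
Proof. unfold ray; rewrite Cexp_i; unfold Cmult; simpl; f_equal; ring. Qed.

Lemma circ_pair (r t : R) : circ r t = (r * cos t, r * sin t).
Proof. unfold circ; rewrite Cexp_i; unfold Cmult; simpl; f_equal; ring. Qed.

Lemma deriv_ray (th t : R) : deriv_on whole 1 (ray th) t = (cos th, sin th).
Proof.
apply deriv_on_whole_1.
apply (is_derive_ext (fun t => (t * cos th, t * sin th) : C_R_NormedModule)).
{ intros u; symmetry; apply ray_pair. }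
apply is_derive_pair; auto_derive; trivial; ring.
Qed.

Lemma deriv_circ (r t : R) : deriv_on whole 1 (circ r) t = (- r * sin t, r * cos t).
Proof.
apply deriv_on_whole_1.
apply (is_derive_ext (fun t => (r * cos t, r * sin t) : C_R_NormedModule)).
{ intros u; symmetry; apply circ_pair. }
apply is_derive_pair; auto_derive; trivial; ring.
Qed.

(** The sector th < arg < th + pi/3, |z| > 1, by linear inequalities. *)
Definition side (th : R) (z : C) : R := cos th * Im z - sin th * Re z.
Definition sec (th : R) (z : C) : Prop :=
  0 < side th z /\ side (th + PI / 3) z < 0 /\ 1 < Cmod z.
Definition csec (th : R) (z : C) : Prop :=
  0 <= side th z /\ side (th + PI / 3) z <= 0 /\ 1 <= Cmod z.

Lemma Cmod_sqr (z : C) : Cmod z * Cmod z = Re z * Re z + Im z * Im z.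
Proof.
unfold Cmod; rewrite sqrt_sqrt; unfold Re, Im; [ring | nra].
Qed.

Lemma Cmod_gt_1 (z : C) : 1 < Cmod z <-> 1 < Re z * Re z + Im z * Im z.
Proof. rewrite <- Cmod_sqr; assert (H := Cmod_ge_0 z); split; nra. Qed.

Lemma Cmod_ge_1 (z : C) : 1 <= Cmod z <-> 1 <= Re z * Re z + Im z * Im z.
Proof. rewrite <- Cmod_sqr; assert (H := Cmod_ge_0 z); split; nra. Qed.

Lemma cs1 (t : R) : cos t * cos t + sin t * sin t = 1.
Proof. generalize (sin2_cos2 t); unfold Rsqr; lra. Qed.

Lemma side_lip (th : R) (z w : C) : Rabs (side th w - side th z) <= Cmod (w - z).
Proof.
assert (H := Cmod_sqr (w - z)%C); assert (H0 := Cmod_ge_0 (w - z)%C).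
assert (Hc := cs1 th).
replace (side th w - side th z) with (side th (w - z)%C)
  by (unfold side, Re, Im; simpl; ring).
unfold side; set (a := Re (w - z)%C) in *; set (b := Im (w - z)%C) in *.
rewrite <- (Rabs_pos_eq (Cmod (w - z))) by assumption.
apply Rsqr_le_abs_0; unfold Rsqr.
assert (0 <= (cos th * a + sin th * b) * (cos th * a + sin th * b)) by apply Rle_0_sqr.
replace (Cmod (w - z) * Cmod (w - z)) with
  ((a * a + b * b) * (cos th * cos th + sin th * sin th)) by (rewrite Hc; lra).
lra.
Qed.

Lemma Cmod_lip (z w : C) : Rabs (Cmod w - Cmod z) <= Cmod (w - z).
Proof.
apply Rabs_le; split.
- assert (H := Cmod_triangle (z - w)%C w).
  replace (z - w + w)%C with z in H by ring.
  replace (z - w)%C with (- (w - z))%C in H by ring; rewrite Cmod_opp in H; lra.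
- assert (H := Cmod_triangle (w - z)%C z).
  replace (w - z + z)%C with w in H by ring; lra.
Qed.

Lemma side_shift (th : R) (z : C) :
  side (th + PI / 3) z
  = / 2 * side th z - sqrt 3 / 2 * (cos th * Re z + sin th * Im z).
Proof.
unfold side; rewrite cos_plus, sin_plus, cos_PI3, sin_PI3; field.
Qed.

Lemma sec_open (th : R) (z : C) :
  sec th z -> exists e, 0 < e /\ forall w, Cmod (w - z) < e -> sec th w.
Proof.
intros (H1 & H2 & H3).
exists (Rmin (side th z) (Rmin (- side (th + PI / 3) z) (Cmod z - 1))); split.
{ repeat apply Rmin_glb_lt; lra. }
intros w Hw.
assert (A := Rmin_l (side th z) (Rmin (- side (th + PI / 3) z) (Cmod z - 1))).
assert (B := Rmin_r (side th z) (Rmin (- side (th + PI / 3) z) (Cmod z - 1))).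
assert (B1 := Rmin_l (- side (th + PI / 3) z) (Cmod z - 1)).
assert (B2 := Rmin_r (- side (th + PI / 3) z) (Cmod z - 1)).
assert (L1 := side_lip th z w); assert (L2 := side_lip (th + PI / 3) z w).
assert (L3 := Cmod_lip z w).
apply Rabs_le_between in L1; apply Rabs_le_between in L2; apply Rabs_le_between in L3.
repeat split; lra.
Qed.

Lemma csec_closed (th : R) (z : C) :
  (forall e, 0 < e -> exists w, Cmod (w - z) < e /\ sec th w) -> csec th z.
Proof.
intros H.
repeat split; apply Rnot_lt_le; intros Hn;
  [ destruct (H (- side th z)) as (w & Hw & W1 & W2 & W3)
  | destruct (H (side (th + PI / 3) z)) as (w & Hw & W1 & W2 & W3)
  | destruct (H (1 - Cmod z)) as (w & Hw & W1 & W2 & W3) ]; try lra;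
  assert (L1 := side_lip th z w); assert (L2 := side_lip (th + PI / 3) z w);
  assert (L3 := Cmod_lip z w);
  apply Rabs_le_between in L1; apply Rabs_le_between in L2; apply Rabs_le_between in L3;
  lra.
Qed.

Lemma csec_dense (th : R) (z : C) : csec th z ->
  forall e, 0 < e -> exists w, Cmod (w - z) < e /\ sec th w.
Proof.
intros (H1 & H2 & H3) e He.
assert (S3 : sqrt 3 * sqrt 3 = 3) by (apply sqrt_sqrt; lra).
assert (S0 : 0 < sqrt 3) by (apply sqrt_lt_R0; lra).
set (v := (cos th + cos (th + PI / 3), sin th + sin (th + PI / 3)) : C).
assert (Hv : side th v = sqrt 3 / 2 /\ side (th + PI / 3) v = - (sqrt 3 / 2)).
{ assert (E := cs1 th).
  split; unfold side, v, Re, Im; simpl; rewrite cos_plus, sin_plus, cos_PI3, sin_PI3.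
  - transitivity (sqrt 3 / 2 * (cos th * cos th + sin th * sin th)); [field | rewrite E; ring].
  - transitivity (- (sqrt 3 / 2) * (cos th * cos th + sin th * sin th)); [field | rewrite E; ring]. }
destruct Hv as [Hv1 Hv2].
set (s := e / (2 * (Cmod v + 1))).
assert (V0 := Cmod_ge_0 v).
assert (Hs : 0 < s) by (apply Rdiv_lt_0_compat; lra).
assert (L : forall t, side t (z + s * v)%C = side t z + s * side t v)
  by (intros t; unfold side, Re, Im; simpl; ring).
exists (z + s * v)%C; split.
{ replace (z + s * v - z)%C with (s * v)%C by ring.
  rewrite Cmod_mult, Cmod_R, Rabs_pos_eq by lra.
  assert (s * (2 * (Cmod v + 1)) = e) by (unfold s; field; lra).
  nra. }
repeat split; [rewrite L; nra | rewrite L; nra |].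
apply Cmod_gt_1; apply Cmod_ge_1 in H3.
assert (Hin : 0 <= Re z * Re v + Im z * Im v).
{ rewrite side_shift in H2.
  replace (Re z * Re v + Im z * Im v) with
    (3 / 2 * (cos th * Re z + sin th * Im z) + sqrt 3 / 2 * side th z).
  2:{ unfold side, v, Re, Im; simpl; rewrite cos_plus, sin_plus, cos_PI3, sin_PI3; field. }
  assert (0 <= cos th * Re z + sin th * Im z) by nra.
  nra. }
assert (Hvv : 0 < Re v * Re v + Im v * Im v).
{ assert (0 <= Re v * Re v) by nra; assert (0 <= Im v * Im v) by nra.
  destruct (Req_dec (Re v * Re v + Im v * Im v) 0) as [E|E]; [|lra].
  assert (V1 : Re v = 0) by nra; assert (V2 : Im v = 0) by nra.
  unfold side in Hv1; rewrite V1, V2 in Hv1; lra. }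
replace (Re (z + s * v)%C) with (Re z + s * Re v) by (unfold Re, Im; simpl; ring).
replace (Im (z + s * v)%C) with (Im z + s * Im v) by (unfold Re, Im; simpl; ring).
assert (0 < s * s) by nra.
nra.
Qed.

Lemma Re_Im_pair (z : C) : z = (Re z, Im z).
Proof. now destruct z. Qed.

Lemma polar_side (th d : R) :
  side th (cos (th + d), sin (th + d)) = sin d.
Proof.
unfold side, Re, Im; simpl; rewrite cos_plus, sin_plus.
transitivity (sin d * (cos th * cos th + sin th * sin th)); [ring | rewrite cs1; ring].
Qed.

Lemma on_sector_boundary (th : R) (z : C) :
  on_contour (sector_boundary th (th + PI / 3)) z <-> csec th z /\ ~ sec th z.
Proof.
assert (P3 := PI_RGT_0).
assert (S3 : sqrt 3 * sqrt 3 = 3) by (apply sqrt_sqrt; lra).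
assert (S0 : 0 < sqrt 3) by (apply sqrt_lt_R0; lra).
assert (SR : forall u t r, side u (ray t r) = r * sin (t - u)).
{ intros u t r; rewrite ray_pair; unfold side, Re, Im; simpl; rewrite sin_minus; ring. }
assert (MR : forall t r, Re (ray t r) * Re (ray t r) + Im (ray t r) * Im (ray t r) = r * r).
{ intros t r; rewrite ray_pair; unfold Re, Im; simpl.
  transitivity (r * r * (cos t * cos t + sin t * sin t)); [ring | rewrite cs1; ring]. }
split.
- intros (p & [<-|[<-|[<-|[]]]] & t & Ht & ->); simpl in Ht |- *.
  + assert (1 <= t) by (unfold clitv in Ht; simpl in Ht; tauto).
    assert (E : side (th + PI / 3) (ray (th + PI / 3) t) = 0)
      by (rewrite SR, Rminus_diag, sin_0; ring).
    split; [|intros (_ & H2 & _); lra].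
    repeat split; [|lra|apply Cmod_ge_1; rewrite MR; nra].
    rewrite SR; replace (th + PI / 3 - th) with (PI / 3) by ring; rewrite sin_PI3; nra.
  + assert (th <= t <= th + PI / 3) by (unfold clitv in Ht; simpl in Ht; lra).
    assert (M : Re (circ 1 t) * Re (circ 1 t) + Im (circ 1 t) * Im (circ 1 t) = 1)
      by (change (circ 1 t) with (ray t 1); rewrite MR; ring).
    split; [|intros (_ & _ & H3); apply Cmod_gt_1 in H3; lra].
    change (circ 1 t) with (ray t 1) in *.
    repeat split; [rewrite SR| rewrite SR | apply Cmod_ge_1; lra].
    * assert (0 <= sin (t - th)) by (apply sin_ge_0; lra); lra.
    * assert (0 <= sin (- (t - (th + PI / 3)))) by (apply sin_ge_0; lra).
      rewrite sin_neg in H0; lra.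
  + assert (1 <= t) by (unfold clitv in Ht; simpl in Ht; tauto).
    assert (E : side th (ray th t) = 0) by (rewrite SR, Rminus_diag, sin_0; ring).
    split; [|intros (H2 & _ & _); lra].
    repeat split; [lra| |apply Cmod_ge_1; rewrite MR; nra].
    rewrite SR; replace (th - (th + PI / 3)) with (- (PI / 3)) by ring.
    rewrite sin_neg, sin_PI3; nra.
- intros [(H1 & H2 & H3) Hn].
  assert (Hp : forall u, let p := cos u * Re z + sin u * Im z in
     Re z = p * cos u - side u z * sin u /\ Im z = p * sin u + side u z * cos u /\
     Re z * Re z + Im z * Im z = p * p + side u z * side u z).
  { intros u p; unfold p, side; assert (E := cs1 u); repeat split.
    - transitivity (Re z * (cos u * cos u + sin u * sin u)); [rewrite E|]; ring.
    - transitivity (Im z * (cos u * cos u + sin u * sin u)); [rewrite E|]; ring.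
    - transitivity ((Re z * Re z + Im z * Im z) * (cos u * cos u + sin u * sin u));
        [rewrite E|]; ring. }
  assert (H3' := proj1 (Cmod_ge_1 z) H3).
  destruct (Req_dec (side th z) 0) as [E1|E1].
  { exists (Path (ray th) 1 p_infty); split; [simpl; tauto|].
    destruct (Hp th) as (A & B & D).
    set (p := cos th * Re z + sin th * Im z) in *.
    rewrite side_shift in H2; fold p in H2; rewrite E1 in *.
    exists p; split.
    - left; split; simpl; trivial. assert (0 <= p) by nra. nra.
    - simpl; rewrite ray_pair, (Re_Im_pair z), A, B; f_equal; ring. }
  destruct (Req_dec (side (th + PI / 3) z) 0) as [E2|E2].
  { exists (Path (ray (th + PI / 3)) p_infty 1); split; [simpl; tauto|].
    assert (Q : cos (th + PI / 3) * Re z + sin (th + PI / 3) * Im z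
      = / 2 * (cos th * Re z + sin th * Im z) + sqrt 3 / 2 * side th z).
    { unfold side; rewrite cos_plus, sin_plus, cos_PI3, sin_PI3; field. }
    assert (E2' := E2); rewrite side_shift in E2'.
    destruct (Hp (th + PI / 3)) as (A & B & D).
    set (p := cos (th + PI / 3) * Re z + sin (th + PI / 3) * Im z) in *.
    rewrite E2 in *.
    exists p; split.
    - right; split; simpl; trivial.
      assert (0 <= cos th * Re z + sin th * Im z) by nra.
      assert (0 <= p) by nra. nra.
    - simpl; rewrite ray_pair, (Re_Im_pair z), A, B; f_equal; ring. }
  assert (M1 : Re z * Re z + Im z * Im z = 1).
  { destruct (Req_dec (Re z * Re z + Im z * Im z) 1) as [E|E]; trivial.
    exfalso; apply Hn; repeat split; try lra. apply Cmod_gt_1; lra. }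
  exists (Path (circ 1) (th + PI / 3) th); split; [simpl; tauto|].
  destruct (Hp th) as (A & B & D).
  set (p := cos th * Re z + sin th * Im z) in *.
  assert (Hb : -1 <= p <= 1) by nra.
  set (d := acos p).
  assert (Hd := acos_bound p); fold d in Hd.
  assert (Cd : cos d = p) by (apply cos_acos; lra).
  assert (Sd : sin d = side th z).
  { assert (0 <= sin d) by (apply sin_ge_0; lra).
    assert (Ed := cs1 d); rewrite Cd in Ed; nra. }
  assert (Z : z = (cos (th + d), sin (th + d))).
  { rewrite (Re_Im_pair z), A, B, cos_plus, sin_plus, Cd, Sd; f_equal; ring. }
  exists (th + d); split.
  + right; split; simpl; [lra|].
    destruct (Rle_or_lt d (PI / 3)) as [Hle|Hlt]; [lra|exfalso].
    rewrite Z in H2.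
    replace (th + d) with ((th + PI / 3) + (d - PI / 3)) in H2 by ring.
    rewrite polar_side in H2.
    assert (0 < sin (d - PI / 3)) by (apply sin_gt_0; lra). lra.
  + simpl; rewrite circ_pair, Z; f_equal; ring.
Qed.

Lemma sector_left (th : R) (p : path) (t : R) :
  In p (sector_boundary th (th + PI / 3)) ->
  (itv (start p) (finish p) t ->
   exists d : R, 0 < d /\ forall s : R, 0 < s < d ->
     sec th (curve p t + s * (Ci * deriv_on whole 1 (curve p) t))%C) /\
  (itv (finish p) (start p) t ->
   exists d : R, 0 < d /\ forall s : R, 0 < s < d ->
     sec th (curve p t + s * (Ci * - deriv_on whole 1 (curve p) t))%C).
Proof.
assert (P3 := PI_RGT_0).
assert (S3 : sqrt 3 * sqrt 3 = 3) by (apply sqrt_sqrt; lra).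
assert (S0 : 0 < sqrt 3) by (apply sqrt_lt_R0; lra).
assert (S2 : sqrt 3 < 2) by nra.
intros [<-|[<-|[<-|[]]]]; split; intros [Ht1 Ht2];
  simpl in Ht1, Ht2; try easy; try lra; cbn [curve].
- exists (t / 2); split; [lra|]; intros s Hs.
  rewrite deriv_ray, ray_pair.
  assert (E := cs1 (th + PI / 3)).
  set (z := (_ + _)%C).
  assert (Ez : z = (t * cos (th + PI / 3) + s * sin (th + PI / 3),
                    t * sin (th + PI / 3) - s * cos (th + PI / 3))).
  { unfold z, Cmult, Cplus, Copp; simpl; f_equal; ring. }
  rewrite Ez; repeat split.
  + unfold side, Re, Im; simpl; rewrite cos_plus, sin_plus, cos_PI3, sin_PI3.
    assert (F := cs1 th).
    match goal with |- 0 < ?X => replace X with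
      ((t * sqrt 3 / 2 - s / 2) * (cos th * cos th + sin th * sin th)) by field end.
    rewrite F; assert (1 < sqrt 3) by nra; nra.
  + unfold side, Re, Im; simpl.
    match goal with |- ?X < 0 => replace X with
      (- s * (cos (th + PI / 3) * cos (th + PI / 3) + sin (th + PI / 3) * sin (th + PI / 3)))
      by ring end.
    rewrite E; lra.
  + apply Cmod_gt_1; unfold Re, Im; simpl.
    match goal with |- 1 < ?X => replace X with
      ((t * t + s * s) * (cos (th + PI / 3) * cos (th + PI / 3)
        + sin (th + PI / 3) * sin (th + PI / 3))) by ring end.
    rewrite E; nra.
- exists 1; split; [lra|]; intros s Hs.
  rewrite deriv_circ, circ_pair.
  set (z := (_ + _)%C).
  assert (Ez : z = ray t (1 + s)).
  { rewrite ray_pair; unfold z, Cmult, Cplus, Copp; simpl; f_equal; ring. }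
  rewrite Ez, ray_pair; repeat split.
  + unfold side, Re, Im; simpl.
    match goal with |- 0 < ?X => replace X with ((1 + s) * sin (t - th))
      by (rewrite sin_minus; ring) end.
    assert (0 < sin (t - th)) by (apply sin_gt_0; lra). nra.
  + unfold side, Re, Im; simpl.
    match goal with |- ?X < 0 => replace X with (- ((1 + s) * sin (th + PI / 3 - t)))
      by (rewrite (sin_minus (th + PI / 3)); ring) end.
    assert (0 < sin (th + PI / 3 - t)) by (apply sin_gt_0; lra). nra.
  + apply Cmod_gt_1; unfold Re, Im; simpl; assert (E := cs1 t).
    match goal with |- 1 < ?X => replace X with
      ((1 + s) * (1 + s) * (cos t * cos t + sin t * sin t)) by ring end.
    rewrite E; nra.
- exists (t / 2); split; [lra|]; intros s Hs.
  rewrite deriv_ray, ray_pair.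
  assert (E := cs1 th).
  set (z := (_ + _)%C).
  assert (Ez : z = (t * cos th - s * sin th, t * sin th + s * cos th)).
  { unfold z, Cmult, Cplus, Copp; simpl; f_equal; ring. }
  rewrite Ez; repeat split.
  + unfold side, Re, Im; simpl.
    match goal with |- 0 < ?X => replace X with
      (s * (cos th * cos th + sin th * sin th)) by ring end.
    rewrite E; lra.
  + unfold side, Re, Im; simpl; rewrite cos_plus, sin_plus, cos_PI3, sin_PI3.
    match goal with |- ?X < 0 => replace X with
      (- (t * sqrt 3 / 2 - s / 2) * (cos th * cos th + sin th * sin th)) by field end.
    rewrite E; assert (1 < sqrt 3) by nra; nra.
  + apply Cmod_gt_1; unfold Re, Im; simpl.
    match goal with |- 1 < ?X => replace X with
      ((t * t + s * s) * (cos th * cos th + sin th * sin th)) by ring end.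
    rewrite E; nra.
Qed.

Lemma frontier_sec (th : R) (D : C -> Prop) :
  (forall z, D z <-> sec th z) ->
  forall z, frontier D z <-> csec th z /\ ~ sec th z.
Proof.
intros HD z; split.
- intros H; split.
  + apply csec_closed; intros e He; destruct (H e He) as [(w & Hw & Dw) _].
    exists w; split; trivial; now apply HD.
  + intros Hs; destruct (sec_open th z Hs) as (e & He & Ho).
    destruct (H e He) as [_ (w & Hw & Dw)]; apply Dw, HD, Ho, Hw.
- intros [Hc Hs] e He; split.
  + destruct (csec_dense th z Hc e He) as (w & Hw & Sw).
    exists w; split; trivial; now apply HD.
  + exists z; split; [|now rewrite HD].
    replace (z - z)%C with (RtoC 0) by ring; now rewrite Cmod_0.
Qed.

Lemma frontier_sec2 (t1 t2 : R) (D : C -> Prop) :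
  (forall z, D z <-> sec t1 z \/ sec t2 z) ->
  (forall z, csec t1 z -> ~ sec t2 z) -> (forall z, csec t2 z -> ~ sec t1 z) ->
  forall z, frontier D z <-> (csec t1 z /\ ~ sec t1 z) \/ (csec t2 z /\ ~ sec t2 z).
Proof.
intros HD H12 H21 z; split.
- intros H.
  assert (N : ~ sec t1 z /\ ~ sec t2 z).
  { split; intros Hs; destruct (sec_open _ z Hs) as (e & He & Ho);
      destruct (H e He) as [_ (w & Hw & Dw)]; apply Dw, HD; auto. }
  destruct (excluded_middle_informative (csec t1 z)) as [C1|C1]; [tauto|].
  right; split; [|tauto].
  apply csec_closed; intros e He.
  apply NNPP; intros Hne; apply C1, csec_closed; intros e' He'.
  destruct (H (Rmin e e')) as [(w & Hw & Dw) _]; [now apply Rmin_glb_lt|].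
  assert (A := Rmin_l e e'); assert (B := Rmin_r e e').
  exists w; split; [lra|].
  apply HD in Dw; destruct Dw as [Dw|Dw]; trivial.
  exfalso; apply Hne; exists w; split; trivial; lra.
- intros H e He.
  assert (N : csec t1 z \/ csec t2 z) by tauto.
  assert (ND : ~ D z) by (rewrite HD; generalize (H12 z) (H21 z); tauto).
  split.
  + destruct N as [N|N]; destruct (csec_dense _ z N e He) as (w & Hw & Sw);
      exists w; split; trivial; apply HD; auto.
  + exists z; split; trivial.
    replace (z - z)%C with (RtoC 0) by ring; now rewrite Cmod_0.
Qed.

Lemma side_0 (z : C) : side 0 z = Im z.
Proof. unfold side; rewrite cos_0, sin_0; ring. Qed.

Lemma side_opp (th : R) (z : C) : side (th + PI) z = - side th z.
Proof. unfold side; rewrite neg_cos, neg_sin; ring. Qed.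

Lemma side_PI3 (z : C) : side (PI / 3) z = / 2 * Im z - sqrt 3 / 2 * Re z.
Proof. unfold side; rewrite cos_PI3, sin_PI3; field. Qed.

Lemma side_2PI3 (z : C) : side (2 * PI / 3) z = - / 2 * Im z - sqrt 3 / 2 * Re z.
Proof.
unfold side; replace (2 * PI / 3) with (PI - PI / 3) by field.
rewrite cos_minus, sin_minus, cos_PI, sin_PI, cos_PI3, sin_PI3; field.
Qed.

Lemma Im_cube (z : C) :
  Im (z * z * z)%C = Im z * (3 * (Re z * Re z) - Im z * Im z).
Proof. unfold Re, Im; simpl; ring. Qed.

Lemma sec_0 (z : C) :
  sec 0 z <-> 0 < Im z /\ / 2 * Im z - sqrt 3 / 2 * Re z < 0 /\ 1 < Cmod z.
Proof.
unfold sec; rewrite side_0; replace (0 + PI / 3) with (PI / 3) by ring.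
now rewrite side_PI3.
Qed.

Lemma sec_PI3 (z : C) :
  sec (PI / 3) z <-> 0 < / 2 * Im z - sqrt 3 / 2 * Re z /\
    - / 2 * Im z - sqrt 3 / 2 * Re z < 0 /\ 1 < Cmod z.
Proof.
unfold sec; rewrite side_PI3; replace (PI / 3 + PI / 3) with (2 * PI / 3) by field.
now rewrite side_2PI3.
Qed.

Lemma side_PI (z : C) : side PI z = - Im z.
Proof. replace PI with (0 + PI) by ring; now rewrite side_opp, side_0. Qed.

Lemma sec_2PI3 (z : C) :
  sec (2 * PI / 3) z <-> 0 < - / 2 * Im z - sqrt 3 / 2 * Re z /\ - Im z < 0 /\ 1 < Cmod z.
Proof.
unfold sec; rewrite side_2PI3; replace (2 * PI / 3 + PI / 3) with PI by field.
now rewrite side_PI.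
Qed.

Lemma sec_4PI3 (z : C) :
  sec (4 * PI / 3) z <-> 0 < - (/ 2 * Im z - sqrt 3 / 2 * Re z) /\
    - (- / 2 * Im z - sqrt 3 / 2 * Re z) < 0 /\ 1 < Cmod z.
Proof.
unfold sec; replace (4 * PI / 3) with (PI / 3 + PI) by field.
replace (PI / 3 + PI + PI / 3) with (2 * PI / 3 + PI) by field.
now rewrite !side_opp, side_PI3, side_2PI3.
Qed.

Lemma on_contour_app (g h : contour) (z : C) :
  on_contour (g ++ h) z <-> on_contour g z \/ on_contour h z.
Proof.
unfold on_contour; split.
- intros (p & Hp & Hz); apply in_app_iff in Hp; destruct Hp; eauto.
- intros [(p & Hp & Hz)|(p & Hp & Hz)]; exists p; rewrite in_app_iff; auto.
Qed.

Lemma sqr_lt (a b : R) : 0 <= b -> a * a < b * b -> a < b.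
Proof. intros H1 H2; apply Rnot_le_lt; intros H; nra. Qed.

Lemma fi_Gamma_p_spec : oriented_boundary fi_Dp fi_Gamma_p.
Proof.
assert (S3 : sqrt 3 * sqrt 3 = 3) by (apply sqrt_sqrt; lra).
assert (S0 : 0 < sqrt 3) by (apply sqrt_lt_R0; lra).
assert (HD : forall z, fi_Dp z <-> sec 0 z \/ sec (2 * PI / 3) z).
{ intros z; unfold fi_Dp; rewrite Im_cube, sec_0, sec_2PI3.
  set (x := Re z); set (y := Im z).
  assert (Hw : (sqrt 3 * x) * (sqrt 3 * x) = 3 * (x * x))
    by (transitivity ((sqrt 3 * sqrt 3) * (x * x)); [ring | now rewrite S3]).
  split.
  - intros (H1 & H2 & H3).
    assert (0 < 3 * (x * x) - y * y)
      by (apply (Rmult_lt_reg_l y); lra).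
    destruct (Rle_or_lt 0 x).
    + left; repeat split; try lra. assert (y < sqrt 3 * x) by (apply sqr_lt; nra); lra.
    + right; repeat split; try lra. assert (y < - (sqrt 3 * x)) by (apply sqr_lt; nra); lra.
  - intros [(H1 & H2 & H3)|(H1 & H2 & H3)]; repeat split; try lra;
      apply Rmult_lt_0_compat; try lra.
    + assert (y < sqrt 3 * x) by lra; nra.
    + assert (y < - (sqrt 3 * x)) by lra; nra. }
assert (E : fi_Gamma_p =
  sector_boundary 0 (0 + PI / 3) ++ sector_boundary (2 * PI / 3) (2 * PI / 3 + PI / 3)).
{ unfold fi_Gamma_p; f_equal; f_equal; field. }
rewrite E; split.
- intros z; rewrite (frontier_sec2 _ _ _ HD), <- !on_sector_boundary.
  + apply on_contour_app.
  + intros w (H1 & H2 & H3); rewrite sec_2PI3; intros (K1 & K2 & K3).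
    rewrite side_0 in H1; replace (0 + PI / 3) with (PI / 3) in H2 by ring.
    rewrite side_PI3 in H2; lra.
  + intros w (H1 & H2 & H3); rewrite sec_0; intros (K1 & K2 & K3).
    rewrite side_2PI3 in H1; lra.
- intros p t Hp; apply in_app_iff in Hp; destruct Hp as [Hp|Hp];
    destruct (sector_left _ p t Hp) as [A B]; split; intros Ht;
    [destruct (A Ht) as (d & Hd & K) | destruct (B Ht) as (d & Hd & K)
    |destruct (A Ht) as (d & Hd & K) | destruct (B Ht) as (d & Hd & K)];
    exists d; split; trivial; intros s Hs; apply HD; auto.
Qed.

Lemma oriented_boundary_sector (th : R) (D : C -> Prop) :
  (forall z, D z <-> sec th z) -> oriented_boundary D (sector_boundary th (th + PI / 3)).
Proof.
intros HD; split.
- intros z; now rewrite (frontier_sec _ _ HD), <- on_sector_boundary.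
- intros p t Hp; destruct (sector_left _ p t Hp) as [A B]; split; intros Ht;
    [destruct (A Ht) as (d & Hd & K) | destruct (B Ht) as (d & Hd & K)];
    exists d; split; trivial; intros s Hs; apply HD; auto.
Qed.

Lemma fi_Gamma_m_spec : oriented_boundary fi_Dm fi_Gamma_m.
Proof.
assert (S3 : sqrt 3 * sqrt 3 = 3) by (apply sqrt_sqrt; lra).
assert (S0 : 0 < sqrt 3) by (apply sqrt_lt_R0; lra).
unfold fi_Gamma_m; replace (5 * PI / 3) with (4 * PI / 3 + PI / 3) by field.
apply oriented_boundary_sector; intros z; unfold fi_Dm; rewrite Im_cube, sec_4PI3.
set (x := Re z); set (y := Im z).
assert (Hw : (sqrt 3 * x) * (sqrt 3 * x) = 3 * (x * x))
    by (transitivity ((sqrt 3 * sqrt 3) * (x * x)); [ring | now rewrite S3]).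
split.
- intros (H1 & H2 & H3).
  assert (3 * (x * x) < y * y) by nra.
  assert (sqrt 3 * x < - y) by (apply sqr_lt; lra).
  assert (- (sqrt 3 * x) < - y) by (apply sqr_lt; lra).
  repeat split; lra.
- intros (H1 & H2 & H3); repeat split; try lra.
  assert (sqrt 3 * x < - y) by lra; assert (- (sqrt 3 * x) < - y) by lra.
  assert (3 * (x * x) < y * y) by nra. nra.
Qed.

Lemma hl_Gamma_p_spec : oriented_boundary hl_Dp hl_Gamma_p.
Proof.
assert (S3 : sqrt 3 * sqrt 3 = 3) by (apply sqrt_sqrt; lra).
assert (S0 : 0 < sqrt 3) by (apply sqrt_lt_R0; lra).
unfold hl_Gamma_p; replace (2 * PI / 3) with (PI / 3 + PI / 3) by field.
apply oriented_boundary_sector; intros z; unfold hl_Dp.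
replace (Re (- Ci * (z * z * z))%C) with (Im (z * z * z)%C)
  by (unfold Re, Im; simpl; ring).
rewrite Im_cube, sec_PI3.
set (x := Re z); set (y := Im z).
assert (Hw : (sqrt 3 * x) * (sqrt 3 * x) = 3 * (x * x))
    by (transitivity ((sqrt 3 * sqrt 3) * (x * x)); [ring | now rewrite S3]).
split.
- intros (H1 & H2 & H3).
  assert (3 * (x * x) < y * y) by nra.
  assert (sqrt 3 * x < y) by (apply sqr_lt; lra).
  assert (- (sqrt 3 * x) < y) by (apply sqr_lt; lra).
  repeat split; lra.
- intros (H1 & H2 & H3); repeat split; try lra.
  assert (sqrt 3 * x < y) by lra; assert (- (sqrt 3 * x) < y) by lra.
  assert (3 * (x * x) < y * y) by nra. nra.
Qed.

(** ** Disjointness of the contours in [union_family] *)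

Lemma fi_Gamma_disjoint (z : C) : on_contour fi_Gamma_p z -> ~ on_contour fi_Gamma_m z.
Proof.
assert (S0 : 0 < sqrt 3) by (apply sqrt_lt_R0; lra).
unfold fi_Gamma_p, fi_Gamma_m.
replace (PI / 3) with (0 + PI / 3) by ring.
replace PI with (2 * PI / 3 + PI / 3) at 3 by field.
replace (5 * PI / 3) with (4 * PI / 3 + PI / 3) by field.
intros (p & Hp & Hz) Hm.
assert (H : 0 <= Im z).
{ apply in_app_iff in Hp; destruct Hp as [Hp|Hp].
  - assert (H : on_contour (sector_boundary 0 (0 + PI / 3)) z) by (exists p; auto).
    apply on_sector_boundary in H; destruct H as [(H & _) _]; now rewrite side_0 in H.
  - assert (H : on_contour (sector_boundary (2 * PI / 3) (2 * PI / 3 + PI / 3)) z)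
      by (exists p; auto).
    apply on_sector_boundary in H; destruct H as [(_ & H & _) _].
    replace (2 * PI / 3 + PI / 3) with PI in H by field; rewrite side_PI in H; lra. }
apply on_sector_boundary in Hm; destruct Hm as [(H1 & H2 & H3) _].
replace (4 * PI / 3 + PI / 3) with (2 * PI / 3 + PI) in H2 by field.
replace (4 * PI / 3) with (PI / 3 + PI) in H1 by field.
rewrite side_opp in H1, H2; rewrite side_PI3 in H1; rewrite side_2PI3 in H2.
apply Cmod_ge_1 in H3.
assert (I0 : Im z = 0) by lra.
assert (R0 : sqrt 3 * Re z = 0) by lra.
apply Rmult_integral in R0; destruct R0 as [R0|R0]; [lra|].
rewrite I0, R0 in H3; lra.
Qed.

Lemma hl_Gamma_disjoint (rho : R) (z : C) : 0 < rho < 1 ->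
  on_contour hl_Gamma_p z -> ~ on_contour (hl_Gamma_m rho) z.
Proof.
intros Hr; assert (S0 : 0 < sqrt 3) by (apply sqrt_lt_R0; lra).
unfold hl_Gamma_p; replace (2 * PI / 3) with (PI / 3 + PI / 3) by field.
intros Hp Hm; apply on_sector_boundary in Hp; destruct Hp as [(H1 & H2 & H3) _].
replace (PI / 3 + PI / 3) with (2 * PI / 3) in H2 by field.
rewrite side_PI3 in H1; rewrite side_2PI3 in H2.
apply Cmod_ge_1 in H3.
assert (HI : Im z <> 0).
{ intros E; assert (R0 : sqrt 3 * Re z = 0) by lra.
  apply Rmult_integral in R0; destruct R0 as [R0|R0]; [lra|].
  rewrite E, R0 in H3; lra. }
destruct Hm as (p & [<-|[<-|[<-|[]]]] & t & _ & Hz); simpl in Hz.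
- apply HI; now rewrite Hz.
- rewrite circ_pair in Hz; rewrite Hz in H3; unfold Re, Im in H3; simpl in H3.
  assert (E := cs1 t).
  replace (rho * cos t * (rho * cos t) + rho * sin t * (rho * sin t))
    with (rho * rho * (cos t * cos t + sin t * sin t)) in H3 by ring.
  rewrite E in H3; assert (rho * rho < 1 * 1) by (apply Rmult_le_0_lt_compat; lra); lra.
- apply HI; now rewrite Hz.
Qed.

(* Main.v *)
Require Import Defs.
From Stdlib Require Import Reals List Lra Lia Psatz Classical ClassicalEpsilon FunctionalExtensionality.
From Coquelicot Require Import Coquelicot.
Import ListNotations.

(** Each of the four families has a kernel of the form
    c0 e_0 + c1 e_1 + c2 e_2 with e_k(x) = exp(- i alpha^k lam x) and coefficients
    depending on lam ([kcomb]).  Since alpha^3 = 1, every e_k is turned into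
    lam^3 e_k by the formal transpose of S, so three integrations by parts give
    F(S f) = lam^3 F(f) + boundary terms ([green], [green_kcomb]).  The boundary
    conditions and the choice of the coefficients leave of these terms only
    - (i/2pi) (f''(0) + i lam f'(0)) for F^+ and
    - (i/2pi) exp(- i lam) f''(1) for F^- on the interval, and
    +- (i/2pi) (f''(0) + i lam f'(0)) for F^+- on the half-line.  On the interval
    the denominator Delta cancels, provided that it does not vanish on the
    contours.  This is seen on the rays from the domination of one of its three
    exponentials ([Delta_neq_0_ray]), and on the unit circle from its Taylor
    expansion at 0 ([Delta_neq_0_circle]).

    With these remainders the integrand exp(i lam x) R_lam(f) / lam^3 is
    exp(i s lam) (a lam^-3 + b lam^-2), where s = x, or s = x - 1 for F^- on the
    interval.  On each sector theta1 < arg lam < theta2, |lam| > r0, whose boundary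
    is part of the contour, the exponential is bounded.  The integrand is thus
    O(|lam|^-2) there, and its integral along the boundary vanishes by Cauchy's
    theorem ([sector_integral_zero], [half_plane_integral_zero]).  Cauchy's theorem
    for such a sector is obtained by differentiating the integral over the arc of
    radius r with respect to r: the derivative is the difference of the integrands
    on the two sides, and the arc integral tends to 0 ([arc_integral_limit],
    [cauchy_sector]).

    The functionals are continuous because their kernels are bounded on [0,1], and
    are O(exp(rho x)) on the half-line with rho < eps.  That S maps the domain on the
    half-line into the ambient space is a Landau-type interpolation: if f is
    O(exp(- eps x)) and all its derivatives are bounded, then all of them are
    O(exp(- c x)) for every c < eps ([decays_derivatives]). *)

Open Scope R_scope.

Local Notation CR := C_R_NormedModule.

(** * Complex-valued functions of a real variable *)

Lemma norm_Cmod (z : CR) : norm z = Cmod z.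
Proof.
unfold Cmod, norm; simpl; unfold prod_norm, norm; simpl; unfold abs; simpl.
f_equal; f_equal; rewrite !Rmult_1_r; [rewrite <- Rabs_mult | rewrite <- Rabs_mult];
  apply Rabs_pos_eq; apply Rle_0_sqr.
Qed.

Lemma filterlim_Cmod {T : Type} (F : (T -> Prop) -> Prop) {FF : Filter F} (f : T -> C) (l : C) :
  filterlim f F (locally (T := CR) l) <->
  forall e, 0 < e -> F (fun t => Cmod (f t - l) < e).
Proof.
split.
- intros H e He.
  apply (H (fun z => Cmod (z - l) < e)).
  apply (locally_le_locally_norm (V := CR) l).
  exists (mkposreal e He); intros y Hy; unfold ball_norm in Hy.
  rewrite norm_Cmod in Hy; exact Hy.
- intros H P HP.
  destruct (locally_norm_le_locally (V := CR) l P HP) as [d Hd].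
  unfold filtermap; generalize (H d (cond_pos d)); apply filter_imp; intros t Ht.
  apply Hd; unfold ball_norm; rewrite norm_Cmod; exact Ht.
Qed.

Lemma continuous_C {U : UniformSpace} (f : U -> C) (x : U) :
  continuous (fun t => fst (f t)) x -> continuous (fun t => snd (f t)) x ->
  continuous (U := CR) f x.
Proof.
intros H1 H2.
apply (filterlim_ext (fun t => (fst (f t), snd (f t)))); [intros t; now destruct (f t)|].
intros P HP; destruct (f x) as [a b] eqn:E; simpl in *.
destruct HP as [e He].
assert (A : locally x (fun t => ball (fst (f x)) e (fst (f t)))) by (apply H1; now exists e).
assert (B : locally x (fun t => ball (snd (f x)) e (snd (f t)))) by (apply H2; now exists e).
rewrite E in A, B.
unfold filtermap; generalize (filter_and _ _ A B); apply filter_imp; intros t [Ht1 Ht2].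
apply He; now split.
Qed.

Lemma continuous_C_fst {U : UniformSpace} (f : U -> C) (x : U) :
  continuous (U := CR) f x -> continuous (fun t => fst (f t)) x.
Proof.
intros H; apply (continuous_comp (V := CR) f fst); trivial.
destruct (f x); apply (@continuous_fst R_UniformSpace R_UniformSpace).
Qed.

Lemma continuous_C_snd {U : UniformSpace} (f : U -> C) (x : U) :
  continuous (U := CR) f x -> continuous (fun t => snd (f t)) x.
Proof.
intros H; apply (continuous_comp (V := CR) f snd); trivial.
destruct (f x); apply (@continuous_snd R_UniformSpace R_UniformSpace).
Qed.

Lemma continuous_Cplus {U : UniformSpace} (f g : U -> C) (x : U) :
  continuous (U := CR) f x -> continuous (U := CR) g x ->
  continuous (U := CR) (fun t => f t + g t)%C x.
Proof. intros; now apply (continuous_plus (V := CR)). Qed.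

Lemma continuous_Cmult {U : UniformSpace} (f g : U -> C) (x : U) :
  continuous (U := CR) f x -> continuous (U := CR) g x ->
  continuous (U := CR) (fun t => f t * g t)%C x.
Proof.
intros Hf Hg.
assert (F1 := continuous_C_fst f x Hf); assert (F2 := continuous_C_snd f x Hf).
assert (G1 := continuous_C_fst g x Hg); assert (G2 := continuous_C_snd g x Hg).
apply continuous_C; unfold Cmult; cbn [fst snd].
- now apply (continuous_minus (V := R_NormedModule));
    apply (continuous_mult (K := R_AbsRing)).
- now apply (continuous_plus (V := R_NormedModule));
    apply (continuous_mult (K := R_AbsRing)).
Qed.

Lemma continuous_Cexp {U : UniformSpace} (f : U -> C) (x : U) :
  continuous (U := CR) f x -> continuous (U := CR) (fun t => Cexp (f t)) x.
Proof.
intros Hf.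
assert (F1 := continuous_C_fst f x Hf); assert (F2 := continuous_C_snd f x Hf).
apply continuous_C; unfold Cexp, Re, Im; cbn [fst snd];
  apply (continuous_mult (K := R_AbsRing)).
- apply (continuous_comp (fun t => fst (f t)) exp); trivial; apply continuous_exp.
- apply (continuous_comp (fun t => snd (f t)) cos); trivial; apply continuous_cos.
- apply (continuous_comp (fun t => fst (f t)) exp); trivial; apply continuous_exp.
- apply (continuous_comp (fun t => snd (f t)) sin); trivial; apply continuous_sin.
Qed.

Lemma continuous_RtoC {U : UniformSpace} (f : U -> R) (x : U) :
  continuous f x -> continuous (U := CR) (fun t => RtoC (f t)) x.
Proof.
intros H; apply continuous_C; cbn [fst snd RtoC]; trivial; apply continuous_const.
Qed.

Lemma is_derive_C (f : R -> C) (x : R) (l : C) :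
  is_derive (fun t => fst (f t)) x (fst l) -> is_derive (fun t => snd (f t)) x (snd l) ->
  is_derive (V := CR) f x l.
Proof.
intros H1 H2.
apply (is_derive_ext (fun t => (fst (f t), snd (f t)) : CR)); [intros t; now destruct (f t)|].
destruct l; now apply is_derive_pair.
Qed.

Lemma is_derive_C_fst (f : R -> C) (x : R) (l : C) :
  is_derive (V := CR) f x l -> is_derive (fun t => fst (f t)) x (fst l).
Proof.
intros H; apply (filterdiff_comp' (U := R_NormedModule) (V := CR) (W := R_NormedModule)
      f (fun z => fst z) x _ (fun z => fst z) H).
apply filterdiff_linear, is_linear_fst.
Qed.

Lemma is_derive_C_snd (f : R -> C) (x : R) (l : C) :
  is_derive (V := CR) f x l -> is_derive (fun t => snd (f t)) x (snd l).
Proof.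
intros H; apply (filterdiff_comp' (U := R_NormedModule) (V := CR) (W := R_NormedModule)
      f (fun z => snd z) x _ (fun z => snd z) H).
apply filterdiff_linear, is_linear_snd.
Qed.

Lemma is_derive_eq_C (f : R -> C) (x : R) (l l' : C) :
  is_derive (V := CR) f x l -> l = l' -> is_derive (V := CR) f x l'.
Proof. now intros H <-. Qed.

Lemma is_derive_continuous_C (f : R -> C) (x : R) (l : C) :
  is_derive (V := CR) f x l -> continuous (U := CR) f x.
Proof. intros H; apply (ex_derive_continuous (V := CR)); now exists l. Qed.

Lemma is_derive_Cplus (f g : R -> C) (x : R) (l m : C) :
  is_derive (V := CR) f x l -> is_derive (V := CR) g x m ->
  is_derive (V := CR) (fun t => f t + g t)%C x (l + m)%C.
Proof. intros; now apply (is_derive_plus (V := CR)). Qed.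

Lemma is_derive_Cmult (f g : R -> C) (x : R) (l m : C) :
  is_derive (V := CR) f x l -> is_derive (V := CR) g x m ->
  is_derive (V := CR) (fun t => f t * g t)%C x (l * g x + f x * m)%C.
Proof.
intros Hf Hg.
assert (F1 := is_derive_C_fst f x l Hf); assert (F2 := is_derive_C_snd f x l Hf).
assert (G1 := is_derive_C_fst g x m Hg); assert (G2 := is_derive_C_snd g x m Hg).
apply is_derive_C; unfold Cmult, Cplus; cbn [fst snd].
- evar_last.
  + apply (is_derive_minus (V := R_NormedModule));
      apply (is_derive_mult (K := R_AbsRing)); eauto using Rmult_comm.
  + unfold minus, plus, opp, mult; simpl; ring.
- evar_last.
  + apply (is_derive_plus (V := R_NormedModule));
      apply (is_derive_mult (K := R_AbsRing)); eauto using Rmult_comm.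
  + unfold plus, mult; simpl; ring.
Qed.

Lemma is_derive_Cconst (c : C) (x : R) : is_derive (V := CR) (fun _ => c) x (RtoC 0).
Proof. apply (is_derive_const (V := CR)). Qed.

Lemma is_derive_Cscal (c : C) (f : R -> C) (x : R) (l : C) :
  is_derive (V := CR) f x l -> is_derive (V := CR) (fun t => c * f t)%C x (c * l)%C.
Proof.
intros H; apply is_derive_eq_C with (1 := is_derive_Cmult _ _ _ _ _ (is_derive_Cconst c x) H).
ring.
Qed.

Lemma is_derive_RtoC (f : R -> R) (x l : R) :
  is_derive f x l -> is_derive (V := CR) (fun t => RtoC (f t)) x (RtoC l).
Proof. intros H; apply is_derive_pair; trivial; apply (is_derive_const (V := R_NormedModule)). Qed.

Lemma is_derive_Cid (x : R) : is_derive (V := CR) (fun t => RtoC t) x (RtoC 1).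
Proof. apply (is_derive_RtoC (fun t => t)), (is_derive_id (K := R_AbsRing)). Qed.

Lemma is_derive_Cexp (f : R -> C) (x : R) (l : C) :
  is_derive (V := CR) f x l ->
  is_derive (V := CR) (fun t => Cexp (f t)) x (l * Cexp (f x))%C.
Proof.
intros Hf.
assert (F1 := is_derive_C_fst f x l Hf); assert (F2 := is_derive_C_snd f x l Hf).
assert (E := is_derive_comp (V := R_NormedModule) exp (fun t => fst (f t)) x _ _
  (is_derive_exp _) F1).
assert (Co := is_derive_comp (V := R_NormedModule) cos (fun t => snd (f t)) x _ _
  (is_derive_cos _) F2).
assert (Si := is_derive_comp (V := R_NormedModule) sin (fun t => snd (f t)) x _ _
  (is_derive_sin _) F2).
apply is_derive_C; unfold Cexp, Re, Im, Cmult; cbn [fst snd].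
- evar_last.
  + apply (is_derive_mult (K := R_AbsRing)); eauto using Rmult_comm.
  + unfold plus, mult, scal; simpl; unfold mult; simpl; ring.
- evar_last.
  + apply (is_derive_mult (K := R_AbsRing)); eauto using Rmult_comm.
  + unfold plus, mult, scal; simpl; unfold mult; simpl; ring.
Qed.

Lemma exp_le_compat (x y : R) : x <= y -> exp x <= exp y.
Proof. intros [H| ->]; [left; now apply exp_increasing | right; reflexivity]. Qed.

Lemma Cexp_plus (z w : C) : Cexp (z + w)%C = (Cexp z * Cexp w)%C.
Proof.
unfold Cexp, Cmult, Cplus, Re, Im; cbn [fst snd].
rewrite exp_plus, cos_plus, sin_plus; f_equal; ring.
Qed.

Lemma Cexp_0 : Cexp (RtoC 0) = RtoC 1.
Proof. unfold Cexp, RtoC, Re, Im; cbn [fst snd]; rewrite exp_0, cos_0, sin_0; f_equal; ring. Qed.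

Lemma Cmod_Cexp (z : C) : Cmod (Cexp z) = exp (Re z).
Proof.
assert (H := Cmod_sqr (Cexp z)).
assert (E := exp_pos (Re z)); assert (M := Cmod_ge_0 (Cexp z)).
apply Rsqr_inj; unfold Rsqr; try lra; rewrite H.
change (Re (Cexp z)) with (exp (Re z) * cos (Im z)).
change (Im (Cexp z)) with (exp (Re z) * sin (Im z)).
transitivity (exp (Re z) * exp (Re z) * (cos (Im z) * cos (Im z) + sin (Im z) * sin (Im z)));
  [ring | rewrite cs1; ring].
Qed.

(** * Integrals of complex-valued functions *)

Lemma is_RInt_Cscal (c : C) (f : R -> C) (a b : R) (l : C) :
  is_RInt (V := CR) f a b l -> is_RInt (V := CR) (fun t => c * f t)%C a b (c * l)%C.
Proof.
intros H.
assert (H1 := is_RInt_fct_extend_fst (U := R_NormedModule) (V := R_NormedModule) _ _ _ _ H).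
assert (H2 := is_RInt_fct_extend_snd (U := R_NormedModule) (V := R_NormedModule) _ _ _ _ H).
apply (is_RInt_fct_extend_pair (U := R_NormedModule) (V := R_NormedModule));
  unfold Cmult; cbn [fst snd].
- apply (is_RInt_minus (V := R_NormedModule)); now apply (is_RInt_scal (V := R_NormedModule)).
- apply (is_RInt_plus (V := R_NormedModule)); now apply (is_RInt_scal (V := R_NormedModule)).
Qed.

Lemma ex_RInt_C (f : R -> C) (a b : R) :
  (forall x, continuous (U := CR) f x) ->
  is_RInt (V := CR) f a b (RInt (V := C_R_CompleteNormedModule) f a b).
Proof.
intros H; apply (RInt_correct (V := C_R_CompleteNormedModule)).
now apply (ex_RInt_continuous (V := C_R_CompleteNormedModule)).
Qed.

Lemma Cmod_RInt_le (f : R -> C) (g : R -> R) (a b : R) (l : C) (m : R) :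
  a <= b -> (forall x, a <= x <= b -> Cmod (f x) <= g x) ->
  is_RInt (V := CR) f a b l -> is_RInt g a b m -> Cmod l <= m.
Proof.
intros Hab Hfg Hf Hg; rewrite <- norm_Cmod.
apply (norm_RInt_le (V := CR) f g a b); trivial.
intros x Hx; rewrite norm_Cmod; now apply Hfg.
Qed.

(** * One-sided derivatives and smooth functions on a set of reals *)

Lemma is_deriv_on_eps (D : R -> Prop) (f : R -> C) (x : R) (l : C) : D x ->
  (is_deriv_on D f x l <->
   forall e, 0 < e -> exists d, 0 < d /\ forall y, D y -> Rabs (y - x) < d ->
     Cmod (f y - f x - (y - x)%R * l)%C <= e * Rabs (y - x)).
Proof.
intros Dx.
assert (N : forall y, norm (minus (minus (f y) (f x)) (scal (minus y x) (l : CR)) : CR)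
   = Cmod (f y - f x - (y - x)%R * l)%C).
{ intros y; rewrite norm_Cmod; f_equal.
  unfold minus, plus, opp, scal; simpl; unfold prod_scal, prod_plus, prod_opp, scal; simpl.
  unfold mult, plus, opp; simpl.
  unfold Cminus, Cplus, Copp, Cmult, RtoC; simpl; f_equal; ring. }
split.
- intros [_ H] e He.
  destruct (H x) with (eps := mkposreal e He) as [d Hd].
  { intros P HP; unfold within; now apply filter_imp with (2 := HP). }
  exists d; split; [apply cond_pos|]; intros y Dy Hy.
  rewrite <- N; exact (Hd y Hy Dy).
- intros H; split; [apply (is_linear_scal_l (V := CR) l)|].
  intros x' Hx'.
  assert (E : x' = x).
  { apply NNPP; intros Hne.
    assert (Hp : 0 < Rabs (x' - x)) by (apply Rabs_pos_lt; lra).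
    destruct (Hx' (fun y => y <> x)) as [d Hd].
    - exists (mkposreal _ Hp); intros y Hy E; subst y.
      unfold ball in Hy; simpl in Hy; unfold AbsRing_ball, abs, minus, plus, opp in Hy; simpl in Hy.
      rewrite <- Rabs_Ropp in Hy; replace (- (x + - x')) with (x' - x) in Hy by ring; lra.
    - apply (Hd x); trivial; apply ball_center. }
  subst x'; intros e; destruct (H e (cond_pos e)) as (d & Hd & K).
  exists (mkposreal d Hd); intros y Hy Dy; assert (Ky := K y Dy Hy); rewrite <- N in Ky; exact Ky.
Qed.

(** The condition on [D] under which derivatives within [D] are unique. *)
Definition no_isolated (D : R -> Prop) : Prop :=
  forall x, D x -> forall d, 0 < d -> exists y, D y /\ y <> x /\ Rabs (y - x) < d.

Lemma no_isolated_unit : no_isolated unit_itv.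
Proof.
intros x [H1 H2] d Hd; simpl in H1, H2.
assert (A := Rmin_l (d / 2) (1 / 2)); assert (B := Rmin_r (d / 2) (1 / 2)).
assert (P : 0 < Rmin (d / 2) (1 / 2)) by (apply Rmin_glb_lt; lra).
destruct (Rle_or_lt x (1 / 2)).
- exists (x + Rmin (d / 2) (1 / 2)); repeat split; simpl; try lra.
  rewrite Rabs_pos_eq; lra.
- exists (x - Rmin (d / 2) (1 / 2)); repeat split; simpl; try lra.
  rewrite Rabs_left; lra.
Qed.

Lemma no_isolated_half_line : no_isolated half_line.
Proof.
intros x [H1 _] d Hd; simpl in H1.
exists (x + d / 2); repeat split; simpl; try lra; rewrite Rabs_pos_eq; lra.
Qed.

Lemma no_isolated_whole : no_isolated whole.
Proof.
intros x _ d Hd; exists (x + d / 2); repeat split; try lra; rewrite Rabs_pos_eq; lra.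
Qed.

Lemma is_deriv_on_unique (D : R -> Prop) (f : R -> C) (x : R) (l m : C) :
  no_isolated D -> D x -> is_deriv_on D f x l -> is_deriv_on D f x m -> l = m.
Proof.
intros HD Dx Hl Hm.
rewrite is_deriv_on_eps in Hl, Hm by trivial.
assert (Z : Cmod (l - m)%C <= 0).
{ apply Rnot_lt_le; intros Hp.
  destruct (Hl (Cmod (l - m) / 4)) as (d1 & Hd1 & K1); [lra|].
  destruct (Hm (Cmod (l - m) / 4)) as (d2 & Hd2 & K2); [lra|].
  destruct (HD x Dx (Rmin d1 d2)) as (y & Dy & Hne & Hy); [now apply Rmin_glb_lt|].
  assert (A := Rmin_l d1 d2); assert (B := Rmin_r d1 d2).
  specialize (K1 y Dy ltac:(lra)); specialize (K2 y Dy ltac:(lra)).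
  assert (T := Cmod_triangle (f y - f x - (y - x)%R * m)%C (- (f y - f x - (y - x)%R * l))%C).
  rewrite Cmod_opp in T.
  replace (f y - f x - (y - x)%R * m + - (f y - f x - (y - x)%R * l))%C
    with ((y - x)%R * (l - m))%C in T by ring.
  rewrite Cmod_mult, Cmod_R in T.
  assert (0 < Rabs (y - x)) by (apply Rabs_pos_lt; lra).
  nra. }
assert (Z' := Cmod_ge_0 (l - m)%C).
assert (Z0 : (l - m)%C = RtoC 0) by (apply Cmod_eq_0; lra).
replace l with (l - m + m)%C by ring; rewrite Z0; ring.
Qed.

Lemma is_deriv_on_ext (D : R -> Prop) (f g : R -> C) (x : R) (l : C) :
  D x -> (forall y, D y -> f y = g y) -> is_deriv_on D f x l -> is_deriv_on D g x l.
Proof.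
intros Dx E H; apply is_deriv_on_eps; trivial; rewrite is_deriv_on_eps in H by trivial.
intros e He; destruct (H e He) as (d & Hd & K); exists d; split; trivial.
intros y Dy Hy; rewrite <- !E by trivial; now apply K.
Qed.

Lemma is_deriv_on_sub (D D' : R -> Prop) (f : R -> C) (x : R) (l : C) :
  (forall y, D y -> D' y) -> D x -> is_deriv_on D' f x l -> is_deriv_on D f x l.
Proof.
intros S Dx H; apply is_deriv_on_eps; trivial; rewrite is_deriv_on_eps in H by auto.
intros e He; destruct (H e He) as (d & Hd & K); exists d; split; auto.
Qed.

Lemma is_deriv_on_lin_comb (D : R -> Prop) (c d : C) (f g : R -> C) (x : R) (l m : C) :
  D x -> is_deriv_on D f x l -> is_deriv_on D g x m ->
  is_deriv_on D (lin_comb c f d g) x (c * l + d * m)%C.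
Proof.
intros Dx Hf Hg; apply is_deriv_on_eps; trivial.
rewrite is_deriv_on_eps in Hf, Hg by trivial.
intros e He.
assert (C0 := Cmod_ge_0 c); assert (D0 := Cmod_ge_0 d).
set (e' := e / (Cmod c + Cmod d + 1)).
assert (He' : 0 < e') by (apply Rdiv_lt_0_compat; lra).
assert (Ee : e' * (Cmod c + Cmod d + 1) = e) by (unfold e'; field; lra).
destruct (Hf e' He') as (d1 & Hd1 & K1); destruct (Hg e' He') as (d2 & Hd2 & K2).
exists (Rmin d1 d2); split; [now apply Rmin_glb_lt|]; intros y Dy Hy.
assert (A := Rmin_l d1 d2); assert (B := Rmin_r d1 d2).
specialize (K1 y Dy ltac:(lra)); specialize (K2 y Dy ltac:(lra)).
unfold lin_comb.
replace (c * f y + d * g y - (c * f x + d * g x) - (y - x)%R * (c * l + d * m))%C with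
  (c * (f y - f x - (y - x)%R * l) + d * (g y - g x - (y - x)%R * m))%C by ring.
eapply Rle_trans; [apply Cmod_triangle|]; rewrite !Cmod_mult.
assert (0 <= Rabs (y - x)) by apply Rabs_pos.
assert (Cmod c * Cmod (f y - f x - (y - x)%R * l) <= Cmod c * (e' * Rabs (y - x)))
  by (apply Rmult_le_compat_l; lra).
assert (Cmod d * Cmod (g y - g x - (y - x)%R * m) <= Cmod d * (e' * Rabs (y - x)))
  by (apply Rmult_le_compat_l; lra).
rewrite <- Ee; nra.
Qed.

(** A function together with all its derivatives: [smooth_on] and [deriv_on]
    are read off such a sequence, so that closure properties of smooth
    functions become termwise statements. *)
Definition jet (D : R -> Prop) (F : nat -> R -> C) : Prop :=
  forall n x, D x -> is_deriv_on D (F n) x (F (S n) x).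

Lemma deriv_on_correct (D : R -> Prop) (n : nat) (f : R -> C) (x : R) (l : C) :
  no_isolated D -> D x -> is_deriv_on D (deriv_on D n f) x l -> deriv_on D (S n) f x = l.
Proof.
intros HD Dx H; apply (iota_unique (V := C_R_CompleteNormedModule)); trivial.
intros m Hm; now apply (is_deriv_on_unique D (deriv_on D n f) x).
Qed.

Lemma jet_deriv_on (D : R -> Prop) (F : nat -> R -> C) (f : R -> C) :
  no_isolated D -> jet D F -> (forall x, D x -> f x = F O x) ->
  forall n x, D x -> deriv_on D n f x = F n x.
Proof.
intros HD HF E n; induction n as [|n IH]; [exact E|]; intros x Dx.
apply deriv_on_correct; trivial.
apply is_deriv_on_ext with (F n); auto; intros y Dy; symmetry; auto.
Qed.

Lemma jet_smooth (D : R -> Prop) (F : nat -> R -> C) (f : R -> C) :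
  no_isolated D -> jet D F -> (forall x, D x -> f x = F O x) -> smooth_on D f.
Proof.
intros HD HF E n x Dx; exists (F (S n) x).
apply is_deriv_on_ext with (F n); auto; intros y Dy; symmetry.
now apply (jet_deriv_on D F f).
Qed.

Lemma smooth_jet (D : R -> Prop) (f : R -> C) :
  no_isolated D -> smooth_on D f -> jet D (fun n => deriv_on D n f).
Proof.
intros HD H n x Dx; destruct (H n x Dx) as [l Hl].
now rewrite (deriv_on_correct D n f x l).
Qed.

Lemma jet_lin_comb (D : R -> Prop) (c d : C) (F G : nat -> R -> C) :
  jet D F -> jet D G -> jet D (fun n => lin_comb c (F n) d (G n)).
Proof. intros HF HG n x Dx; now apply is_deriv_on_lin_comb; auto. Qed.

Lemma jet_zero (D : R -> Prop) : jet D (fun _ _ => RtoC 0).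
Proof.
intros n x Dx; apply is_deriv_on_eps; trivial; intros e He; exists 1; split; [lra|].
intros y Dy Hy; replace (RtoC 0 - RtoC 0 - (y - x)%R * RtoC 0)%C with (RtoC 0) by ring.
rewrite Cmod_0; assert (0 <= Rabs (y - x)) by apply Rabs_pos; nra.
Qed.

Lemma jet_shift (D : R -> Prop) (k : nat) (F : nat -> R -> C) :
  jet D F -> jet D (fun n => F (n + k)%nat).
Proof. intros HF n x Dx; apply (HF (n + k)%nat x Dx). Qed.

Lemma jet_opS (D : R -> Prop) (f : R -> C) :
  no_isolated D -> smooth_on D f -> jet D (fun n => lin_comb Ci (deriv_on D (n + 3) f) 0 (fun _ => 0)).
Proof.
intros HD H; apply (jet_lin_comb D Ci 0 (fun n => deriv_on D (n + 3) f) (fun _ _ => 0)).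
- apply (jet_shift D 3 (fun n => deriv_on D n f)), smooth_jet; trivial.
- apply jet_zero.
Qed.

Lemma opS_lin_comb (D : R -> Prop) (f : R -> C) (x : R) :
  opS D f x = lin_comb Ci (deriv_on D 3 f) 0 (fun _ => 0) x.
Proof. unfold opS, lin_comb; ring. Qed.

Lemma smooth_lin_comb (D : R -> Prop) (c d : C) (f g : R -> C) :
  no_isolated D -> smooth_on D f -> smooth_on D g -> smooth_on D (lin_comb c f d g).
Proof.
intros HD Hf Hg.
apply (jet_smooth D _ _ HD (jet_lin_comb D c d _ _ (smooth_jet D f HD Hf) (smooth_jet D g HD Hg))).
reflexivity.
Qed.

Lemma deriv_on_lin_comb (D : R -> Prop) (c d : C) (f g : R -> C) (n : nat) (x : R) :
  no_isolated D -> smooth_on D f -> smooth_on D g -> D x ->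
  deriv_on D n (lin_comb c f d g) x = (c * deriv_on D n f x + d * deriv_on D n g x)%C.
Proof.
intros HD Hf Hg Dx.
now apply (jet_deriv_on D _ (lin_comb c f d g) HD
  (jet_lin_comb D c d _ _ (smooth_jet D f HD Hf) (smooth_jet D g HD Hg))).
Qed.

Lemma smooth_zero (D : R -> Prop) : no_isolated D -> smooth_on D (fun _ => 0).
Proof. intros HD; now apply (jet_smooth D _ _ HD (jet_zero D)). Qed.

Lemma deriv_on_zero (D : R -> Prop) (n : nat) (x : R) :
  no_isolated D -> D x -> deriv_on D n (fun _ => RtoC 0) x = 0.
Proof. intros HD; now apply (jet_deriv_on D _ _ HD (jet_zero D)). Qed.

Lemma smooth_opS (D : R -> Prop) (f : R -> C) :
  no_isolated D -> smooth_on D f -> smooth_on D (opS D f).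
Proof.
intros HD Hf; apply (jet_smooth D _ _ HD (jet_opS D f HD Hf)).
intros x _; apply opS_lin_comb.
Qed.

Lemma opS_linear (D : R -> Prop) (c d : C) (f g : R -> C) (x : R) :
  no_isolated D -> smooth_on D f -> smooth_on D g -> D x ->
  opS D (lin_comb c f d g) x = lin_comb c (opS D f) d (opS D g) x.
Proof.
intros HD Hf Hg Dx; unfold opS; rewrite deriv_on_lin_comb by trivial; unfold lin_comb; ring.
Qed.

(** * Proper and improper integrals from 0 *)

(** One notion serves both problems: the proper integral over [0,1] for [b = 1], and
    the improper one over the half-line for [b = p_infty]. *)
Definition is_int (b : Rbar) (h : R -> C) (l : C) : Prop :=
  is_RInt_gen (V := CR) h (at_point 0) (end_filter b) l.

#[local] Instance end_filter_proper (b : Rbar) : ProperFilter (end_filter b).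
Proof.
destruct b; simpl; [apply at_point_filter | apply (Rbar_locally_filter p_infty)
  | apply (Rbar_locally_filter m_infty)].
Qed.

Lemma end_filter_clitv (b : Rbar) : Rbar_lt 0 b ->
  end_filter b (fun r => 0 <= r /\ forall x, 0 <= x <= r -> clitv 0 b x).
Proof.
destruct b as [b| |]; simpl; intros Hb; try easy.
- split; [lra|]; intros x Hx; split; simpl; lra.
- exists 0; intros r Hr; split; [lra|]; intros x Hx; split; simpl; tauto || lra.
Qed.

Lemma filter_prod_0 (F : (R -> Prop) -> Prop) {FF : Filter F} (P : R -> R -> Prop) :
  F (P 0) -> filter_prod (at_point (0 : R_UniformSpace)) F (fun ab => P (fst ab) (snd ab)).
Proof.
intros H; apply (Filter_prod _ _ _ (fun a => a = 0) (P 0)); trivial.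
- reflexivity.
- intros x y -> Hy; exact Hy.
Qed.

Lemma filter_prod_0_inv (F : (R -> Prop) -> Prop) {FF : Filter F} (P : R * R -> Prop) :
  filter_prod (at_point (0 : R_UniformSpace)) F P -> F (fun r => P (0, r)).
Proof. intros [Q S HQ HS H]; apply filter_imp with (2 := HS); intros r Hr; now apply H. Qed.

Lemma is_int_ext (b : Rbar) (h k : R -> C) (l : C) : Rbar_lt 0 b ->
  (forall x, clitv 0 b x -> h x = k x) -> is_int b h l -> is_int b k l.
Proof.
intros Hb E.
apply (is_RInt_gen_ext (V := CR) (FFa := filter_filter (ProperFilter := at_point_filter (0 : R_UniformSpace)))
  (FFb := filter_filter (ProperFilter := end_filter_proper b)) h k l).
apply (filter_prod_0 _ (fun u v => forall x, Rmin u v < x < Rmax u v -> h x = k x)).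
apply filter_imp with (2 := end_filter_clitv b Hb); intros r [Hr K] x Hx.
rewrite Rmin_left, Rmax_right in Hx by trivial; apply E, K; lra.
Qed.

Lemma is_RInt_gen_Cscal (Fa Fb : (R -> Prop) -> Prop) {FA : Filter Fa} {FB : Filter Fb}
    (c : C) (h : R -> C) (l : C) :
  is_RInt_gen (V := CR) h Fa Fb l -> is_RInt_gen (V := CR) (fun x => c * h x)%C Fa Fb (c * l)%C.
Proof.
intros H P HP.
assert (L : locally (T := CR) l (fun z => P (c * z)%C)).
{ apply (continuous_Cmult (U := CR) (fun _ => c) (fun z => z) l); trivial;
    [apply continuous_const | apply continuous_id]. }
specialize (H _ L); unfold filtermapi in *.
apply filter_imp with (2 := H); intros [u v] (y & Hy & Py).
exists (c * y)%C; split; trivial; now apply is_RInt_Cscal.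
Qed.

Lemma is_int_lin_comb (b : Rbar) (c d : C) (h k : R -> C) (l m : C) :
  is_int b h l -> is_int b k m ->
  is_int b (fun x => c * h x + d * k x)%C (c * l + d * m)%C.
Proof.
intros Hh Hk.
assert (F0 : Filter (at_point (0 : R_UniformSpace))) by apply at_point_filter.
assert (Fb : Filter (end_filter b)) by apply end_filter_proper.
apply (is_RInt_gen_plus (V := CR) (FFa := F0) (FFb := Fb)
  (fun x => c * h x)%C (fun x => d * k x)%C (c * l)%C (d * m)%C);
  now apply is_RInt_gen_Cscal.
Qed.

Lemma int01_eq (h : R -> C) (l : C) : is_int 1 h l -> int01 h = l.
Proof.
intros H; apply (proj1 (is_RInt_gen_at_point (V := CR) h 0 1 l)) in H.
exact (is_RInt_unique (V := C_R_CompleteNormedModule) h 0 1 l H).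
Qed.

Lemma int_half_line_eq (h : R -> C) (l : C) : is_int p_infty h l -> int_half_line h = l.
Proof.
intros H; unfold int_half_line.
exact (is_RInt_gen_unique (V := C_R_CompleteNormedModule)
  (FFa := Proper_StrongProper _ (at_point_filter (0 : R_UniformSpace)))
  (FFb := Proper_StrongProper _ (end_filter_proper p_infty)) h l H).
Qed.

Lemma is_int_of_RInt (b : Rbar) (h I : R -> C) (l : C) :
  (forall x, is_RInt (V := CR) h 0 x (I x)) -> filterlim I (end_filter b) (locally (T := CR) l) ->
  is_int b h l.
Proof.
intros HI HL P HP; unfold filtermapi.
apply (filter_prod_0 _ (fun u v => exists y : CR, is_RInt h u v y /\ P y)).
assert (K := HL P HP); unfold filtermap in K; revert K.
apply filter_imp; intros r Hr; now exists (I r).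
Qed.

Lemma is_int_le (b : Rbar) (h : R -> C) (w W : R -> R) (l : C) (M : R) : Rbar_lt 0 b ->
  is_int b h l -> (forall x, clitv 0 b x -> Cmod (h x) <= w x) ->
  (forall r, clitv 0 b r -> is_RInt w 0 r (W r) /\ W r <= M) -> Cmod l <= M.
Proof.
intros Hb H Hw HW; apply Rnot_lt_le; intros Hlt.
assert (L : locally (T := CR) l (fun z => Cmod (z - l) < Cmod l - M)).
{ apply (proj1 (filterlim_Cmod (locally (T := CR) l) (fun z => z) l)); [|lra].
  apply filterlim_id. }
specialize (H _ L); unfold filtermapi in H; apply filter_prod_0_inv in H; [|typeclasses eauto].
destruct (filter_ex _ (filter_and _ _ H (end_filter_clitv b Hb))) as (r & (y & Hy & K) & Hr & Hc).
simpl in Hy; destruct (HW r) as [H1 H2]; [apply Hc; lra|].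
assert (Hle : Cmod y <= W r).
{ apply (Cmod_RInt_le h w 0 r); trivial; intros x Hx; apply Hw, Hc, Hx. }
assert (T := Cmod_lip l y); apply Rabs_le_between in T; lra.
Qed.

(** Cauchy's criterion; in its uses [W u] is the integral from [u] to infinity of a
    function that dominates the integrand. *)
Lemma filterlim_of_decrements (I : R -> C) (W : R -> R) (A : R) :
  (forall u v, A <= u <= v -> Cmod (I v - I u) <= W u - W v) ->
  (forall u, A <= u -> 0 <= W u) ->
  (forall e, 0 < e -> exists B, forall u, B < u -> W u < e) ->
  exists l : C, filterlim I (Rbar_locally p_infty) (locally (T := CR) l).
Proof.
intros H1 H2 H3.
apply (filterlim_locally_cauchy (U := C_R_CompleteNormedModule) (F := Rbar_locally p_infty)).
intros e; destruct (H3 e (cond_pos e)) as [B HB].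
exists (fun u => Rmax A B < u); split; [now exists (Rmax A B)|].
assert (K : forall u v, Rmax A B < u -> u <= v -> Cmod (I v - I u) < e).
{ intros u v Hu Huv; assert (R1 := Rmax_l A B); assert (R2 := Rmax_r A B).
  specialize (H1 u v ltac:(lra)); specialize (H2 v ltac:(lra)); specialize (HB u ltac:(lra)); lra. }
intros u v Hu Hv; destruct (Rle_or_lt u v) as [Huv|Huv].
- apply (norm_compat1 (V := CR)); rewrite norm_Cmod; now apply K.
- apply ball_sym, (norm_compat1 (V := CR)); rewrite norm_Cmod; apply K; lra.
Qed.

Lemma Cmod_RInt_decrement (h : R -> C) (w W : R -> R) (u v : R) (l : C) : u <= v ->
  is_RInt (V := CR) h u v l -> (forall x, u <= x <= v -> Cmod (h x) <= w x) ->
  (forall x, u <= x <= v -> is_derive W x (- w x)) ->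
  (forall x, u <= x <= v -> continuous w x) -> Cmod l <= W u - W v.
Proof.
intros Huv H Hw HW Hc.
apply (Cmod_RInt_le h w u v l); trivial.
assert (K := is_RInt_derive (V := R_CompleteNormedModule) (fun x => - W x) w u v).
rewrite Rmin_left, Rmax_right in K by trivial.
replace (W u - W v) with (minus (- W v) (- W u)) by (unfold minus, plus, opp; simpl; ring).
apply K; trivial; intros x Hx.
replace (w x) with (opp (- w x)) by (unfold opp; simpl; ring).
now apply (is_derive_opp (V := R_NormedModule)), HW.
Qed.

Lemma exp_decay_small (K d : R) : 0 <= K -> 0 < d ->
  forall e, 0 < e -> exists B, forall u, B < u -> K * exp (- d * u) < e.
Proof.
intros HK Hd e He; exists (K / (e * d)); intros u Hu.
assert (P : 0 < e * d) by now apply Rmult_lt_0_compat.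
assert (Hu' : K < u * (e * d)).
{ apply (Rmult_lt_compat_r (e * d)) in Hu; trivial.
  unfold Rdiv in Hu; rewrite Rmult_assoc, Rinv_l in Hu; lra. }
assert (E := exp_pos (d * u)); assert (E' := exp_pos (- d * u)).
assert (X : exp (d * u) * exp (- d * u) = 1) by (rewrite <- exp_plus, <- exp_0; f_equal; ring).
assert (G : 1 + d * u <= exp (d * u)) by apply exp_ineq1_le.
assert (K < e * exp (d * u)) by nra.
apply Rmult_lt_reg_l with (exp (d * u)); trivial.
replace (exp (d * u) * (K * exp (- d * u))) with (K * (exp (d * u) * exp (- d * u))) by ring.
rewrite X; lra.
Qed.

Lemma filterlim_exp_decay (P : R -> C) (K d : R) : 0 < d ->
  (forall x, 0 <= x -> Cmod (P x) <= K * exp (- d * x)) ->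
  filterlim P (Rbar_locally p_infty) (locally (T := CR) (RtoC 0)).
Proof.
intros Hd H; apply filterlim_Cmod; [apply (end_filter_proper p_infty)|]; intros e He.
destruct (exp_decay_small (Rabs K) d (Rabs_pos K) Hd e He) as [B HB].
exists (Rmax 0 B); intros x Hx.
assert (A1 := Rmax_l 0 B); assert (A2 := Rmax_r 0 B).
replace (P x - RtoC 0)%C with (P x) by ring.
specialize (H x ltac:(lra)); specialize (HB x ltac:(lra)).
assert (E := exp_pos (- d * x)); assert (K <= Rabs K) by apply Rle_abs; nra.
Qed.

Lemma is_RInt_exp_decay (K d u v : R) : 0 < d ->
  is_RInt (fun x => K * exp (- d * x)) u v (K / d * exp (- d * u) - K / d * exp (- d * v)).
Proof.
intros Hd.
replace (K / d * exp (- d * u) - K / d * exp (- d * v)) with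
  (minus (- (K / d * exp (- d * v))) (- (K / d * exp (- d * u))))
  by (unfold minus, plus, opp; simpl; ring).
apply (is_RInt_derive (V := R_CompleteNormedModule) (fun x => - (K / d * exp (- d * x)))).
- intros x _; auto_derive; trivial; field; lra.
- intros x _; apply (ex_derive_continuous (V := R_NormedModule)); auto_derive; trivial.
Qed.

Lemma ex_int_exp_decay (h : R -> C) (K d : R) : 0 <= K -> 0 < d ->
  (forall x, continuous (U := CR) h x) ->
  (forall x, 0 <= x -> Cmod (h x) <= K * exp (- d * x)) -> exists l, is_int p_infty h l.
Proof.
intros HK Hd Hc Hb.
set (I := fun x => RInt (V := C_R_CompleteNormedModule) h 0 x).
assert (HI : forall x, is_RInt (V := CR) h 0 x (I x)) by (intros x; now apply ex_RInt_C).
assert (KD : 0 <= K / d) by (apply Rdiv_le_0_compat; lra).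
destruct (filterlim_of_decrements I (fun x => K / d * exp (- d * x)) 0) as [l Hl].
- intros u v Huv.
  apply (Cmod_RInt_le h (fun x => K * exp (- d * x)) u v); [lra| |
    |now apply is_RInt_exp_decay].
  + intros x Hx; apply Hb; lra.
  + replace (I v - I u)%C with (plus (opp (I u : CR)) (I v : CR)) by (apply Cplus_comm).
    apply (is_RInt_Chasles (V := CR)) with 0; trivial; now apply (is_RInt_swap (V := CR)).
- intros u _; apply Rmult_le_pos; trivial; left; apply exp_pos.
- now apply exp_decay_small.
- exists l; now apply is_int_of_RInt with I.
Qed.

Lemma is_int_le_exp_decay (h : R -> C) (K d : R) (l : C) : 0 <= K -> 0 < d ->
  is_int p_infty h l -> (forall x, 0 <= x -> Cmod (h x) <= K * exp (- d * x)) ->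
  Cmod l <= K / d.
Proof.
intros HK Hd H Hb.
apply (is_int_le p_infty h (fun x => K * exp (- d * x))
  (fun r => K / d * exp (- d * 0) - K / d * exp (- d * r))); simpl; trivial.
- intros x [Hx _]; now apply Hb.
- intros r _; split; [now apply is_RInt_exp_decay|].
  rewrite Rmult_0_r, exp_0.
  assert (0 <= K / d) by (apply Rdiv_le_0_compat; lra).
  assert (0 < exp (- d * r)) by apply exp_pos; nra.
Qed.

(** * Green's formula for the exponential kernels *)

Definition ker (mu : C) (x : R) : C := Cexp (- Ci * mu * x)%C.

Lemma is_derive_ker (mu : C) (x : R) :
  is_derive (V := CR) (ker mu) x (- Ci * mu * ker mu x)%C.
Proof.
apply is_derive_Cexp.
apply is_derive_eq_C with (1 := is_derive_Cscal (- Ci * mu) _ _ _ (is_derive_Cid x)); ring.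
Qed.

Lemma continuous_ker (mu : C) (x : R) : continuous (U := CR) (ker mu) x.
Proof. exact (is_derive_continuous_C _ _ _ (is_derive_ker mu x)). Qed.

Lemma Cmod_ker (mu : C) (x : R) : Cmod (ker mu x) = exp (Im mu * x).
Proof. unfold ker; rewrite Cmod_Cexp; f_equal; unfold Re, Im; simpl; ring. Qed.

Lemma ker_0 (mu : C) : ker mu 0 = RtoC 1.
Proof. unfold ker; replace (- Ci * mu * 0%R)%C with (RtoC 0) by ring; apply Cexp_0. Qed.

(** Passing to functions on the whole line replaces the one-sided derivatives at the
    end points of [D] by ordinary ones, to which the product rule and the fundamental
    theorem of calculus apply. *)
Definition C3_extension (D : R -> Prop) (f : R -> C) (G : nat -> R -> C) : Prop :=
  (forall k x, (k < 3)%nat -> is_derive (V := CR) (G k) x (G (S k) x)) /\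
  (forall x, continuous (U := CR) (G 3%nat) x) /\
  (forall k x, (k <= 3)%nat -> D x -> deriv_on D k f x = G k x).

(** The boundary terms of three integrations by parts against [ker mu]. *)
Definition boundary_form (mu : C) (G : nat -> R -> C) (x : R) : C :=
  (ker mu x * (G 2%nat x + Ci * mu * G 1%nat x - mu * mu * G 0%nat x))%C.

Lemma is_derive_boundary_form (mu : C) (G : nat -> R -> C) (x : R) :
  (forall k x, (k < 3)%nat -> is_derive (V := CR) (G k) x (G (S k) x)) ->
  is_derive (V := CR) (boundary_form mu G) x
    (ker mu x * G 3%nat x + Ci * (mu * mu * mu) * (ker mu x * G 0%nat x))%C.
Proof.
intros HG.
evar_last.
- apply is_derive_Cmult; [apply is_derive_ker|].
  apply (is_derive_Cplus _ (fun t => - (mu * mu * G 0%nat t))%C).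
  + apply is_derive_Cplus; [apply HG; auto|].
    apply is_derive_Cscal, HG; auto.
  + apply (is_derive_opp (V := CR) (fun t => mu * mu * G 0%nat t)%C), is_derive_Cscal, HG; auto.
- change (- Ci * mu * ker mu x * (G 2%nat x + Ci * mu * G 1%nat x - mu * mu * G 0%nat x)
    + ker mu x * (G 3%nat x + Ci * mu * G 2%nat x - mu * mu * G 1%nat x)
    = ker mu x * G 3%nat x + Ci * (mu * mu * mu) * (ker mu x * G 0%nat x))%C.
  assert (E : (Ci * Ci)%C = (- RtoC 1)%C) by (unfold Ci, Cmult, Copp, RtoC; simpl; f_equal; ring).
  ring [E].
Qed.

(** Three integrations by parts at once: [boundary_form mu G] is a primitive of
    [ker mu * G 3 + i mu^3 * ker mu * G 0]. *)
Lemma green (b : Rbar) (mu : C) (G : nat -> R -> C) (B t : C) :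
  (forall k x, (k < 3)%nat -> is_derive (V := CR) (G k) x (G (S k) x)) ->
  (forall x, continuous (U := CR) (G 3%nat) x) ->
  filterlim (boundary_form mu G) (end_filter b) (locally (T := CR) B) ->
  is_int b (fun x => ker mu x * G 0%nat x)%C t ->
  is_int b (fun x => ker mu x * G 3%nat x)%C
    (B - boundary_form mu G 0 - Ci * (mu * mu * mu) * t)%C.
Proof.
intros HG HC HB Ht.
assert (C0 : forall x, continuous (U := CR) (fun x => ker mu x * G 0%nat x)%C x).
{ intros x; apply continuous_Cmult; [apply continuous_ker|].
  exact (is_derive_continuous_C _ _ _ (HG 0%nat x ltac:(auto))). }
assert (C3 : forall x, continuous (U := CR) (fun x => ker mu x * G 3%nat x)%C x).
{ intros x; apply continuous_Cmult; [apply continuous_ker | apply HC]. }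
assert (HP : is_int b (fun x => ker mu x * G 3%nat x + Ci * (mu * mu * mu) * (ker mu x * G 0%nat x))%C
  (B - boundary_form mu G 0)%C).
{ apply is_int_of_RInt with (fun x => boundary_form mu G x - boundary_form mu G 0)%C.
  - intros x; apply (is_RInt_derive (V := C_R_CompleteNormedModule) (boundary_form mu G)).
    + intros y _; now apply is_derive_boundary_form.
    + intros y _; apply continuous_Cplus; trivial.
      apply continuous_Cmult; [apply continuous_const | apply C0].
  - apply (filterlim_comp_2 (G := locally (T := CR) B) (H := locally (T := CR) (- boundary_form mu G 0)%C)
      (boundary_form mu G) (fun _ => - boundary_form mu G 0)%C Cplus); trivial.
    + apply filterlim_const.
    + apply (filterlim_plus (V := CR)). }
assert (L := is_int_lin_comb b 1 (- (Ci * (mu * mu * mu))) _ _ _ _ HP Ht).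
replace (B - boundary_form mu G 0 - Ci * (mu * mu * mu) * t)%C with
  (1 * (B - boundary_form mu G 0) + - (Ci * (mu * mu * mu)) * t)%C by ring.
replace (fun x => ker mu x * G 3%nat x)%C with (fun x => 1 *
  (ker mu x * G 3%nat x + Ci * (mu * mu * mu) * (ker mu x * G 0%nat x))
  + - (Ci * (mu * mu * mu)) * (ker mu x * G 0%nat x))%C; trivial.
apply functional_extensionality; intros x; ring.
Qed.

(** * Cauchy's theorem for an unbounded sector *)

Lemma is_RInt_gen_from (F : (R -> Prop) -> Prop) {FF : Filter F} (a : R) (h I : R -> C) (l : C) :
  F (fun x => is_RInt (V := CR) h a x (I x)) -> filterlim I F (locally (T := CR) l) ->
  is_RInt_gen (V := CR) h (at_point a) F l.
Proof.
intros HI HL P HP; unfold filtermapi.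
assert (K := HL P HP); unfold filtermap in K.
apply (Filter_prod _ _ _ (fun x => x = a) (fun x => is_RInt (V := CR) h a x (I x) /\ P (I x))).
- reflexivity.
- now apply filter_and.
- intros x y -> [H1 H2]; now exists (I y).
Qed.

Lemma ex_RInt_C_on (f : R -> C) (a b : R) : a <= b ->
  (forall x, a <= x <= b -> continuous (U := CR) f x) ->
  is_RInt (V := CR) f a b (RInt (V := C_R_CompleteNormedModule) f a b).
Proof.
intros Hab H; apply (RInt_correct (V := C_R_CompleteNormedModule)).
apply (ex_RInt_continuous (V := C_R_CompleteNormedModule)).
now rewrite Rmin_left, Rmax_right.
Qed.

Lemma RInt_C_fst (f : R -> C) (a b : R) : ex_RInt (V := CR) f a b ->
  fst (RInt (V := C_R_CompleteNormedModule) f a b) = RInt (fun t => fst (f t)) a b.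
Proof.
intros H; symmetry; apply (is_RInt_unique (V := R_CompleteNormedModule)).
apply (is_RInt_fct_extend_fst (U := R_NormedModule) (V := R_NormedModule)).
now apply (RInt_correct (V := C_R_CompleteNormedModule)).
Qed.

Lemma RInt_C_snd (f : R -> C) (a b : R) : ex_RInt (V := CR) f a b ->
  snd (RInt (V := C_R_CompleteNormedModule) f a b) = RInt (fun t => snd (f t)) a b.
Proof.
intros H; symmetry; apply (is_RInt_unique (V := R_CompleteNormedModule)).
apply (is_RInt_fct_extend_snd (U := R_NormedModule) (V := R_NormedModule)).
now apply (RInt_correct (V := C_R_CompleteNormedModule)).
Qed.

Lemma is_derive_RInt_param_R (k k1 : R -> R -> R) (a b x : R) :
  locally x (fun y => forall t, is_derive (fun u => k u t) y (k1 y t)) ->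
  (forall t, continuous (fun p : R * R => k1 (fst p) (snd p)) (x, t)) ->
  locally x (fun y => ex_RInt (k y) a b) ->
  is_derive (fun y => RInt (k y) a b) x (RInt (k1 x) a b).
Proof.
intros Hd Hc Hi.
assert (E : RInt (fun t => Derive (fun u => k u t) x) a b = RInt (k1 x) a b).
{ apply RInt_ext; intros t _; apply is_derive_unique, (locally_singleton _ _ Hd). }
rewrite <- E; apply is_derive_RInt_param; trivial.
- apply filter_imp with (2 := Hd); intros y Hy t _; now exists (k1 y t).
- intros t _; apply continuity_2d_pt_ext_loc with k1.
  + destruct Hd as [d Hd]; exists d; intros u v Hu _.
    symmetry; apply is_derive_unique, Hd; exact Hu.
  + apply continuity_2d_pt_filterlim, Hc.
Qed.

Lemma is_derive_RInt_param_C (K K1 : R -> R -> C) (a b x : R) :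
  locally x (fun y => forall t, is_derive (V := CR) (fun u => K u t) y (K1 y t)) ->
  (forall t, continuous (U := CR) (fun p : R * R => K1 (fst p) (snd p)) (x, t)) ->
  (forall t, continuous (U := CR) (K1 x) t) ->
  locally x (fun y => ex_RInt (V := CR) (K y) a b) ->
  is_derive (V := CR) (fun y => RInt (V := C_R_CompleteNormedModule) (K y) a b) x
    (RInt (V := C_R_CompleteNormedModule) (K1 x) a b).
Proof.
intros Hd Hc Hc1 Hi.
assert (Hx : ex_RInt (V := CR) (K1 x) a b)
  by (eexists; apply ex_RInt_C, Hc1).
apply is_derive_C.
- rewrite (RInt_C_fst _ _ _ Hx).
  apply is_derive_ext_loc with (fun y => RInt (fun t => fst (K y t)) a b).
  { apply filter_imp with (2 := Hi); intros y Hy; symmetry; now apply RInt_C_fst. }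
  apply (is_derive_RInt_param_R (fun y t => fst (K y t)) (fun y t => fst (K1 y t))).
  + apply filter_imp with (2 := Hd); intros y Hy t; apply (is_derive_C_fst (fun u => K u t)), Hy.
  + intros t; apply (continuous_C_fst (fun p : R * R => K1 (fst p) (snd p))), Hc.
  + apply filter_imp with (2 := Hi); intros y [l Hl]; exists (fst l).
    now apply (is_RInt_fct_extend_fst (U := R_NormedModule) (V := R_NormedModule)).
- rewrite (RInt_C_snd _ _ _ Hx).
  apply is_derive_ext_loc with (fun y => RInt (fun t => snd (K y t)) a b).
  { apply filter_imp with (2 := Hi); intros y Hy; symmetry; now apply RInt_C_snd. }
  apply (is_derive_RInt_param_R (fun y t => snd (K y t)) (fun y t => snd (K1 y t))).
  + apply filter_imp with (2 := Hd); intros y Hy t; apply (is_derive_C_snd (fun u => K u t)), Hy.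
  + intros t; apply (continuous_C_snd (fun p : R * R => K1 (fst p) (snd p))), Hc.
  + apply filter_imp with (2 := Hi); intros y [l Hl]; exists (snd l).
    now apply (is_RInt_fct_extend_snd (U := R_NormedModule) (V := R_NormedModule)).
Qed.

Definition cis (th : R) : C := Cexp (Ci * th)%C.

Lemma is_derive_cis (th : R) : is_derive (V := CR) cis th (Ci * cis th)%C.
Proof.
apply is_derive_eq_C with (1 := is_derive_Cexp _ _ _ (is_derive_Cscal Ci _ _ _ (is_derive_Cid th))).
unfold cis; ring.
Qed.

Lemma Cmod_cis (th : R) : Cmod (cis th) = 1.
Proof. unfold cis; rewrite Cmod_Cexp, <- exp_0; f_equal; unfold Re; simpl; ring. Qed.

Lemma is_derive_ray (th r : R) : is_derive (V := CR) (ray th) r (cis th).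
Proof.
apply is_derive_eq_C with (1 := is_derive_Cmult _ _ _ _ _ (is_derive_Cid r) (is_derive_Cconst (cis th) r)).
ring.
Qed.

Lemma is_derive_circ (r th : R) : is_derive (V := CR) (circ r) th (Ci * circ r th)%C.
Proof.
apply is_derive_eq_C with (1 := is_derive_Cscal r _ _ _ (is_derive_cis th)).
unfold circ, cis; ring.
Qed.

Lemma Cmod_ray (th r : R) : 0 <= r -> Cmod (ray th r) = r.
Proof.
intros Hr; change (ray th r) with (r * cis th)%C.
rewrite Cmod_mult, Cmod_cis, Cmod_R, Rabs_pos_eq; lra.
Qed.

Lemma ray_neq_0 (th r : R) : 0 < r -> ray th r <> RtoC 0.
Proof.
intros Hr E; assert (H := Cmod_ray th r ltac:(lra)); rewrite E, Cmod_0 in H; lra.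
Qed.

(** Complex differentiability enters Cauchy's theorem only through the chain rule
    along rays and circles; taken as a definition, the chain rule passes at once to
    sums and products. *)
Definition holomorphic_off_0 (f : C -> C) : Prop := exists f' : C -> C,
  (forall u x u', u x <> RtoC 0 -> is_derive (V := CR) u x u' ->
     is_derive (V := CR) (fun t => f (u t)) x (f' (u x) * u')%C) /\
  (forall z, z <> RtoC 0 ->
     continuous (T := CR) (U := CR) f z /\ continuous (T := CR) (U := CR) f' z).

Lemma continuous_ray2 (r th : R) : continuous (U := CR) (fun p : R * R => ray (snd p) (fst p)) (r, th).
Proof.
apply continuous_Cmult.
- apply continuous_RtoC, (@continuous_fst R_UniformSpace R_UniformSpace).
- apply continuous_Cexp, continuous_Cmult; [apply continuous_const|].
  apply continuous_RtoC, (@continuous_snd R_UniformSpace R_UniformSpace).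
Qed.

Lemma continuous_polar_slice (K : R -> R -> C) (r th : R) :
  continuous (U := CR) (fun p : R * R => K (fst p) (snd p)) (r, th) ->
  continuous (U := CR) (K r) th.
Proof.
intros H; apply (continuous_comp_2 (U := R_UniformSpace) (V := R_UniformSpace) (W := R_UniformSpace)
  (X := CR) (fun _ => r) (fun t => t) K th); trivial;
  [apply continuous_const | apply continuous_id].
Qed.

(** Let [A r] be the integral over the arc of radius r, taken anticlockwise, and
    [B th r] the integral along the ray at [th] from [r0] to [r].  With
    z = r exp(i th), the r-derivative of f(z) i z and the th-derivative of
    f(z) exp(i th) are the same function, called [K1] in the proof.  Differentiating
    [A] under the integral sign, and integrating [K1] over the arc, identifies the
    derivative of [A] with the difference of the integrands of [B th2] and [B th1].
    The bound on f makes [A r] of size (th2 - th1) M / r. *)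
Lemma arc_integral_limit (f : C -> C) (r0 th1 th2 M : R) :
  holomorphic_off_0 f -> 0 < r0 -> th1 <= th2 -> 0 <= M ->
  (forall r th, r0 <= r -> th1 <= th <= th2 -> Cmod (f (ray th r)) <= M / (r * r)) ->
  forall (A : R -> C) (B : R -> R -> C), A = (fun r => RInt (V := C_R_CompleteNormedModule)
                     (fun th => f (ray th r) * (Ci * ray th r))%C th1 th2) ->
  B = (fun th r => RInt (V := C_R_CompleteNormedModule)
                     (fun s => f (ray th s) * cis th)%C r0 r) ->
  (forall r, r0 <= r -> A r = (A r0 + (B th2 r - B th1 r))%C) /\
  filterlim A (Rbar_locally p_infty) (locally (T := CR) (RtoC 0)).
Proof.
intros (f' & Hf & Hc) Hr0 Hth HM Hb A B EA EB.
assert (Cr : forall th r, 0 < r -> continuous (U := CR) (fun s => f (ray th s) * cis th)%C r).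
{ intros th r Hr; apply continuous_Cmult; [|apply continuous_const].
  exact (is_derive_continuous_C _ _ _ (Hf _ _ _ (ray_neq_0 th r Hr) (is_derive_ray th r))). }
assert (Dth : forall r th, 0 < r ->
  is_derive (V := CR) (fun t => f (ray t r)) th (f' (ray th r) * (Ci * ray th r))%C).
{ intros r th Hr; exact (Hf (circ r) th _ (ray_neq_0 th r Hr) (is_derive_circ r th)). }
set (K1 := fun r th => (f' (ray th r) * cis th * (Ci * ray th r) + f (ray th r) * (Ci * cis th))%C).
assert (CK : forall r th, 0 < r ->
  continuous (U := CR) (fun t => f (ray t r) * (Ci * ray t r))%C th).
{ intros r th Hr; apply continuous_Cmult.
  - exact (is_derive_continuous_C _ _ _ (Dth r th Hr)).
  - apply continuous_Cmult; [apply continuous_const|].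
    exact (is_derive_continuous_C _ _ _ (is_derive_circ r th)). }
assert (CK1 : forall r th, 0 < r ->
  continuous (U := CR) (fun p : R * R => K1 (fst p) (snd p)) (r, th)).
{ intros r th Hr; unfold K1.
  assert (Ccis : continuous (U := CR) (fun p : R * R => cis (snd p)) (r, th)).
  { apply continuous_Cexp, continuous_Cmult; [apply continuous_const|].
    apply continuous_RtoC, (@continuous_snd R_UniformSpace R_UniformSpace). }
  assert (Cray := continuous_ray2 r th).
  destruct (Hc (ray th r) (ray_neq_0 th r Hr)) as [C1 C2].
  assert (CI : continuous (U := CR) (fun _ : R * R => Ci) (r, th)) by apply continuous_const.
  assert (C1' := continuous_comp (V := CR) (fun p : R * R => ray (snd p) (fst p)) f (r, th) Cray C1).
  assert (C2' := continuous_comp (V := CR) (fun p : R * R => ray (snd p) (fst p)) f' (r, th) Cray C2).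
  exact (continuous_Cplus _ _ _
    (continuous_Cmult _ _ _ (continuous_Cmult _ _ _ C2' Ccis) (continuous_Cmult _ _ _ CI Cray))
    (continuous_Cmult _ _ _ C1' (continuous_Cmult _ _ _ CI Ccis))). }
assert (CK1' : forall r th, 0 < r -> continuous (U := CR) (K1 r) th).
{ intros r th Hr; now apply continuous_polar_slice, CK1. }
assert (HA : forall r, 0 < r ->
  is_derive (V := CR) A r (f (ray th2 r) * cis th2 - f (ray th1 r) * cis th1)%C).
{ intros r Hr.
  assert (Lr : locally r (fun s => 0 < s)) by now apply open_gt.
  assert (E : RInt (V := C_R_CompleteNormedModule) (K1 r) th1 th2
    = (f (ray th2 r) * cis th2 - f (ray th1 r) * cis th1)%C).
  { apply (is_RInt_unique (V := C_R_CompleteNormedModule)).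
    apply (is_RInt_derive (V := C_R_CompleteNormedModule) (fun t => f (ray t r) * cis t)%C).
    - intros t _.
      apply is_derive_eq_C with (1 := is_derive_Cmult _ _ _ _ _ (Dth r t Hr) (is_derive_cis t)).
      unfold K1; ring.
    - intros t _; now apply CK1'. }
  rewrite <- E, EA; apply is_derive_RInt_param_C.
  - apply filter_imp with (2 := Lr); intros s Hs t.
    apply is_derive_eq_C with (1 := is_derive_Cmult _ _ _ _ _
      (Hf _ _ _ (ray_neq_0 t s Hs) (is_derive_ray t s))
      (is_derive_Cscal Ci _ _ _ (is_derive_ray t s))).
    unfold K1; ring.
  - intros t; now apply CK1.
  - intros t; now apply CK1'.
  - apply filter_imp with (2 := Lr); intros s Hs; eexists; apply ex_RInt_C; intros t; now apply CK. }
split.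
- intros r Hr.
  assert (I1 : forall th, is_RInt (V := CR) (fun s => f (ray th s) * cis th)%C r0 r (B th r)).
  { intros th; rewrite EB; apply ex_RInt_C_on; trivial; intros s Hs; apply Cr; lra. }
  assert (I2 : is_RInt (V := CR) (fun s => f (ray th2 s) * cis th2 - f (ray th1 s) * cis th1)%C r0 r
    (A r - A r0)%C).
  { apply (is_RInt_derive (V := C_R_CompleteNormedModule) A); rewrite Rmin_left, Rmax_right by trivial.
    - intros s Hs; apply HA; lra.
    - intros s Hs; apply (continuous_minus (V := CR)); apply Cr; lra. }
  assert (E : (A r - A r0)%C = (B th2 r - B th1 r)%C).
  { rewrite <- (is_RInt_unique (V := C_R_CompleteNormedModule) _ _ _ _ I2).
    apply (is_RInt_unique (V := C_R_CompleteNormedModule)).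
    apply (is_RInt_minus (V := CR)); apply I1. }
  rewrite <- E; ring.
- apply filterlim_Cmod; [apply (end_filter_proper p_infty)|]; intros e He.
  set (L := (th2 - th1) * M).
  assert (HL : 0 <= L) by (apply Rmult_le_pos; lra).
  exists (Rmax r0 (L / e)); intros r Hr.
  assert (A1 := Rmax_l r0 (L / e)); assert (A2 := Rmax_r r0 (L / e)).
  replace (A r - RtoC 0)%C with (A r) by ring.
  apply Rle_lt_trans with (L / r).
  + apply (Cmod_RInt_le (fun th => f (ray th r) * (Ci * ray th r))%C (fun _ => M / r) th1 th2); trivial.
    * intros th Ht; rewrite !Cmod_mult, Cmod_ray by lra.
      replace (Cmod Ci) with 1 by (rewrite <- (Cmod_cis (PI / 2)); f_equal; unfold cis;
        rewrite Cexp_i, cos_PI2, sin_PI2; reflexivity).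
      replace (M / r) with (M / (r * r) * (1 * r)) by (field; lra).
      apply Rmult_le_compat_r; [lra|]; apply Hb; lra.
    * rewrite EA; apply ex_RInt_C; intros t; apply CK; lra.
    * replace (L / r) with (scal (th2 - th1) (M / r))
        by (unfold L, scal; simpl; unfold mult; simpl; field; lra).
      apply (is_RInt_const (V := R_NormedModule)).
  + apply Rmult_lt_reg_r with r; [lra|].
    assert (H : L / e < r) by lra.
    apply (Rmult_lt_compat_r e) in H; trivial.
    replace (L / e * e) with L in H by (field; lra).
    replace (L / r * r) with L by (field; lra); lra.
Qed.

Lemma ray_integral_converges (h : R -> C) (r0 M : R) : 0 < r0 -> 0 <= M ->
  (forall r, r0 <= r -> continuous (U := CR) h r) ->
  (forall r, r0 <= r -> Cmod (h r) <= M / (r * r)) ->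
  exists l, filterlim (fun r => RInt (V := C_R_CompleteNormedModule) h r0 r)
    (Rbar_locally p_infty) (locally (T := CR) l).
Proof.
intros Hr0 HM Hc Hb.
apply (filterlim_of_decrements _ (fun r => M / r) r0).
- intros u v Huv.
  assert (HI : forall x, r0 <= x -> is_RInt (V := CR) h r0 x
    (RInt (V := C_R_CompleteNormedModule) h r0 x)).
  { intros x Hx; apply ex_RInt_C_on; trivial; intros s Hs; apply Hc; lra. }
  apply (Cmod_RInt_decrement h (fun r => M / (r * r)) (fun r => M / r) u v); [lra| | | |].
  + match goal with |- is_RInt _ _ _ (?x - ?y)%C =>
      replace (x - y)%C with (plus (opp (y : CR)) (x : CR)) by (apply Cplus_comm) end.
    apply (is_RInt_Chasles (V := CR)) with r0; [apply (is_RInt_swap (V := CR))|]; apply HI; lra.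
  + intros x Hx; apply Hb; lra.
  + intros x Hx; auto_derive; [lra|field; lra].
  + intros x Hx; apply (ex_derive_continuous (V := R_NormedModule)); auto_derive; nra.
- intros u Hu; apply Rdiv_le_0_compat; lra.
- intros e He; exists (Rmax r0 (M / e)); intros r Hr.
  assert (A1 := Rmax_l r0 (M / e)); assert (A2 := Rmax_r r0 (M / e)).
  apply Rmult_lt_reg_r with r; [lra|].
  assert (H : M / e < r) by lra.
  apply (Rmult_lt_compat_r e) in H; trivial.
  replace (M / e * e) with M in H by (field; lra).
  replace (M / r * r) with M by (field; lra); lra.
Qed.

(** The outer radius tends to infinity in [arc_integral_limit].  Traversed with the
    sector on its left, the boundary contributes [- v2], then [v2 - v1] for the clockwise
    arc, then [v1], and these add up to zero. *)
Lemma cauchy_sector (f : C -> C) (r0 th1 th2 M : R) :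
  holomorphic_off_0 f -> 0 < r0 -> th1 <= th2 -> 0 <= M ->
  (forall r th, r0 <= r -> th1 <= th <= th2 -> Cmod (f (ray th r)) <= M / (r * r)) ->
  exists v1 v2 : C,
    is_path_int (Path (ray th1) r0 p_infty) f v1 /\
    is_path_int (Path (ray th2) r0 p_infty) f v2 /\
    is_path_int (Path (circ r0) th2 th1) f (v2 - v1)%C.
Proof.
intros Hf Hr0 Hth HM Hb; assert (Hf0 := Hf); destruct Hf0 as (f' & Hf' & _).
assert (Cr : forall th r, 0 < r -> continuous (U := CR) (fun s => f (ray th s) * cis th)%C r).
{ intros th r Hr; apply continuous_Cmult; [|apply continuous_const].
  exact (is_derive_continuous_C _ _ _ (Hf' _ _ _ (ray_neq_0 th r Hr) (is_derive_ray th r))). }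
assert (L : forall th, th1 <= th <= th2 -> exists l, filterlim
  (fun r => RInt (V := C_R_CompleteNormedModule) (fun s => f (ray th s) * cis th)%C r0 r)
  (Rbar_locally p_infty) (locally (T := CR) l)).
{ intros th Ht; apply ray_integral_converges with M; trivial.
  - intros r Hr; apply Cr; lra.
  - intros r Hr; rewrite Cmod_mult, Cmod_cis, Rmult_1_r; now apply Hb. }
destruct (L th1 ltac:(lra)) as [v1 H1]; destruct (L th2 ltac:(lra)) as [v2 H2].
exists v1, v2.
assert (P : forall th v, filterlim
  (fun r => RInt (V := C_R_CompleteNormedModule) (fun s => f (ray th s) * cis th)%C r0 r)
  (Rbar_locally p_infty) (locally (T := CR) v) -> is_path_int (Path (ray th) r0 p_infty) f v).
{ intros th v Hv; unfold is_path_int; simpl curve.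
  replace (fun t => (f (ray th t) * deriv_on whole 1 (ray th) t)%C)
    with (fun t => f (ray th t) * cis th)%C
    by (apply functional_extensionality; intros t; rewrite deriv_ray; unfold cis; now rewrite Cexp_i).
  apply (is_RInt_gen_from (Rbar_locally p_infty)) with (2 := Hv).
  exists r0; intros x Hx; apply ex_RInt_C_on; [lra|]; intros s Hs; apply Cr; lra. }
split; [now apply P|]; split; [now apply P|].
destruct (arc_integral_limit f r0 th1 th2 M Hf Hr0 Hth HM Hb _ _ eq_refl eq_refl) as [HA HA0].
set (A := (fun r => RInt (V := C_R_CompleteNormedModule)
  (fun th => f (ray th r) * (Ci * ray th r))%C th1 th2) : R -> C) in *.
cbv beta in HA, HA0.
assert (EA : (A r0 + (v2 - v1))%C = RtoC 0).
{ apply (filterlim_locally_unique (V := CR) (F := Rbar_locally p_infty)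
    (FF := Proper_StrongProper _ (end_filter_proper p_infty)) A); trivial.
  apply (filterlim_ext_loc (fun r => A r0 +
    (RInt (V := C_R_CompleteNormedModule) (fun s => f (ray th2 s) * cis th2)%C r0 r
     - RInt (V := C_R_CompleteNormedModule) (fun s => f (ray th1 s) * cis th1)%C r0 r))%C).
  { exists r0; intros r Hr; symmetry; apply HA; lra. }
  apply filterlim_Cmod; [apply (end_filter_proper p_infty)|]; intros e He.
  assert (K1 := proj1 (filterlim_Cmod _ _ _) H1 (e / 2) ltac:(lra)).
  assert (K2 := proj1 (filterlim_Cmod _ _ _) H2 (e / 2) ltac:(lra)).
  generalize (filter_and _ _ K1 K2); apply filter_imp; intros r [L1 L2].
  match goal with |- Cmod (?a + (?x - ?y) - _)%C < _ => set (x2 := x : C) in *; set (x1 := y : C) in * end.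
  replace (A r0 + (x2 - x1) - (A r0 + (v2 - v1)))%C with (x2 - v2 + - (x1 - v1))%C by ring.
  eapply Rle_lt_trans; [apply Cmod_triangle|]; rewrite Cmod_opp; lra. }
assert (EA' : (v2 - v1)%C = (- A r0)%C).
{ replace (v2 - v1)%C with (- A r0 + (A r0 + (v2 - v1)))%C by ring; rewrite EA; ring. }
rewrite EA'; change (- A r0)%C with (opp (A r0 : CR)).
unfold is_path_int; simpl curve; apply (is_RInt_gen_at_point (V := CR)), (is_RInt_swap (V := CR)).
replace (fun t => (f (circ r0 t) * deriv_on whole 1 (circ r0) t)%C)
  with (fun th => f (ray th r0) * (Ci * ray th r0))%C.
2:{ apply functional_extensionality; intros t; rewrite deriv_circ.
    change (circ r0 t) with (ray t r0); rewrite ray_pair; apply (f_equal (Cmult _)).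
    unfold Ci, Cmult; cbn [fst snd]; apply injective_projections; cbn [fst snd]; ring. }
apply ex_RInt_C; intros t; apply continuous_Cmult.
- exact (is_derive_continuous_C _ _ _ (Hf' (circ r0) t _ (ray_neq_0 t r0 Hr0) (is_derive_circ r0 t))).
- apply continuous_Cmult; [apply continuous_const|].
  exact (is_derive_continuous_C _ _ _ (is_derive_circ r0 t)).
Qed.

Lemma continuous_Cinv (z : C) : z <> RtoC 0 -> continuous (T := CR) (U := CR) Cinv z.
Proof.
intros Hz.
assert (N : fst z ^ 2 + snd z ^ 2 <> 0).
{ intros E; apply Hz; apply injective_projections; simpl in *; nra. }
assert (I : continuous (U := CR) (fun w : CR => w) z) by apply continuous_id.
assert (C1 := continuous_C_fst (fun w : CR => w) z I).
assert (C2 := continuous_C_snd (fun w : CR => w) z I).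
assert (S : forall g : CR -> R, continuous g z -> continuous (fun w => g w ^ 2) z).
{ intros g Hg; apply (continuous_mult (K := R_AbsRing)); trivial.
  apply (continuous_mult (K := R_AbsRing)); trivial; apply continuous_const. }
assert (V : continuous (fun w : CR => / (fst w ^ 2 + snd w ^ 2)) z).
{ apply (continuous_comp (fun w : CR => fst w ^ 2 + snd w ^ 2) Rinv); [|now apply continuous_Rinv].
  apply (continuous_plus (V := R_NormedModule)); now apply S. }
apply continuous_C; unfold Cinv, Rdiv; cbn [fst snd];
  apply (continuous_mult (K := R_AbsRing)); trivial.
now apply (continuous_opp (V := R_NormedModule)).
Qed.

Lemma is_derive_Cinv (u : R -> C) (x : R) (l : C) : u x <> RtoC 0 ->
  is_derive (V := CR) u x l ->
  is_derive (V := CR) (fun t => / u t)%C x (- / (u x * u x) * l)%C.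
Proof.
intros Hz H.
assert (H1 := is_derive_C_fst u x l H); assert (H2 := is_derive_C_snd u x l H).
set (p := fun t => fst (u t)) in *; set (q := fun t => snd (u t)) in *.
assert (N : p x * p x + q x * q x <> 0).
{ intros E; apply Hz; apply injective_projections; unfold p, q in E; simpl; nra. }
assert (E : (- / (u x * u x) * l)%C =
  (fst l / (p x * p x + q x * q x) - p x * (2 * p x * fst l + 2 * q x * snd l)
     / ((p x * p x + q x * q x) * (p x * p x + q x * q x)),
   - snd l / (p x * p x + q x * q x) + q x * (2 * p x * fst l + 2 * q x * snd l)
     / ((p x * p x + q x * q x) * (p x * p x + q x * q x)))).
{ assert (N2 : (u x * u x)%C <> RtoC 0) by now apply Cmult_neq_0.
  apply injective_projections; unfold Cinv, Cmult, Copp; cbn [fst snd]; fold (p x) (q x); simpl; field;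
    split; trivial;
  replace ((p x * p x - q x * q x) * (p x * p x - q x * q x)
    + (p x * q x + q x * p x) * (p x * q x + q x * p x))
    with ((p x * p x + q x * q x) * (p x * p x + q x * q x)) by ring; nra. }
rewrite E; apply is_derive_C; unfold Cinv; cbn [fst snd].
- change (is_derive (fun t => p t / (p t ^ 2 + q t ^ 2)) x (fst l / (p x * p x + q x * q x) -
   p x * (2 * p x * fst l + 2 * q x * snd l) / ((p x * p x + q x * q x) * (p x * p x + q x * q x)))).
  auto_derive.
  + repeat split; try (eexists; eassumption); simpl; lra.
  + replace (Derive (fun x0 : R => p x0) x) with (fst l) by (symmetry; now apply is_derive_unique).
    replace (Derive (fun x0 : R => q x0) x) with (snd l) by (symmetry; now apply is_derive_unique).
    field; simpl; lra.
- change (is_derive (fun t => - q t / (p t ^ 2 + q t ^ 2)) x (- snd l / (p x * p x + q x * q x) +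
   q x * (2 * p x * fst l + 2 * q x * snd l) / ((p x * p x + q x * q x) * (p x * p x + q x * q x)))).
  auto_derive.
  + repeat split; try (eexists; eassumption); simpl; lra.
  + replace (Derive (fun x0 : R => p x0) x) with (fst l) by (symmetry; now apply is_derive_unique).
    replace (Derive (fun x0 : R => q x0) x) with (snd l) by (symmetry; now apply is_derive_unique).
    field; simpl; lra.
Qed.

Lemma holomorphic_const (c : C) : holomorphic_off_0 (fun _ => c).
Proof.
exists (fun _ => RtoC 0); split.
- intros u x u' _ _; apply is_derive_eq_C with (1 := is_derive_Cconst c x); ring.
- intros z _; split; apply continuous_const.
Qed.

Lemma holomorphic_plus (f g : C -> C) :
  holomorphic_off_0 f -> holomorphic_off_0 g -> holomorphic_off_0 (fun z => f z + g z)%C.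
Proof.
intros (f' & Hf & Cf) (g' & Hg & Cg); exists (fun z => f' z + g' z)%C; split.
- intros u x u' Hu Du.
  apply is_derive_eq_C with (1 := is_derive_Cplus _ _ _ _ _ (Hf u x u' Hu Du) (Hg u x u' Hu Du)); ring.
- intros z Hz; destruct (Cf z Hz), (Cg z Hz); split; now apply continuous_Cplus.
Qed.

Lemma holomorphic_mult (f g : C -> C) :
  holomorphic_off_0 f -> holomorphic_off_0 g -> holomorphic_off_0 (fun z => f z * g z)%C.
Proof.
intros (f' & Hf & Cf) (g' & Hg & Cg); exists (fun z => f' z * g z + f z * g' z)%C; split.
- intros u x u' Hu Du.
  apply is_derive_eq_C with (1 := is_derive_Cmult _ _ _ _ _ (Hf u x u' Hu Du) (Hg u x u' Hu Du)); ring.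
- intros z Hz; destruct (Cf z Hz), (Cg z Hz); split; [now apply continuous_Cmult|].
  apply continuous_Cplus; now apply continuous_Cmult.
Qed.

Lemma holomorphic_inv : holomorphic_off_0 Cinv.
Proof.
exists (fun z => - / (z * z))%C; split.
- intros u x u' Hu Du; now apply is_derive_Cinv.
- intros z Hz; split; [now apply continuous_Cinv|].
  apply (continuous_opp (V := CR) (fun w : CR => / (w * w))%C).
  apply (continuous_comp (V := CR) (fun w : CR => w * w)%C Cinv).
  + apply continuous_Cmult; apply continuous_id.
  + apply continuous_Cinv; now apply Cmult_neq_0.
Qed.

Lemma holomorphic_exp (c : C) : holomorphic_off_0 (fun z => Cexp (c * z)%C).
Proof.
assert (K : forall z, continuous (T := CR) (U := CR) (fun z => Cexp (c * z)%C) z).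
{ intros z; apply continuous_Cexp, continuous_Cmult; [apply continuous_const | apply continuous_id]. }
exists (fun z => c * Cexp (c * z))%C; split.
- intros u x u' Hu Du.
  apply is_derive_eq_C with (1 := is_derive_Cexp _ _ _ (is_derive_Cscal c _ _ _ Du)); ring.
- intros z Hz; split; trivial; apply continuous_Cmult; trivial; apply continuous_const.
Qed.

(** With a suitable [s], this is the form taken by every integrand
    exp(i lam x) R_lam / lam^3. *)
Definition decaying_exp (s : R) (a b : C) (lam : C) : C :=
  (Cexp (Ci * s * lam) * ((a * / lam + b) * (/ lam * / lam)))%C.

Lemma holomorphic_decaying_exp (s : R) (a b : C) : holomorphic_off_0 (decaying_exp s a b).
Proof.
unfold decaying_exp.
apply (holomorphic_mult (fun z => Cexp (Ci * s * z)) (fun z => (a * / z + b) * (/ z * / z)))%C.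
- apply holomorphic_exp.
- apply (holomorphic_mult (fun z => a * / z + b) (fun z => / z * / z))%C.
  + apply (holomorphic_plus (fun z => a * / z)%C (fun z => b)); [|apply holomorphic_const].
    apply (holomorphic_mult (fun z => a) Cinv); [apply holomorphic_const | apply holomorphic_inv].
  + apply (holomorphic_mult Cinv Cinv); apply holomorphic_inv.
Qed.

Lemma decaying_exp_bound (s : R) (a b : C) (r0 r th : R) :
  0 < r0 <= r -> 0 <= s * sin th ->
  Cmod (decaying_exp s a b (ray th r)) <= (Cmod a / r0 + Cmod b) / (r * r).
Proof.
intros Hr Hs; unfold decaying_exp.
assert (Hz := ray_neq_0 th r ltac:(lra)).
assert (Mz := Cmod_ray th r ltac:(lra)).
rewrite !Cmod_mult, !Cmod_inv, Mz by trivial.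
assert (A0 := Cmod_ge_0 a); assert (B0 := Cmod_ge_0 b).
assert (E : Cmod (Cexp (Ci * s * ray th r)) <= 1).
{ rewrite Cmod_Cexp, <- exp_0; apply exp_le_compat; rewrite ray_pair; unfold Re; simpl; nra. }
assert (I : / r <= / r0) by (apply Rinv_le_contravar; lra).
assert (I0 : 0 < / r) by (apply Rinv_0_lt_compat; lra).
assert (T : Cmod (a * / ray th r + b) <= Cmod a / r0 + Cmod b).
{ eapply Rle_trans; [apply Cmod_triangle|]; rewrite Cmod_mult, Cmod_inv, Mz by trivial.
  unfold Rdiv; nra. }
assert (T0 := Cmod_ge_0 (a * / ray th r + b)); assert (E0 := Cmod_ge_0 (Cexp (Ci * s * ray th r))).
replace ((Cmod a / r0 + Cmod b) / (r * r)) with (1 * ((Cmod a / r0 + Cmod b) * (/ r * / r)))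
  by (field; lra).
assert (0 < / r * / r) by nra.
apply Rmult_le_compat; trivial; [nra|]; apply Rmult_le_compat_r; lra.
Qed.

(** When one end is finite, all parameters between two values close to the respective
    ends belong to the path. *)
Lemma is_path_int_ext (p : path) (f g : C -> C) (v : C) :
  (exists r : R, start p = r \/ finish p = r) ->
  (forall z, on_path p z -> f z = g z) -> is_path_int p f v -> is_path_int p g v.
Proof.
intros Hp E H.
assert (E' : forall t, clitv (start p) (finish p) t \/ clitv (finish p) (start p) t ->
  f (curve p t) = g (curve p t)) by (intros t Ht; apply E; now exists t).
revert H; unfold is_path_int.
apply (is_RInt_gen_ext (V := CR) (FFa := filter_filter (ProperFilter := end_filter_proper _))
  (FFb := filter_filter (ProperFilter := end_filter_proper _))).
assert (K : exists P Q : R -> Prop, end_filter (start p) P /\ end_filter (finish p) Q /\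
  forall x y, P x -> Q y -> forall t, Rmin x y < t < Rmax x y ->
   clitv (start p) (finish p) t \/ clitv (finish p) (start p) t).
{ destruct p as [c [a| |] [b| |]]; simpl in *;
    try (exfalso; destruct Hp as [r [Hr|Hr]]; discriminate Hr).
  - exists (fun x => x = a), (fun y => y = b); split; [reflexivity|split; [reflexivity|]].
    intros x y -> -> t Ht; unfold clitv; simpl; unfold Rmin, Rmax in Ht; destruct (Rle_dec a b); lra.
  - exists (fun x => x = a), (fun y => a < y); split; [reflexivity|split; [now exists a|]].
    intros x y -> Hy t Ht; rewrite Rmin_left, Rmax_right in Ht by lra; unfold clitv; simpl; lra.
  - exists (fun x => x = a), (fun y => y < a); split; [reflexivity|split; [now exists a|]].
    intros x y -> Hy t Ht; rewrite Rmin_right, Rmax_left in Ht by lra; unfold clitv; simpl; lra.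
  - exists (fun x => b < x), (fun y => y = b); split; [now exists b|split; [reflexivity|]].
    intros x y Hx -> t Ht; rewrite Rmin_right, Rmax_left in Ht by lra; unfold clitv; simpl; lra.
  - exists (fun x => x < b), (fun y => y = b); split; [now exists b|split; [reflexivity|]].
    intros x y Hx -> t Ht; rewrite Rmin_left, Rmax_right in Ht by lra; unfold clitv; simpl; lra. }
destruct K as (P & Q & HP & HQ & K); apply (Filter_prod _ _ _ P Q); trivial.
intros x y Hx Hy t Ht; simpl in Ht; f_equal; now apply E', (K x y).
Qed.

Lemma is_contour_int_ext (g : contour) (f h : C -> C) (v : C) :
  (forall p, In p g -> exists r : R, start p = r \/ finish p = r) ->
  (forall z, on_contour g z -> f z = h z) -> is_contour_int g f v -> is_contour_int g h v.
Proof.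
revert v; induction g as [|p g IH]; intros v Hp E H; trivial.
destruct H as (v1 & v2 & H1 & H2 & ->); exists v1, v2; split; [|split; trivial].
- apply is_path_int_ext with f; trivial; [apply Hp; now left|].
  intros z Hz; apply E; exists p; split; trivial; now left.
- apply IH; trivial.
  + intros q Hq; apply Hp; now right.
  + intros z (q & Hq & Hz); apply E; exists q; split; trivial; now right.
Qed.

Lemma is_contour_int_app (g h : contour) (f : C -> C) (v w : C) :
  is_contour_int g f v -> is_contour_int h f w -> is_contour_int (g ++ h) f (v + w)%C.
Proof.
revert v; induction g as [|p g IH]; intros v Hg Hh; simpl in *.
- subst v; now replace (RtoC 0 + w)%C with w by ring.
- destruct Hg as (v1 & v2 & H1 & H2 & ->); exists v1, (v2 + w)%C; split; trivial; split; auto; ring.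
Qed.

Lemma is_path_int_rev (c : R -> C) (e1 e2 : Rbar) (f : C -> C) (v : C) :
  is_path_int (Path c e1 e2) f v -> is_path_int (Path c e2 e1) f (- v)%C.
Proof.
intros H; exact (is_RInt_gen_swap (V := CR) (FFa := filter_filter (ProperFilter := end_filter_proper _))
  (FFb := filter_filter (ProperFilter := end_filter_proper _)) _ _ H).
Qed.

(** The condition on the sines says that exp(i s lam) has modulus at most 1 in the
    sector. *)
Lemma sector_integral_zero (s : R) (a b : C) (th1 th2 : R) : th1 <= th2 ->
  (forall th, th1 <= th <= th2 -> 0 <= s * sin th) ->
  is_contour_int (sector_boundary th1 th2) (decaying_exp s a b) (RtoC 0).
Proof.
intros Hth Hs.
destruct (cauchy_sector (decaying_exp s a b) 1 th1 th2 (Cmod a / 1 + Cmod b))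
  as (v1 & v2 & H1 & H2 & H3); trivial.
- apply holomorphic_decaying_exp.
- lra.
- assert (A0 := Cmod_ge_0 a); assert (B0 := Cmod_ge_0 b); lra.
- intros r th Hr Ht; apply decaying_exp_bound; [lra | now apply Hs].
- exists (- v2)%C, v2; split; [now apply is_path_int_rev|split; [|ring]].
  exists (v2 - v1)%C, v1; split; trivial; split; [|ring].
  exists v1, (RtoC 0); split; trivial; split; [reflexivity | ring].
Qed.

Lemma is_RInt_gen_reflect (h : R -> C) (a : R) (v : C) :
  is_RInt_gen (V := CR) h (at_point a) (Rbar_locally p_infty) v ->
  is_RInt_gen (V := CR) (fun t => - h (- t)%R)%C (at_point (- a)) (Rbar_locally m_infty) v.
Proof.
intros H P HP; destruct (H P HP) as [Q S HQ [M HS] K].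
apply (Filter_prod _ _ _ (fun x => x = - a) (fun y => y < - M)); [reflexivity | now exists (- M) |].
intros x y -> Hy; destruct (K a (- y) HQ) as (w & Hw & Pw); [apply HS; lra|].
exists w; split; trivial; simpl in *.
apply (is_RInt_comp_opp (V := CR) h); now rewrite Ropp_involutive.
Qed.

(** As a set, [hl_Gamma_m rho] is the boundary of the sector of opening pi and inner
    radius [rho]; its left half-line is parametrised by R instead of the ray at pi. *)
Lemma half_plane_integral_zero (s : R) (a b : C) (rho : R) : 0 < rho -> 0 <= s ->
  is_contour_int (hl_Gamma_m rho) (decaying_exp s a b) (RtoC 0).
Proof.
intros Hrho Hs; assert (P := PI_RGT_0).
destruct (cauchy_sector (decaying_exp s a b) rho 0 PI (Cmod a / rho + Cmod b))
  as (v1 & v2 & H1 & H2 & H3); trivial.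
- apply holomorphic_decaying_exp.
- lra.
- assert (A0 := Cmod_ge_0 a); assert (B0 := Cmod_ge_0 b).
  assert (0 <= Cmod a / rho) by (apply Rdiv_le_0_compat; lra); lra.
- intros r th Hr Ht; apply decaying_exp_bound; [lra|].
  apply Rmult_le_pos; trivial; apply sin_ge_0; lra.
- exists (- v2)%C, v2; split; [|split; [|ring]].
  + assert (H2' := is_RInt_gen_reflect
      (fun t => decaying_exp s a b (ray PI t) * deriv_on whole 1 (ray PI) t)%C rho v2 H2).
    assert (E : forall t, deriv_on whole 1 RtoC t = RtoC 1)
      by (intros t; apply deriv_on_whole_1, is_derive_Cid).
    apply is_path_int_rev.
    change (is_RInt_gen (V := CR) (fun t => decaying_exp s a b (RtoC t) * deriv_on whole 1 RtoC t)%C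
      (at_point (- rho)) (Rbar_locally m_infty) v2).
    replace (fun t => decaying_exp s a b (RtoC t) * deriv_on whole 1 RtoC t)%C
      with (fun t => - (decaying_exp s a b (ray PI (- t)) * deriv_on whole 1 (ray PI) (- t)%R))%C;
      [exact H2'|].
    apply functional_extensionality; intros t; rewrite deriv_ray, E.
    replace (ray PI (- t)) with (RtoC t)
      by (rewrite ray_pair, cos_PI, sin_PI; unfold RtoC; f_equal; ring).
    rewrite cos_PI, sin_PI; change (-1, 0) with (RtoC (-1)).
    replace (RtoC (-1)) with (- RtoC 1)%C by (unfold Copp, RtoC; simpl; f_equal; ring); ring.
  + exists (v2 - v1)%C, v1; split; trivial; split; [|ring].
    exists v1, (RtoC 0); split; [|split; [reflexivity | ring]].
    change (is_RInt_gen (V := CR) (fun t => decaying_exp s a b (RtoC t) * deriv_on whole 1 RtoC t)%C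
      (at_point rho) (Rbar_locally p_infty) v1).
    replace (fun t => decaying_exp s a b (RtoC t) * deriv_on whole 1 RtoC t)%C
      with (fun t => decaying_exp s a b (ray 0 t) * deriv_on whole 1 (ray 0) t)%C; [exact H1|].
    apply functional_extensionality; intros t.
    rewrite deriv_ray, cos_0, sin_0, (deriv_on_whole_1 RtoC t (RtoC 1)) by apply is_derive_Cid.
    replace (ray 0 t) with (RtoC t); trivial.
    rewrite ray_pair, cos_0, sin_0; unfold RtoC; f_equal; ring.
Qed.

(** * The denominator Delta does not vanish on the contours *)

Lemma alpha_pair : alpha = (- (1 / 2), sqrt 3 / 2).
Proof.
unfold alpha; replace (2 * PI * Ci / 3)%C with (Ci * (2 * PI / 3)%R)%C.
- rewrite Cexp_i; replace (2 * PI / 3) with (PI - PI / 3) by field.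
  rewrite cos_minus, sin_minus, cos_PI, sin_PI, cos_PI3, sin_PI3; f_equal; field.
- unfold Cdiv, Cinv, Cmult, RtoC, Ci; apply injective_projections; cbn [fst snd]; field.
Qed.

Lemma sqrt3_sqr : sqrt 3 * sqrt 3 = 3.
Proof. apply sqrt_sqrt; lra. Qed.

Lemma alpha_sum : (1 + alpha + alpha * alpha)%C = RtoC 0.
Proof.
assert (S := sqrt3_sqr); rewrite alpha_pair.
unfold Cplus, Cmult, RtoC; apply injective_projections; cbn [fst snd]; lra.
Qed.

Lemma alpha_sqr : (alpha * alpha)%C = (- 1 - alpha)%C.
Proof.
replace (alpha * alpha)%C with ((1 + alpha + alpha * alpha) - 1 - alpha)%C by ring.
rewrite alpha_sum; ring.
Qed.

Lemma alpha_cube : (alpha * alpha * alpha)%C = RtoC 1.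
Proof. rewrite alpha_sqr; replace ((- 1 - alpha) * alpha)%C with (- alpha - alpha * alpha)%C by ring.
rewrite alpha_sqr; ring. Qed.

Lemma Ci_sqr : (Ci * Ci)%C = (- RtoC 1)%C.
Proof. unfold Ci, Cmult, Copp, RtoC; simpl; f_equal; ring. Qed.

Lemma Cmod_Ci : Cmod Ci = 1.
Proof.
assert (H := Cmod_sqr Ci); assert (H0 := Cmod_ge_0 Ci).
unfold Ci, Re, Im in H; simpl in H; fold Ci in H; nra.
Qed.

Lemma Cmod_alpha : Cmod alpha = 1.
Proof.
assert (H := Cmod_sqr alpha); assert (H0 := Cmod_ge_0 alpha); assert (S := sqrt3_sqr).
rewrite alpha_pair in H at 3 4 5 6; unfold Re, Im in H; simpl in H; nra.
Qed.

(** The general solution of K''' = i lam^3 K, for lam <> 0. *)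
Definition kcomb (lam c0 c1 c2 : C) (x : R) : C :=
  (c0 * ker lam x + c1 * ker (alpha * lam) x + c2 * ker (alpha * alpha * lam) x)%C.

Lemma is_derive_kcomb (lam c0 c1 c2 : C) (x : R) :
  is_derive (V := CR) (kcomb lam c0 c1 c2) x
    (kcomb lam (c0 * (- Ci * lam)) (c1 * (- Ci * (alpha * lam)))
       (c2 * (- Ci * (alpha * alpha * lam))) x)%C.
Proof.
evar_last.
- apply is_derive_Cplus; [apply is_derive_Cplus|]; apply is_derive_Cscal, is_derive_ker.
- unfold kcomb; cbv beta.
  match goal with |- ?a = ?b => change ((a : C) = b) end; ring.
Qed.

Lemma continuous_kcomb (lam c0 c1 c2 : C) (x : R) :
  continuous (U := CR) (kcomb lam c0 c1 c2) x.
Proof. exact (is_derive_continuous_C _ _ _ (is_derive_kcomb lam c0 c1 c2 x)). Qed.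

Lemma Delta_kcomb (lam : C) : Defs.Delta lam = kcomb lam 1 alpha (alpha * alpha) 1.
Proof.
unfold Defs.Delta, kcomb, ker.
replace (- Ci * lam * 1)%C with (- Ci * lam)%C by ring.
replace (- Ci * (alpha * lam) * 1)%C with (- Ci * alpha * lam)%C by ring.
replace (- Ci * (alpha * alpha * lam) * 1)%C with (- Ci * (alpha * alpha) * lam)%C by ring.
ring.
Qed.

Lemma sum3_neq_0 (z1 z2 z3 : C) : Cmod z2 + Cmod z3 < Cmod z1 -> (z1 + z2 + z3)%C <> RtoC 0.
Proof.
intros H E; assert (T := Cmod_triangle z2 z3).
replace (z2 + z3)%C with (- z1)%C in T; [rewrite Cmod_opp in T; lra|].
replace (- z1)%C with ((z2 + z3) - (z1 + z2 + z3))%C by ring; rewrite E; ring.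
Qed.

Lemma exp_dominates (T : R) : 17 / 20 <= T -> 1 + exp (- T) < exp T.
Proof.
intros HT; assert (E := exp_ineq1_le T).
assert (X : exp T * exp (- T) = 1) by (rewrite <- exp_plus, <- exp_0; f_equal; ring).
assert (P := exp_pos (- T)); assert (P' := exp_pos T).
assert (exp (- T) <= 20 / 37) by nra.
lra.
Qed.

(** On the rays at the multiples of pi/3 the three exponentials in [Delta] have
    moduli exp T, 1 and exp (- T), so that one of them dominates. *)
Lemma Delta_neq_0_ray (x y t : R) : 1 <= t ->
  ((x = t /\ y = 0) \/ (x = - t /\ y = 0) \/
   ((x = t / 2 \/ x = - (t / 2)) /\ (y = sqrt 3 / 2 * t \/ y = - (sqrt 3 / 2 * t)))) ->
  Defs.Delta (x, y) <> RtoC 0.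
Proof.
intros Ht Hxy.
assert (S := sqrt3_sqr); assert (S0 := sqrt_pos 3).
assert (S1 : 17 / 10 <= sqrt 3) by nra.
set (T := sqrt 3 / 2 * t) in *.
assert (HT : 17 / 20 <= T) by (unfold T; nra).
assert (D := exp_dominates T HT).
assert (E0 : exp 0 = 1) by apply exp_0.
assert (M0 : Cmod (1 * ker (x, y) 1)%C = exp y).
{ rewrite Cmod_mult, Cmod_ker, Cmod_1; unfold Im; cbn [snd]; rewrite Rmult_1_l; f_equal; ring. }
assert (M1 : Cmod (alpha * ker (alpha * (x, y)) 1)%C = exp (- (y / 2) + sqrt 3 / 2 * x)).
{ rewrite Cmod_mult, Cmod_ker, Cmod_alpha, alpha_pair; unfold Im, Cmult; cbn [fst snd].
  rewrite Rmult_1_l; f_equal; field. }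
assert (M2 : Cmod (alpha * alpha * ker (alpha * alpha * (x, y)) 1)%C
  = exp (- (y / 2) - sqrt 3 / 2 * x)).
{ rewrite !Cmod_mult, Cmod_ker, Cmod_alpha, alpha_sqr, alpha_pair.
  unfold Im, Cmult, Cminus, Cplus, Copp, RtoC.
  cbn [fst snd]; rewrite !Rmult_1_l; f_equal; field. }
rewrite Delta_kcomb; unfold kcomb.
set (z0 := (1 * _)%C) in *; set (z1 := (alpha * ker _ _)%C) in *.
set (z2 := (alpha * alpha * ker _ _)%C) in *.
assert (R1 : (z0 + z1 + z2)%C = (z1 + z0 + z2)%C) by ring.
assert (R2 : (z0 + z1 + z2)%C = (z2 + z0 + z1)%C) by ring.
destruct Hxy as [[Hx Hy]|[[Hx Hy]|[[Hx|Hx] [Hy|Hy]]]]; subst x y.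
- rewrite R1; apply sum3_neq_0; rewrite M0, M1, M2.
  replace (- (0 / 2) + sqrt 3 / 2 * t) with T by (unfold T; field).
  replace (- (0 / 2) - sqrt 3 / 2 * t) with (- T) by (unfold T; field). lra.
- rewrite R2; apply sum3_neq_0; rewrite M0, M1, M2.
  replace (- (0 / 2) + sqrt 3 / 2 * - t) with (- T) by (unfold T; field).
  replace (- (0 / 2) - sqrt 3 / 2 * - t) with T by (unfold T; field). lra.
- apply sum3_neq_0; rewrite M0, M1, M2.
  replace (- (T / 2) + sqrt 3 / 2 * (t / 2)) with 0 by (unfold T; field).
  replace (- (T / 2) - sqrt 3 / 2 * (t / 2)) with (- T) by (unfold T; field). lra.
- rewrite R1; apply sum3_neq_0; rewrite M0, M1, M2.
  replace (- (- T / 2) + sqrt 3 / 2 * (t / 2)) with T by (unfold T; field).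
  replace (- (- T / 2) - sqrt 3 / 2 * (t / 2)) with 0 by (unfold T; field). lra.
- apply sum3_neq_0; rewrite M0, M1, M2.
  replace (- (T / 2) + sqrt 3 / 2 * - (t / 2)) with (- T) by (unfold T; field).
  replace (- (T / 2) - sqrt 3 / 2 * - (t / 2)) with 0 by (unfold T; field). lra.
- rewrite R2; apply sum3_neq_0; rewrite M0, M1, M2.
  replace (- (- T / 2) + sqrt 3 / 2 * - (t / 2)) with 0 by (unfold T; field).
  replace (- (- T / 2) - sqrt 3 / 2 * - (t / 2)) with T by (unfold T; field). lra.
Qed.

(** From 7/8 <= exp(- 1/8), raised to the eighth power. *)
Lemma exp_1_lt_3 : exp 1 < 3.
Proof.
assert (H := exp_ineq1_le (- (1 / 8))).
assert (P := exp_pos (- (1 / 8))).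
set (y := exp (- (1 / 8))) in *.
assert (E : exp 1 * ((y * y) * (y * y) * ((y * y) * (y * y))) = 1).
{ unfold y; rewrite <- !exp_plus, <- exp_0; f_equal; field. }
assert (49 / 64 <= y * y) by nra.
assert (2401 / 4096 <= y * y * (y * y)) by nra.
assert (1 / 3 < y * y * (y * y) * (y * y * (y * y))) by nra.
assert (0 < exp 1) by apply exp_pos.
nra.
Qed.

Lemma growth_bound (g g' : R -> C) (c : R) (n : nat) :
  (forall x, is_derive (V := CR) g x (g' x)) -> (forall x, continuous (U := CR) g' x) ->
  g 0 = RtoC 0 ->
  (forall x, 0 <= x <= 1 -> Cmod (g' x) <= c * x ^ n) ->
  forall x, 0 <= x <= 1 -> Cmod (g x) <= c / INR (S n) * x ^ S n.
Proof.
intros Hd Hc H0 Hb x Hx.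
assert (N : INR (S n) <> 0) by now apply not_0_INR.
apply (Cmod_RInt_le g' (fun t => c * t ^ n) 0 x); [lra| | |].
- intros t Ht; apply Hb; lra.
- replace (g x) with (minus (g x : CR) (g 0)).
  + apply (is_RInt_derive (V := C_R_CompleteNormedModule) g); auto.
  + rewrite H0; change (g x - RtoC 0 = g x)%C; ring.
- replace (c / INR (S n) * x ^ S n) with
    (minus (c / INR (S n) * x ^ S n) (c / INR (S n) * 0 ^ S n))
    by (rewrite pow_i by apply Nat.lt_0_succ; unfold minus, plus, opp; simpl; ring).
  apply (is_RInt_derive (V := R_CompleteNormedModule) (fun t => c / INR (S n) * t ^ S n)).
  + intros t _; auto_derive; trivial; simpl pred; field; trivial.
  + intros t _; apply (ex_derive_continuous (V := R_NormedModule)); auto_derive; trivial.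
Qed.

(** At 0 the function [kcomb lam 1 alpha alpha^2] vanishes to second order with
    second derivative - 3 lam^2, and its third derivative is at most 3 e on
    the unit circle: its value at 1 is at distance at most e/2 < 3/2 from
    - 3 lam^2 / 2. *)
Lemma Delta_neq_0_circle (lam : C) : Cmod lam = 1 -> Defs.Delta lam <> RtoC 0.
Proof.
intros Hl.
set (w := (- Ci * lam)%C).
assert (Hw : Cmod w = 1) by (unfold w; rewrite Cmod_mult, Cmod_opp, Cmod_Ci, Hl; ring).
assert (A3 := alpha_cube); assert (AS := alpha_sum).
set (H0 := kcomb lam 1 alpha (alpha * alpha)).
set (H1 := kcomb lam w (alpha * alpha * w) (alpha * w)).
set (H2 := kcomb lam (w * w) (w * w) (w * w)).
set (H3 := kcomb lam (w * w * w) (alpha * w * w * w) (alpha * alpha * w * w * w)).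
assert (D0 : forall x, is_derive (V := CR) H0 x (H1 x)).
{ intros x; apply is_derive_eq_C with (1 := is_derive_kcomb lam _ _ _ x).
  unfold H1, w; f_equal; ring [A3]. }
assert (D1 : forall x, is_derive (V := CR) H1 x (H2 x)).
{ intros x; apply is_derive_eq_C with (1 := is_derive_kcomb lam _ _ _ x).
  unfold H2, w; f_equal; ring [A3]. }
assert (D2 : forall x, is_derive (V := CR) H2 x (H3 x)).
{ intros x; apply is_derive_eq_C with (1 := is_derive_kcomb lam _ _ _ x).
  unfold H3, w; f_equal; ring [A3]. }
assert (B3 : forall x, 0 <= x <= 1 -> Cmod (H3 x) <= 3 * exp 1 * x ^ 0).
{ intros x Hx.
  assert (Kb : forall mu, Cmod mu = 1 -> Cmod (ker mu x) <= exp 1).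
  { intros mu Hmu; rewrite Cmod_ker; apply exp_le_compat.
    assert (I := Cmod_sqr mu); rewrite Hmu in I; nra. }
  assert (K0 := Kb lam Hl).
  assert (K1 := Kb (alpha * lam)%C ltac:(rewrite Cmod_mult, Cmod_alpha, Hl; ring)).
  assert (K2 := Kb (alpha * alpha * lam)%C ltac:(rewrite !Cmod_mult, Cmod_alpha, Hl; ring)).
  unfold H3, kcomb.
  eapply Rle_trans; [apply Cmod_triangle|].
  eapply Rle_trans; [apply Rplus_le_compat_r, Cmod_triangle|].
  rewrite !Cmod_mult, Cmod_alpha, Hw; simpl; lra. }
assert (K00 : forall c0 c1 c2, kcomb lam c0 c1 c2 0 = (c0 + c1 + c2)%C).
{ intros; unfold kcomb; rewrite !ker_0; ring. }
assert (B2 := growth_bound (fun x => H2 x - 3 * (w * w))%C H3 (3 * exp 1) 0).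
assert (B1 := growth_bound (fun x => H1 x - 3 * (w * w) * x)%C (fun x => H2 x - 3 * (w * w))%C (3 * exp 1) 1).
assert (B0 := growth_bound (fun x => H0 x - 3 / 2 * (w * w) * (x * x))%C
  (fun x => H1 x - 3 * (w * w) * x)%C (3 * exp 1 / 2) 2).
assert (Dlin : forall c x, is_derive (V := CR) (fun x => - (c * RtoC x))%C x (- c)%C).
{ intros c x.
  apply (is_derive_ext (fun x => (- c) * RtoC x : CR)%C);
    [intros t; change ((- c * t)%C = (- (c * t))%C); ring|].
  apply is_derive_eq_C with (1 := is_derive_Cscal (- c) _ _ _ (is_derive_Cid x)); ring. }
assert (Dsq : forall c x, is_derive (V := CR) (fun x => - (c * (RtoC x * RtoC x)))%C x (- (2 * c * x))%C).
{ intros c x.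
  apply (is_derive_ext (fun x => (- c) * (RtoC x * RtoC x) : CR)%C);
    [intros t; change ((- c * (t * t))%C = (- (c * (t * t)))%C); ring|].
  apply is_derive_eq_C with (1 := is_derive_Cscal (- c) _ _ _
    (is_derive_Cmult _ _ _ _ _ (is_derive_Cid x) (is_derive_Cid x))); ring. }
assert (Cx : forall c x, continuous (U := CR) (fun x => - (c * RtoC x))%C x)
  by (intros c x; exact (is_derive_continuous_C _ _ _ (Dlin c x))).
assert (B2' : forall x, 0 <= x <= 1 -> Cmod (H2 x - 3 * (w * w))%C <= 3 * exp 1 * x ^ 1).
{ intros x Hx; replace (3 * exp 1) with (3 * exp 1 / INR 1) by (simpl; field); apply B2; trivial.
  - intros t; apply is_derive_eq_C with (1 := is_derive_Cplus _ _ _ _ _ (D2 t)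
      (is_derive_Cconst (- (3 * (w * w))) t)); ring.
  - intros t; apply continuous_kcomb.
  - unfold H2; rewrite K00; ring. }
assert (B1' : forall x, 0 <= x <= 1 -> Cmod (H1 x - 3 * (w * w) * x)%C <= 3 * exp 1 / 2 * x ^ 2).
{ intros x Hx; replace (3 * exp 1 / 2) with (3 * exp 1 / INR 2) by (simpl; field); apply B1; trivial.
  - intros t; apply is_derive_eq_C with (1 := is_derive_Cplus _ _ _ _ _ (D1 t) (Dlin _ t)); ring.
  - intros t; apply continuous_Cplus; [apply continuous_kcomb | apply continuous_const].
  - unfold H1; rewrite K00; transitivity (w * (1 + alpha + alpha * alpha))%C; [ring | rewrite AS; ring]. }
assert (F : Cmod (H0 1 - 3 / 2 * (w * w) * (1 * 1))%C <= 3 * exp 1 / 2 / INR 3 * 1 ^ 3).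
{ apply B0; trivial; [| | |lra].
  - intros t; apply is_derive_eq_C with (1 := is_derive_Cplus _ _ _ _ _ (D0 t) (Dsq _ t)); field.
  - intros t; apply continuous_Cplus; [apply continuous_kcomb | apply Cx].
  - unfold H0; rewrite K00; transitivity (1 + alpha + alpha * alpha)%C; [ring | exact AS]. }
intros E; rewrite Delta_kcomb in E; fold H0 in E; rewrite E in F.
replace (0 - 3 / 2 * (w * w) * (1 * 1))%C with (- (3 / 2 * (w * w)))%C in F by field.
rewrite Cmod_opp, !Cmod_mult, Hw in F.
replace (Cmod (3 / 2)) with (3 / 2) in F.
2:{ replace (3 / 2)%C with (RtoC (3 / 2)).
    - rewrite Cmod_R, Rabs_pos_eq; lra.
    - now rewrite RtoC_div by lra. }
assert (X := exp_1_lt_3); simpl in F; lra.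
Qed.

(** * Continuity of functionals *)

(** The bound by finitely many seminorms is quantified over [d] because seminorms take
    values in the extended reals. *)
Definition bounded_functional (X : fun_space) (E : functional) : Prop :=
  linear_functional X E /\
  exists (l : list (sn_index X)) (K : R), forall h d, 0 < d -> carrier X h ->
    (forall i, In i l -> Rbar_lt (seminorm X i h) d) -> Cmod (E h) <= K * d.

Lemma bounded_dual (X : fun_space) (E : functional) :
  subspace (carrier X) -> bounded_functional X E -> dual X E.
Proof.
intros [_ HX] [HL (l & K & HK)]; split; trivial; intros f Hf e He.
assert (K0 := Rabs_pos K); assert (K1 := Rle_abs K).
assert (Hd : 0 < e / (Rabs K + 1)) by (apply Rdiv_lt_0_compat; lra).
exists l, (e / (Rabs K + 1)); split; trivial; intros g Hg Hs.
assert (E1 : (fun x => (g x - f x)%C) = lin_comb 1 g (- (1)) f)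
  by (apply functional_extensionality; intros x; unfold lin_comb; ring).
assert (E2 : (E g - E f)%C = E (fun x => (g x - f x)%C)).
{ rewrite E1, HL by trivial; ring. }
rewrite E2; apply Rle_lt_trans with (K * (e / (Rabs K + 1))).
- apply HK; trivial; rewrite E1; now apply HX.
- assert (e / (Rabs K + 1) * (Rabs K + 1) = e) by (field; lra); nra.
Qed.

Lemma bounded_lin_comb (X : fun_space) (c d : C) (E F : functional) :
  bounded_functional X E -> bounded_functional X F ->
  bounded_functional X (fun f => c * E f + d * F f)%C.
Proof.
intros [LE (l1 & K1 & H1)] [LF (l2 & K2 & H2)]; split.
- intros a b f g Hf Hg; rewrite LE, LF by trivial; ring.
- exists (l1 ++ l2), (Cmod c * K1 + Cmod d * K2); intros h r Hr Hh Hs.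
  assert (A := H1 h r Hr Hh ltac:(intros i Hi; apply Hs, in_or_app; auto)).
  assert (B := H2 h r Hr Hh ltac:(intros i Hi; apply Hs, in_or_app; auto)).
  assert (C0 := Cmod_ge_0 c); assert (D0 := Cmod_ge_0 d).
  eapply Rle_trans; [apply Cmod_triangle|]; rewrite !Cmod_mult; nra.
Qed.

Lemma sup_on_lt (D : R -> Prop) (h : R -> R) (d x : R) :
  Rbar_lt (sup_on D h) d -> D x -> h x < d.
Proof.
intros H Dx; destruct (Lub_Rbar_correct (fun y => exists x, D x /\ y = h x)) as [U _].
assert (Hx := U (h x) (ex_intro _ x (conj Dx eq_refl))).
exact (Rbar_le_lt_trans (h x) _ d Hx H).
Qed.

(** * Continuous and smooth extensions from [0,1] *)

Definition clamp (x : R) : R := Rmax 0 (Rmin x 1).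

Lemma clamp_in (x : R) : unit_itv (clamp x).
Proof.
unfold clamp; split; simpl; [apply Rmax_l|].
apply Rmax_lub; [lra | apply Rmin_r].
Qed.

Lemma clamp_id (x : R) : unit_itv x -> clamp x = x.
Proof. intros [H1 H2]; simpl in H1, H2; unfold clamp; rewrite Rmin_left, Rmax_right; lra. Qed.

Lemma clamp_lip (x y : R) : Rabs (clamp y - clamp x) <= Rabs (y - x).
Proof.
unfold clamp, Rmax, Rmin.
repeat (destruct (Rle_dec _ _)); unfold Rabs; repeat (destruct (Rcase_abs _)); lra.
Qed.

Lemma continuous_clamp (f : R -> C) : (forall x, unit_itv x -> exists l, is_deriv_on unit_itv f x l) ->
  forall x, continuous (U := CR) (fun t => f (clamp t)) x.
Proof.
intros H x; apply filterlim_Cmod; [typeclasses eauto|]; intros e He.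
destruct (H _ (clamp_in x)) as [l Hl]; rewrite is_deriv_on_eps in Hl by apply clamp_in.
destruct (Hl 1 Rlt_0_1) as (d & Hd & K); assert (L0 := Cmod_ge_0 l).
assert (Hp : 0 < Rmin d (e / (Cmod l + 1))) by (apply Rmin_glb_lt; [|apply Rdiv_lt_0_compat]; lra).
exists (mkposreal _ Hp); intros y Hy.
assert (Hy' : Rabs (y - x) < Rmin d (e / (Cmod l + 1))) by exact Hy.
assert (A := Rmin_l d (e / (Cmod l + 1))); assert (B := Rmin_r d (e / (Cmod l + 1))).
assert (Li := clamp_lip x y).
assert (K' := K (clamp y) (clamp_in y) ltac:(lra)).
assert (T := Cmod_triangle (f (clamp y) - f (clamp x) - (clamp y - clamp x)%R * l)%C
  ((clamp y - clamp x)%R * l)%C).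
replace (f (clamp y) - f (clamp x) - (clamp y - clamp x)%R * l + (clamp y - clamp x)%R * l)%C
  with (f (clamp y) - f (clamp x))%C in T by ring.
rewrite Cmod_mult, Cmod_R in T.
assert (E : e / (Cmod l + 1) * (Cmod l + 1) = e) by (field; lra).
assert (P := Rabs_pos (clamp y - clamp x)); nra.
Qed.

Lemma zero_deriv_constant (h : R -> C) :
  (forall x, unit_itv x -> is_deriv_on unit_itv h x 0) -> forall x, unit_itv x -> h x = h 0.
Proof.
intros H.
(* Precomposing with the retraction [clamp] keeps the derivative zero, also at
   the end points. *)
assert (D : forall x, is_derive (V := CR) (fun t => h (clamp t)) x (RtoC 0)).
{ intros x; apply is_deriv_on_whole, is_deriv_on_eps; [exact I|]; intros e He.
  assert (Hx := H _ (clamp_in x)); rewrite is_deriv_on_eps in Hx by apply clamp_in.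
  destruct (Hx e He) as (d & Hd & K); exists d; split; trivial; intros y _ Hy.
  assert (Li := clamp_lip x y); specialize (K (clamp y) (clamp_in y) ltac:(lra)).
  replace (h (clamp y) - h (clamp x) - (y - x)%R * 0)%C
    with (h (clamp y) - h (clamp x) - (clamp y - clamp x)%R * 0)%C by ring.
  nra. }
intros x Hx; destruct (Req_dec x 0) as [->|Hne]; trivial.
assert (0 < x) by (destruct Hx as [Hx _]; simpl in Hx; lra).
rewrite <- (clamp_id x Hx), <- (clamp_id 0) by (split; simpl; lra).
symmetry; apply (eq_is_derive (V := CR) (fun t => h (clamp t)) 0 x); auto.
Qed.

(** [F] is a primitive of [G], and [F - f] has derivative zero on [0,1]. *)
Lemma extension_step (f f' G : R -> C) :
  (forall x, unit_itv x -> is_deriv_on unit_itv f x (f' x)) ->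
  (forall x, continuous (U := CR) G x) -> (forall x, unit_itv x -> f' x = G x) ->
  exists F, (forall x, is_derive (V := CR) F x (G x)) /\ forall x, unit_itv x -> f x = F x.
Proof.
intros Hf HG E.
exists (fun x => f 0 + RInt (V := C_R_CompleteNormedModule) G 0 x)%C.
set (F := fun x => (f 0 + RInt (V := C_R_CompleteNormedModule) G 0 x)%C).
assert (D : forall x, is_derive (V := CR) F x (G x)).
{ intros x; apply is_derive_eq_C with (0 + G x)%C; [|ring].
  apply is_derive_Cplus; [apply is_derive_Cconst|].
  apply (is_derive_RInt (V := CR) G _ 0); trivial.
  apply filter_forall; intros y; now apply ex_RInt_C. }
split; trivial; intros x Hx.
assert (F0 : F 0 = f 0).
{ unfold F; rewrite (is_RInt_unique (V := C_R_CompleteNormedModule) _ _ _ _ (is_RInt_point (V := CR) G 0)).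
  change (zero : CR) with (RtoC 0); ring. }
assert (K := zero_deriv_constant (lin_comb 1 f (- (1)) F)).
assert (KE : lin_comb 1 f (- (1)) F x = lin_comb 1 f (- (1)) F 0).
{ apply K; trivial; intros y Hy; replace (RtoC 0) with (1 * f' y + - (1) * G y)%C.
  - apply is_deriv_on_lin_comb; auto.
    apply is_deriv_on_sub with whole; trivial; [now intros|]; now apply is_deriv_on_whole.
  - rewrite E by trivial; ring. }
unfold lin_comb in KE; rewrite F0 in KE.
fold (F x); replace (f x) with (1 * f x + - (1) * F x + F x)%C by ring; rewrite KE; ring.
Qed.

Lemma C3_extension_unit (f : R -> C) : smooth_on unit_itv f ->
  exists G, C3_extension unit_itv f G.
Proof.
intros H; assert (J := smooth_jet _ _ no_isolated_unit H).
set (G3 := fun t => deriv_on unit_itv 3 f (clamp t)).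
assert (C3 : forall x, continuous (U := CR) G3 x) by (apply continuous_clamp, H).
destruct (extension_step (deriv_on unit_itv 2 f) (deriv_on unit_itv 3 f) G3) as (G2 & D2 & E2);
  [intros x Hx; now apply (J 2%nat) | trivial | intros x Hx; unfold G3; now rewrite clamp_id |].
destruct (extension_step (deriv_on unit_itv 1 f) (deriv_on unit_itv 2 f) G2) as (G1 & D1 & E1);
  [intros x Hx; now apply (J 1%nat) | intros x; exact (is_derive_continuous_C _ _ _ (D2 x)) | trivial |].
destruct (extension_step (deriv_on unit_itv 0 f) (deriv_on unit_itv 1 f) G1) as (G0 & D0 & E0);
  [intros x Hx; now apply (J 0%nat) | intros x; exact (is_derive_continuous_C _ _ _ (D1 x)) | trivial |].
exists (fun k => match k with 0 => G0 | 1 => G1 | 2 => G2 | _ => G3 end)%nat; split; [|split]; trivial.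
- intros [|[|[|k]]] x Hk; trivial; lia.
- intros [|[|[|[|k]]]] x Hk Dx; auto; [unfold G3; now rewrite clamp_id | lia].
Qed.

(** * The functionals on the finite interval *)

Lemma subspace_Cinf01 : subspace (carrier Cinf01).
Proof.
split; [apply smooth_zero, no_isolated_unit|].
intros c d f g; apply smooth_lin_comb, no_isolated_unit.
Qed.

Lemma unit_itv_0 : unit_itv 0.
Proof. split; simpl; lra. Qed.

Lemma unit_itv_1 : unit_itv 1.
Proof. split; simpl; lra. Qed.

Lemma linear_operator_fi : linear_operator (clitv 0 1) fi_Phi Cinf01 (opS unit_itv).
Proof.
assert (N := no_isolated_unit).
split; [apply subspace_Cinf01|]; split; [|split; [|split]].
- split.
  + repeat split; [now apply smooth_zero|]; apply deriv_on_zero; trivial; apply unit_itv_1.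
  + intros c d f g (Sf & f0 & f1 & f1') (Sg & g0 & g1 & g1'); split; [now apply smooth_lin_comb|].
    rewrite deriv_on_lin_comb by (trivial; apply unit_itv_1); unfold lin_comb.
    rewrite f0, f1, f1', g0, g1, g1'; repeat split; ring.
- now intros f [Hf _].
- intros f [Hf _]; now apply smooth_opS.
- intros c d f g [Hf _] [Hg _] x Dx; now apply opS_linear.
Qed.

Lemma bounded_point_fi (k : nat) (x : R) : unit_itv x ->
  bounded_functional Cinf01 (fun f => deriv_on unit_itv k f x).
Proof.
intros Dx; split.
- intros c d f g Hf Hg; apply deriv_on_lin_comb; trivial; apply no_isolated_unit.
- exists [k], 1; intros h d Hd Hh Hs.
  assert (K := sup_on_lt _ _ d x (Hs k ltac:(now left)) Dx); simpl in K; lra.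
Qed.

Definition is_kernel_integral (b : Rbar) (lam c0 c1 c2 : C) (f : R -> C) (l : C) : Prop :=
  is_int b (fun x => kcomb lam c0 c1 c2 x * f x)%C l.

Lemma kcomb_bound (lam c0 c1 c2 : C) (rho x : R) : 0 <= x ->
  (c0 = RtoC 0 \/ Im lam <= rho) -> (c1 = RtoC 0 \/ Im (alpha * lam) <= rho) ->
  (c2 = RtoC 0 \/ Im (alpha * alpha * lam) <= rho) ->
  Cmod (kcomb lam c0 c1 c2 x) <= (Cmod c0 + Cmod c1 + Cmod c2) * exp (rho * x).
Proof.
intros Hx H0 H1 H2.
assert (K : forall c mu, c = RtoC 0 \/ Im mu <= rho -> Cmod (c * ker mu x) <= Cmod c * exp (rho * x)).
{ intros c mu [-> | H]; rewrite Cmod_mult; [rewrite Cmod_0; lra|].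
  apply Rmult_le_compat_l; [apply Cmod_ge_0|]; rewrite Cmod_ker; apply exp_le_compat; nra. }
unfold kcomb; eapply Rle_trans; [apply Cmod_triangle|].
eapply Rle_trans; [apply Rplus_le_compat_r, Cmod_triangle|].
assert (A := K c0 lam H0); assert (B := K c1 (alpha * lam)%C H1).
assert (D := K c2 (alpha * alpha * lam)%C H2); lra.
Qed.

Lemma ex_kernel_integral_fi (lam c0 c1 c2 : C) (f : R -> C) : smooth_on unit_itv f ->
  exists l, is_kernel_integral 1 lam c0 c1 c2 f l.
Proof.
intros Hf.
set (h := fun x => (kcomb lam c0 c1 c2 x * f (clamp x))%C).
assert (Ch : forall x, continuous (U := CR) h x).
{ intros x; apply continuous_Cmult; [apply continuous_kcomb|]; apply continuous_clamp, (Hf 0%nat). }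
exists (RInt (V := C_R_CompleteNormedModule) h 0 1).
apply is_int_ext with h; [simpl; lra| |].
- intros x Hx; unfold h; rewrite clamp_id; trivial.
- apply (is_int_of_RInt 1 h (fun x => RInt (V := C_R_CompleteNormedModule) h 0 x)).
  + intros x; now apply ex_RInt_C.
  + intros P HP; exact (locally_singleton (T := CR) _ _ HP).
Qed.

Lemma bounded_kernel_fi (lam c0 c1 c2 : C) :
  bounded_functional Cinf01 (fun f => int01 (fun x => kcomb lam c0 c1 c2 x * f x)%C).
Proof.
split.
- intros c d f g Hf Hg.
  destruct (ex_kernel_integral_fi lam c0 c1 c2 f Hf) as [l Hl].
  destruct (ex_kernel_integral_fi lam c0 c1 c2 g Hg) as [m Hm].
  rewrite (int01_eq _ _ Hl), (int01_eq _ _ Hm); apply int01_eq.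
  assert (L := is_int_lin_comb 1 c d _ _ _ _ Hl Hm).
  replace (fun x => kcomb lam c0 c1 c2 x * lin_comb c f d g x)%C with
    (fun x => c * (kcomb lam c0 c1 c2 x * f x) + d * (kcomb lam c0 c1 c2 x * g x))%C; trivial.
  apply functional_extensionality; intros x; unfold lin_comb; ring.
- set (S := Cmod c0 + Cmod c1 + Cmod c2).
  assert (I : forall z, Im z <= Cmod z).
  { intros z; assert (A := Cmod_sqr z); assert (B := Cmod_ge_0 z); nra. }
  exists [0%nat], (S * exp (Cmod lam)); intros h d Hd Hh Hs.
  destruct (ex_kernel_integral_fi lam c0 c1 c2 h Hh) as [l Hl]; rewrite (int01_eq _ _ Hl).
  assert (S0 : 0 <= S) by (assert (A := Cmod_ge_0 c0); assert (B := Cmod_ge_0 c1);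
    assert (D := Cmod_ge_0 c2); unfold S; lra).
  assert (P : 0 < exp (Cmod lam)) by apply exp_pos.
  apply (is_int_le 1 (fun x => kcomb lam c0 c1 c2 x * h x)%C
    (fun _ => S * exp (Cmod lam) * d) (fun r => r * (S * exp (Cmod lam) * d)) l
    (S * exp (Cmod lam) * d)); trivial; [simpl; lra| |].
  + intros x Hx; rewrite Cmod_mult.
    assert (Hh' := sup_on_lt _ _ d x (Hs 0%nat ltac:(now left)) Hx); simpl in Hh'.
    destruct Hx as [Hx1 Hx2]; simpl in Hx1, Hx2.
    apply Rmult_le_compat; try apply Cmod_ge_0; [|lra].
    eapply Rle_trans; [apply kcomb_bound with (rho := Cmod lam); trivial; right|].
    * apply I.
    * eapply Rle_trans; [apply I|]; rewrite Cmod_mult, Cmod_alpha; lra.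
    * eapply Rle_trans; [apply I|]; rewrite !Cmod_mult, Cmod_alpha; lra.
    * apply Rmult_le_compat_l; trivial; apply exp_le_compat.
      assert (A := Cmod_ge_0 lam); nra.
  + intros r [Hr1 Hr2]; simpl in Hr1, Hr2; split.
    * assert (A := is_RInt_const (V := R_NormedModule) 0 r (S * exp (Cmod lam) * d)).
      replace (r * (S * exp (Cmod lam) * d)) with (scal (r - 0) (S * exp (Cmod lam) * d))
        by (unfold scal; simpl; unfold mult; simpl; ring); trivial.
    * assert (0 <= S * exp (Cmod lam) * d) by (apply Rmult_le_pos; [nra|lra]); nra.
Qed.

(** * Green's formula for combinations of kernels *)

Lemma is_int_zero (b : Rbar) : is_int b (fun _ => 0) 0.
Proof.
apply is_int_of_RInt with (fun _ => RtoC 0).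
- intros x; assert (H := is_RInt_const (V := CR) 0 x (zero : CR)).
  assert (E : scal (x - 0) (zero : CR) = zero) by apply (scal_zero_r (V := CR)).
  rewrite E in H; exact H.
- assert (Fb : Filter (end_filter b)) by apply end_filter_proper; apply filterlim_const.
Qed.

(** The case [c = 0] is separated because the integral against [ker mu] may then diverge:
    on the half-line exp(- i lam x) grows when lam is on the contour of F^+, whose kernel
    does not contain it. *)
Lemma green_term (b : Rbar) (mu c : C) (D : R -> Prop) (f : R -> C) (G : nat -> R -> C) (B : C) :
  Rbar_lt 0 b -> (forall x, clitv 0 b x -> D x) -> C3_extension D f G ->
  c = RtoC 0 \/
  (filterlim (boundary_form mu G) (end_filter b) (locally (T := CR) B) /\
   exists t, is_int b (fun x => ker mu x * f x)%C t) ->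
  exists t,
    is_int b (fun x => c * (ker mu x * f x))%C t /\
    is_int b (fun x => c * (ker mu x * opS D f x))%C
      (mu * mu * mu * t + Ci * (c * (B - boundary_form mu G 0)))%C.
Proof.
intros Hb HD (HG & HC & HE) [-> | [HB [t Ht]]].
- exists (RtoC 0).
  replace (mu * mu * mu * 0 + Ci * (0 * (B - boundary_form mu G 0)))%C with (RtoC 0) by ring.
  split; apply is_int_ext with (3 := is_int_zero b); trivial; intros x _; ring.
- exists (c * t)%C; split.
  + replace (c * t)%C with (c * t + 0 * t)%C by ring.
    apply is_int_ext with (3 := is_int_lin_comb b c 0 _ _ _ _ Ht Ht); trivial; intros x _; ring.
  + assert (T : is_int b (fun x => ker mu x * G 3%nat x)%C
      (B - boundary_form mu G 0 - Ci * (mu * mu * mu) * t)%C).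
    { apply green; trivial.
      apply is_int_ext with (3 := Ht); trivial; intros x Hx; apply (f_equal (Cmult _)).
      apply (HE 0%nat); [lia | now apply HD]. }
    assert (I2 := Ci_sqr).
    replace (mu * mu * mu * (c * t) + Ci * (c * (B - boundary_form mu G 0)))%C with
      (Ci * c * (B - boundary_form mu G 0 - Ci * (mu * mu * mu) * t)
       + 0 * (B - boundary_form mu G 0 - Ci * (mu * mu * mu) * t))%C by ring [I2].
    apply is_int_ext with (3 := is_int_lin_comb b (Ci * c) 0 _ _ _ _ T T); trivial.
    intros x Hx; unfold opS; rewrite (HE 3%nat) by (try lia; now apply HD); ring.
Qed.

Lemma green_kcomb (b : Rbar) (lam c0 c1 c2 : C) (D : R -> Prop) (f : R -> C) (G : nat -> R -> C)
    (B0 B1 B2 : C) : Rbar_lt 0 b -> (forall x, clitv 0 b x -> D x) -> C3_extension D f G ->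
  c0 = RtoC 0 \/
  (filterlim (boundary_form lam G) (end_filter b) (locally (T := CR) B0) /\
   exists t, is_int b (fun x => ker lam x * f x)%C t) ->
  c1 = RtoC 0 \/
  (filterlim (boundary_form (alpha * lam) G) (end_filter b) (locally (T := CR) B1) /\
   exists t, is_int b (fun x => ker (alpha * lam) x * f x)%C t) ->
  c2 = RtoC 0 \/
  (filterlim (boundary_form (alpha * alpha * lam) G) (end_filter b) (locally (T := CR) B2) /\
   exists t, is_int b (fun x => ker (alpha * alpha * lam) x * f x)%C t) ->
  exists t,
    is_kernel_integral b lam c0 c1 c2 f t /\
    is_kernel_integral b lam c0 c1 c2 (opS D f)
      (lam * lam * lam * t
       + Ci * (c0 * (B0 - boundary_form lam G 0) + c1 * (B1 - boundary_form (alpha * lam) G 0)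
               + c2 * (B2 - boundary_form (alpha * alpha * lam) G 0)))%C.
Proof.
intros Hb HD HG H0 H1 H2.
assert (A3 := alpha_cube).
destruct (green_term b _ _ D f G B0 Hb HD HG H0) as (t0 & S0 & T0).
destruct (green_term b _ _ D f G B1 Hb HD HG H1) as (t1 & S1 & T1).
destruct (green_term b _ _ D f G B2 Hb HD HG H2) as (t2 & S2 & T2).
assert (Sum : forall h u0 u1 u2,
  is_int b (fun x => c0 * (ker lam x * h x))%C u0 ->
  is_int b (fun x => c1 * (ker (alpha * lam) x * h x))%C u1 ->
  is_int b (fun x => c2 * (ker (alpha * alpha * lam) x * h x))%C u2 ->
  is_kernel_integral b lam c0 c1 c2 h (1 * (1 * u0 + 1 * u1) + 1 * u2)%C).
{ intros h u0 u1 u2 U0 U1 U2.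
  apply is_int_ext with (3 := is_int_lin_comb b 1 1 _ _ _ _ (is_int_lin_comb b 1 1 _ _ _ _ U0 U1) U2);
    trivial; intros x _; unfold kcomb; ring. }
exists (1 * (1 * t0 + 1 * t1) + 1 * t2)%C; split; [now apply Sum|].
assert (L := Sum _ _ _ _ T0 T1 T2).
match type of L with is_kernel_integral _ _ _ _ _ _ ?v =>
  match goal with |- is_kernel_integral _ _ _ _ _ _ ?w => replace w with v; trivial end end.
replace (alpha * lam * (alpha * lam) * (alpha * lam))%C with (lam * lam * lam)%C by ring [A3].
replace (alpha * alpha * lam * (alpha * alpha * lam) * (alpha * alpha * lam))%C
  with (lam * lam * lam)%C by ring [A3].
ring.
Qed.

(** * Exponential decay passes to derivatives *)

Definition decays (b : R) (u : R -> R) : Prop :=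
  exists K, forall x, 0 <= x -> Rabs (u x) <= K * exp (- b * x).

Lemma decays_weaken (a b : R) (u : R -> R) : b <= a -> decays a u -> decays b u.
Proof.
intros Hab [K HK]; exists (Rabs K); intros x Hx; eapply Rle_trans; [now apply HK|].
assert (E : exp (- a * x) <= exp (- b * x)) by (apply exp_le_compat; nra).
assert (P := exp_pos (- a * x)); assert (A := Rle_abs K); assert (B := Rabs_pos K); nra.
Qed.

Lemma MVT_derive (u u' : R -> R) (x y : R) : (forall t, is_derive u t (u' t)) -> x <= y ->
  exists t, x <= t <= y /\ u y - u x = u' t * (y - x).
Proof.
intros H Hxy; destruct (MVT_gen u x y u') as (t & Ht & E).
- intros t _; apply H.
- intros t _; apply continuity_pt_filterlim, (ex_derive_continuous (V := R_NormedModule)).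
  now exists (u' t).
- rewrite Rmin_left, Rmax_right in Ht by trivial; now exists t.
Qed.

(** Landau's interpolation between a function and its second derivative: the
    difference quotient over a step of length exp ((b - a) x / 2) balances the
    two errors. *)
Lemma decays_interpolate (u u1 u2 : R -> R) (a b : R) : 0 <= a -> 0 <= b ->
  (forall x, is_derive u x (u1 x)) -> (forall x, is_derive u1 x (u2 x)) ->
  decays a u -> decays b u2 -> decays ((a + b) / 2) u1.
Proof.
intros Ha Hb D1 D2 [K HK] [M HM].
exists (2 * Rabs K + Rabs M); intros x Hx.
set (d := exp ((b - a) * x / 2)).
assert (Hd : 0 < d) by apply exp_pos.
destruct (MVT_derive u u1 x (x + d) D1) as (t & Ht & Et); [lra|].
destruct (MVT_derive u1 u2 x t D2) as (s & Hs & Es); [lra|].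
assert (X : forall c y, 0 <= c -> x <= y -> exp (- c * y) <= exp (- c * x))
  by (intros; apply exp_le_compat; nra).
assert (K0 := HK x Hx); assert (K1 := HK (x + d) ltac:(lra)).
assert (M0 := HM s ltac:(lra)).
assert (XA := X a (x + d) Ha ltac:(lra)); assert (XB := X b s Hb ltac:(lra)).
assert (PA := exp_pos (- a * (x + d))); assert (PB := exp_pos (- b * s)).
assert (QA := exp_pos (- a * x)); assert (QB := exp_pos (- b * x)).
assert (AK := Rle_abs K); assert (AM := Rle_abs M).
assert (BK := Rabs_pos K); assert (BM := Rabs_pos M).
assert (F1 : Rabs (u1 t) * d <= 2 * Rabs K * exp (- a * x)).
{ replace (Rabs (u1 t) * d) with (Rabs (u (x + d) - u x)).
  2:{ rewrite Et, Rabs_mult; rewrite (Rabs_pos_eq (_ - _)); [f_equal; ring | lra]. }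
  assert (Tr := Rabs_triang (u (x + d)) (- u x)); rewrite Rabs_Ropp in Tr.
  unfold Rminus; nra. }
assert (F2 : Rabs (u1 t - u1 x) <= Rabs M * exp (- b * x) * d).
{ rewrite Es, Rabs_mult, (Rabs_pos_eq (t - x)) by lra.
  apply Rmult_le_compat; try lra; [apply Rabs_pos|]; nra. }
assert (E1 : exp (- a * x) = exp (- ((a + b) / 2) * x) * d)
  by (unfold d; rewrite <- exp_plus; f_equal; field).
assert (E2 : exp (- b * x) * d = exp (- ((a + b) / 2) * x))
  by (unfold d; rewrite <- exp_plus; f_equal; field).
assert (F3 : Rabs (u1 t) <= 2 * Rabs K * exp (- ((a + b) / 2) * x)).
{ apply Rmult_le_reg_r with d; trivial; rewrite E1 in F1; lra. }
rewrite Rmult_assoc, E2 in F2.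
assert (Tr := Rabs_triang (u1 t) (- (u1 t - u1 x))); rewrite Rabs_Ropp in Tr.
replace (u1 t + - (u1 t - u1 x)) with (u1 x) in Tr by ring; lra.
Qed.

(** A concave sequence that decreases once decreases at least linearly from there on. *)
Lemma concave_bounded_nondecreasing (s : nat -> R) (M : R) :
  (forall k, 0 <= s k <= M) -> (forall k, s k + s (S (S k)) <= 2 * s (S k)) ->
  forall k, s O <= s k.
Proof.
intros Hb Hc.
assert (Hi : forall k, s k <= s (S k)).
{ intros k; apply Rnot_lt_le; intros Hlt.
  set (d := s k - s (S k)).
  assert (Hn : forall n, s (k + n)%nat <= s k - INR n * d /\ s (S (k + n)) <= s (k + n)%nat - d).
  { induction n as [|n [I1 I2]].
    - rewrite Nat.add_0_r; simpl INR; unfold d; lra.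
    - rewrite Nat.add_succ_r, S_INR; specialize (Hc (k + n)%nat); lra. }
  assert (Hd : 0 < d) by (unfold d; lra).
  destruct (INR_unbounded (M / d)) as [n HN].
  destruct (Hn n) as [I _]; assert (A := Hb (k + n)%nat); assert (B := Hb k).
  apply (Rmult_lt_compat_r d) in HN; trivial.
  replace (M / d * d) with M in HN by (field; lra); lra. }
induction k as [|k IH]; [lra|]; eapply Rle_trans; [apply IH | apply Hi].
Qed.

(** The best exponents of decay of the successive derivatives, cut off at [eps], form by
    interpolation a concave sequence; being bounded, it is nondecreasing, and it
    starts with [eps]. *)
Lemma decays_derivatives (u : nat -> R -> R) (eps : R) : 0 <= eps ->
  (forall k x, is_derive (u k) x (u (S k) x)) ->
  (forall k, decays 0 (u k)) -> decays eps (u O) ->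
  forall k c, c < eps -> decays c (u k).
Proof.
intros He HD H0 Hu k c Hc.
set (S := fun k b => 0 <= b <= eps /\ decays b (u k)).
assert (HS : forall k, {m | is_lub (S k) m}).
{ intros j; apply completeness.
  - exists eps; intros b [Hb _]; lra.
  - exists 0; split; [lra | apply H0]. }
set (s := fun k => proj1_sig (HS k)).
assert (Hs : forall k, is_lub (S k) (s k)) by (intros j; exact (proj2_sig (HS j))).
assert (Happ : forall k e, 0 < e -> exists b, S k b /\ s k - e < b).
{ intros j e Hpos; apply NNPP; intros Hn.
  assert (s j <= s j - e); [|lra].
  apply (proj2 (Hs j)); intros b Hb; apply Rnot_lt_le; intros Hlt; apply Hn; now exists b. }
assert (Hk : s O <= s k).
{ apply concave_bounded_nondecreasing with eps.
  - intros j; split.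
    + apply (proj1 (Hs j)); split; [lra | apply H0].
    + apply (proj2 (Hs j)); intros b [Hb _]; lra.
  - intros j; apply Rnot_lt_le; intros Hlt.
    set (g := s j + s (Datatypes.S (Datatypes.S j)) - 2 * s (Datatypes.S j)).
    destruct (Happ j (g / 2)) as (a & [Ha Da] & La); [unfold g; lra|].
    destruct (Happ (Datatypes.S (Datatypes.S j)) (g / 2)) as (b & [Hb Db] & Lb); [unfold g; lra|].
    assert (M : (a + b) / 2 <= s (Datatypes.S j)).
    { apply (proj1 (Hs (Datatypes.S j))); split; [lra|].
      apply decays_interpolate with (u j) (u (Datatypes.S (Datatypes.S j))); auto; lra. }
    unfold g in La, Lb; lra. }
assert (s O >= eps) by (apply Rle_ge, (proj1 (Hs O)); split; [lra | trivial]).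
destruct (Happ k (eps - c)) as (b & [_ Hb] & Lb); [lra|].
apply decays_weaken with b; trivial; lra.
Qed.

(** * Schwartz functions on the half-line *)

Lemma schwartz_derive (g : R -> C) : schwartz g ->
  forall k x, is_derive (V := CR) (deriv_on whole k g) x (deriv_on whole (S k) g x).
Proof.
intros [H _] k x; apply is_deriv_on_whole.
now apply (smooth_jet whole g no_isolated_whole H).
Qed.

Lemma jet_schwartz_half (f g : R -> C) : schwartz g -> (forall x, half_line x -> f x = g x) ->
  jet half_line (fun k => deriv_on whole k g).
Proof.
intros [H _] E k x Dx; apply is_deriv_on_sub with whole; trivial; [now intros|].
now apply (smooth_jet whole g no_isolated_whole H).
Qed.

Lemma schwartz_half_deriv (f g : R -> C) : schwartz g -> (forall x, half_line x -> f x = g x) ->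
  forall k x, half_line x -> deriv_on half_line k f x = deriv_on whole k g x.
Proof.
intros Hg E; apply (jet_deriv_on half_line (fun k => deriv_on whole k g)); trivial.
- apply no_isolated_half_line.
- now apply jet_schwartz_half with f.
Qed.

Lemma schwartz_half_smooth (f : R -> C) : schwartz_half f -> smooth_on half_line f.
Proof.
intros (g & Hg & E); apply (jet_smooth half_line (fun k => deriv_on whole k g)); trivial.
- apply no_isolated_half_line.
- now apply jet_schwartz_half with f.
Qed.

Lemma schwartz_zero : schwartz (fun _ => 0).
Proof.
assert (N := no_isolated_whole); split; [now apply smooth_zero|].
intros m k; exists 0; intros x; rewrite deriv_on_zero by (trivial; exact I).
rewrite Cmod_0; lra.
Qed.

Lemma schwartz_lin_comb (c d : C) (f g : R -> C) :
  schwartz f -> schwartz g -> schwartz (lin_comb c f d g).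
Proof.
assert (N := no_isolated_whole); intros [Sf Hf] [Sg Hg]; split; [now apply smooth_lin_comb|].
intros m k; destruct (Hf m k) as [K HK]; destruct (Hg m k) as [M HM].
exists (Cmod c * K + Cmod d * M); intros x; rewrite deriv_on_lin_comb by (trivial; exact I).
assert (C0 := Cmod_ge_0 c); assert (D0 := Cmod_ge_0 d).
specialize (HK x); specialize (HM x).
assert (X0 : 0 <= Rabs x ^ m) by (apply pow_le, Rabs_pos).
apply Rle_trans with (Rabs x ^ m * (Cmod c * Cmod (deriv_on whole k f x)
  + Cmod d * Cmod (deriv_on whole k g x))).
- apply Rmult_le_compat_l; trivial; rewrite <- !Cmod_mult; apply Cmod_triangle.
- nra.
Qed.

Lemma deriv_on_add (D : R -> Prop) (n m : nat) (f : R -> C) :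
  deriv_on D n (deriv_on D m f) = deriv_on D (n + m) f.
Proof. induction n as [|n IH]; trivial; simpl; now rewrite IH. Qed.

Lemma schwartz_deriv_on (k : nat) (f : R -> C) : schwartz f -> schwartz (deriv_on whole k f).
Proof.
intros [Sf Hf]; split.
- intros n x Dx; rewrite deriv_on_add; now apply Sf.
- intros m n; rewrite deriv_on_add; apply Hf.
Qed.

Lemma schwartz_half_zero : schwartz_half (fun _ => 0).
Proof. exists (fun _ => 0); split; trivial; apply schwartz_zero. Qed.

Lemma schwartz_half_lin_comb (c d : C) (f g : R -> C) :
  schwartz_half f -> schwartz_half g -> schwartz_half (lin_comb c f d g).
Proof.
intros (f0 & Hf & Ef) (g0 & Hg & Eg); exists (lin_comb c f0 d g0); split.
- now apply schwartz_lin_comb.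
- intros x Dx; unfold lin_comb; now rewrite Ef, Eg.
Qed.

Lemma schwartz_half_opS (f : R -> C) : schwartz_half f -> schwartz_half (opS half_line f).
Proof.
intros (g & Hg & E); exists (lin_comb Ci (deriv_on whole 3 g) 0 (fun _ => 0)); split.
- apply schwartz_lin_comb; [now apply schwartz_deriv_on | apply schwartz_zero].
- intros x Dx; rewrite opS_lin_comb; unfold lin_comb.
  now rewrite (schwartz_half_deriv f g) by trivial.
Qed.

Lemma bigO_exp_zero (c : R) : bigO_exp c (fun _ => 0).
Proof. exists 0, 0; intros x _ _; rewrite Cmod_0; lra. Qed.

Lemma bigO_exp_lin_comb (r : R) (c d : C) (f g : R -> C) :
  bigO_exp r f -> bigO_exp r g -> bigO_exp r (lin_comb c f d g).
Proof.
intros (K & X & HK) (M & Y & HM); exists (Cmod c * K + Cmod d * M), (Rmax X Y).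
intros x Hx Dx; assert (A := Rmax_l X Y); assert (B := Rmax_r X Y).
specialize (HK x ltac:(lra) Dx); specialize (HM x ltac:(lra) Dx).
assert (C0 := Cmod_ge_0 c); assert (D0 := Cmod_ge_0 d).
unfold lin_comb; eapply Rle_trans; [apply Cmod_triangle|]; rewrite !Cmod_mult; nra.
Qed.

Definition Cdecays (b : R) (f : R -> C) : Prop :=
  exists K, 0 <= K /\ forall x, 0 <= x -> Cmod (f x) <= K * exp (- b * x).

Lemma half_line_ge (x : R) : half_line x <-> 0 <= x.
Proof. split; [now intros [H _] | intros H; split; simpl; trivial]. Qed.

Lemma schwartz_half_bounded (f : R -> C) (k : nat) : schwartz_half f ->
  exists K, 0 <= K /\ forall x, 0 <= x -> Cmod (deriv_on half_line k f x) <= K.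
Proof.
intros (g & Hg & E); destruct (proj2 Hg 0%nat k) as [K HK]; exists K; split.
- specialize (HK 0); assert (A := Cmod_ge_0 (deriv_on whole k g 0)); simpl in HK; lra.
- intros x Hx; rewrite (schwartz_half_deriv f g) by (trivial; now apply half_line_ge).
  specialize (HK x); simpl in HK; lra.
Qed.

Lemma Cdecays_of_bigO (c : R) (f : R -> C) : schwartz_half f -> bigO_exp c f -> Cdecays c f.
Proof.
intros Hf (K & X & HK); destruct (schwartz_half_bounded f 0 Hf) as (B & HB0 & HB).
simpl in HB.
set (X' := Rmax 0 X); set (M := Rmax (Rabs K) (B * exp (Rabs c * X'))).
assert (X0 : 0 <= X') by apply Rmax_l; assert (X1 : X <= X') by apply Rmax_r.
assert (M0 : Rabs K <= M) by apply Rmax_l; assert (M1 : B * exp (Rabs c * X') <= M) by apply Rmax_r.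
assert (K0 := Rabs_pos K); assert (K1 := Rle_abs K).
exists M; split; [lra|]; intros x Hx; assert (P := exp_pos (- c * x)).
destruct (Rle_or_lt X' x) as [H|H].
- eapply Rle_trans; [apply HK; [lra | now apply half_line_ge]|]; nra.
- eapply Rle_trans; [now apply HB|].
  assert (L : 1 <= exp (Rabs c * X') * exp (- c * x)).
  { rewrite <- exp_plus, <- exp_0; apply exp_le_compat.
    assert (A := Rle_abs c); assert (A0 := Rabs_pos c); nra. }
  apply Rle_trans with (B * exp (Rabs c * X') * exp (- c * x)); [rewrite Rmult_assoc; nra|nra].
Qed.

Lemma Cdecays_derivatives (eps : R) (f : R -> C) : 0 <= eps -> schwartz_half f -> bigO_exp eps f ->
  forall k c, c < eps -> Cdecays c (deriv_on half_line k f).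
Proof.
intros He Hf HO k c Hc.
destruct (Cdecays_of_bigO eps f Hf HO) as (K0 & HK0 & HK).
assert (Hf' := Hf); destruct Hf' as (g & Hg & E).
assert (Dg := schwartz_derive g Hg).
assert (E' := schwartz_half_deriv f g Hg E).
assert (Bg : forall j x, 0 <= x -> deriv_on half_line j f x = deriv_on whole j g x)
  by (intros j x Hx; apply E'; now apply half_line_ge).
assert (Hre : decays c (fun x => fst (deriv_on whole k g x))).
{ apply (decays_derivatives (fun j x => fst (deriv_on whole j g x)) eps); trivial.
  - intros j x; apply (is_derive_C_fst (deriv_on whole j g)), Dg.
  - intros j; destruct (schwartz_half_bounded f j Hf) as (B & HB0 & HB); exists B; intros x Hx.
    replace (- 0 * x) with 0 by ring; rewrite exp_0, Rmult_1_r.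
    eapply Rle_trans; [apply re_le_Cmod|]; rewrite <- Bg; auto.
  - exists K0; intros x Hx; eapply Rle_trans; [apply re_le_Cmod|]; rewrite <- Bg; auto. }
assert (Him : decays c (fun x => snd (deriv_on whole k g x))).
{ assert (im_le_Cmod : forall z : C, Rabs (snd z) <= Cmod z).
  { intros z; eapply Rle_trans; [apply Rmax_r | apply Rmax_Cmod]. }
  apply (decays_derivatives (fun j x => snd (deriv_on whole j g x)) eps); trivial.
  - intros j x; apply (is_derive_C_snd (deriv_on whole j g)), Dg.
  - intros j; destruct (schwartz_half_bounded f j Hf) as (B & HB0 & HB); exists B; intros x Hx.
    replace (- 0 * x) with 0 by ring; rewrite exp_0, Rmult_1_r.
    eapply Rle_trans; [apply im_le_Cmod|]; rewrite <- Bg; auto.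
  - exists K0; intros x Hx; eapply Rle_trans; [apply im_le_Cmod|]; rewrite <- Bg; auto. }
destruct Hre as [K1 H1]; destruct Him as [K2 H2].
assert (T : forall z : C, Cmod z <= Rabs (fst z) + Rabs (snd z)).
{ intros z; replace z with (RtoC (fst z) + Ci * RtoC (snd z))%C at 1.
  - eapply Rle_trans; [apply Cmod_triangle|]; rewrite Cmod_mult, Cmod_Ci, !Cmod_R; lra.
  - destruct z; unfold Ci, Cplus, Cmult, RtoC; apply injective_projections; simpl; ring. }
exists (K1 + K2); split.
- specialize (H1 0 ltac:(lra)); specialize (H2 0 ltac:(lra)).
  rewrite Rmult_0_r, exp_0 in H1, H2.
  assert (A := Rabs_pos (fst (deriv_on whole k g 0))).
  assert (B := Rabs_pos (snd (deriv_on whole k g 0))); lra.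
- intros x Hx; rewrite Bg by trivial; eapply Rle_trans; [apply T|].
  specialize (H1 x Hx); specialize (H2 x Hx); lra.
Qed.

(** * The function space and the functionals on the half-line *)

Lemma Shalf_decay (eps : R) (f : R -> C) : carrier (Shalf eps) f -> forall c, c < eps -> Cdecays c f.
Proof. intros [Hf HO] c Hc; now apply Cdecays_of_bigO; [|apply HO]. Qed.

Lemma subspace_Shalf (eps : R) : subspace (carrier (Shalf eps)).
Proof.
split.
- split; [apply schwartz_half_zero | intros c _; apply bigO_exp_zero].
- intros c d f g [Hf Of] [Hg Og]; split; [now apply schwartz_half_lin_comb|].
  intros r Hr; apply bigO_exp_lin_comb; auto.
Qed.

Lemma bigO_of_Cdecays (c : R) (f : R -> C) : Cdecays c f -> bigO_exp c f.
Proof. intros (K & _ & H); exists K, 0; intros x Hx _; now apply H. Qed.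

Lemma linear_operator_hl (eps : R) : 0 < eps ->
  linear_operator (clitv 0 p_infty) (hl_Phi eps) (Shalf eps) (opS half_line).
Proof.
intros He; assert (N := no_isolated_half_line).
split; [apply subspace_Shalf|]; split; [|split; [|split]].
- split.
  + repeat split; [apply schwartz_half_zero | apply bigO_exp_zero].
  + intros c d f g [[Sf Of] f0] [[Sg Og] g0]; repeat split.
    * now apply schwartz_half_lin_comb.
    * now apply bigO_exp_lin_comb.
    * unfold lin_comb; rewrite f0, g0; ring.
- intros f [[Sf Of] _]; split; trivial; intros c Hc.
  apply bigO_of_Cdecays, (Cdecays_derivatives eps f ltac:(lra) Sf Of 0 c Hc).
- intros f [[Sf Of] _]; split; [now apply schwartz_half_opS|]; intros c Hc.
  destruct (Cdecays_derivatives eps f ltac:(lra) Sf Of 3 c Hc) as (K & K0 & HK).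
  exists K, 0; intros x Hx _; unfold opS; rewrite Cmod_mult, Cmod_Ci, Rmult_1_l; auto.
- intros c d f g [[Sf _] _] [[Sg _] _] x Dx; apply opS_linear; trivial; now apply schwartz_half_smooth.
Qed.

Lemma bounded_point_hl (eps : R) (k : nat) :
  bounded_functional (Shalf eps) (fun f => deriv_on half_line k f 0).
Proof.
assert (D0 : half_line 0) by (apply half_line_ge; lra).
split.
- intros c d f g [Hf _] [Hg _]; apply deriv_on_lin_comb; trivial; try now apply schwartz_half_smooth.
  apply no_isolated_half_line.
- exists [inl (0%nat, k)], 1; intros h d Hd Hh Hs.
  assert (K := sup_on_lt _ _ d 0 (Hs (inl (0%nat, k)) ltac:(now left)) D0); simpl in K; lra.
Qed.

Lemma ex_kernel_integral_hl (lam c0 c1 c2 : C) (rho c : R) (f : R -> C) : rho < c ->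
  (c0 = RtoC 0 \/ Im lam <= rho) -> (c1 = RtoC 0 \/ Im (alpha * lam) <= rho) ->
  (c2 = RtoC 0 \/ Im (alpha * alpha * lam) <= rho) ->
  schwartz_half f -> Cdecays c f -> exists l, is_kernel_integral p_infty lam c0 c1 c2 f l.
Proof.
intros Hr H0 H1 H2 (g & Hg & E) (K & K0 & HK).
set (S := Cmod c0 + Cmod c1 + Cmod c2).
assert (S0 : 0 <= S) by (assert (A := Cmod_ge_0 c0); assert (B := Cmod_ge_0 c1);
  assert (D := Cmod_ge_0 c2); unfold S; lra).
destruct (ex_int_exp_decay (fun x => kcomb lam c0 c1 c2 x * g x)%C (S * K) (c - rho)) as [l Hl];
  [nra | lra | | |].
- intros x; apply continuous_Cmult; [apply continuous_kcomb|].
  exact (is_derive_continuous_C _ _ _ (schwartz_derive g Hg 0 x)).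
- intros x Hx; rewrite <- E by now apply half_line_ge.
  rewrite Cmod_mult; replace (- (c - rho) * x) with (rho * x + - c * x) by ring; rewrite exp_plus.
  replace (S * K * (exp (rho * x) * exp (- c * x))) with ((S * exp (rho * x)) * (K * exp (- c * x))) by ring.
  apply Rmult_le_compat; try apply Cmod_ge_0; auto; now apply kcomb_bound.
- exists l; apply is_int_ext with (3 := Hl); [exact I|].
  intros x Hx; now rewrite E.
Qed.

Lemma bounded_kernel_hl (eps rho : R) (lam c0 c1 c2 : C) : rho < eps ->
  (c0 = RtoC 0 \/ Im lam <= rho) -> (c1 = RtoC 0 \/ Im (alpha * lam) <= rho) ->
  (c2 = RtoC 0 \/ Im (alpha * alpha * lam) <= rho) ->
  bounded_functional (Shalf eps) (fun f => int_half_line (fun x => kcomb lam c0 c1 c2 x * f x)%C).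
Proof.
intros Hr H0 H1 H2.
(* Any rate strictly between the growth of the kernel and [eps] serves. *)
set (c := (rho + eps) / 2).
assert (Hc : rho < c < eps) by (unfold c; lra).
assert (Ex : forall f, carrier (Shalf eps) f -> exists l, is_kernel_integral p_infty lam c0 c1 c2 f l).
{ intros f Hf; apply ex_kernel_integral_hl with rho c; trivial; [lra | apply Hf |].
  apply (Shalf_decay eps f Hf c); lra. }
split.
- intros a b f g Hf Hg; destruct (Ex f Hf) as [l Hl]; destruct (Ex g Hg) as [m Hm].
  rewrite (int_half_line_eq _ _ Hl), (int_half_line_eq _ _ Hm); apply int_half_line_eq.
  assert (L := is_int_lin_comb p_infty a b _ _ _ _ Hl Hm).
  replace (fun x => kcomb lam c0 c1 c2 x * lin_comb a f b g x)%C with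
    (fun x => a * (kcomb lam c0 c1 c2 x * f x) + b * (kcomb lam c0 c1 c2 x * g x))%C; trivial.
  apply functional_extensionality; intros x; unfold lin_comb; ring.
- set (S := Cmod c0 + Cmod c1 + Cmod c2).
  assert (S0 : 0 <= S) by (assert (A := Cmod_ge_0 c0); assert (B := Cmod_ge_0 c1);
    assert (D := Cmod_ge_0 c2); unfold S; lra).
  exists [inr (exist _ c (proj2 Hc))], (S / (c - rho)); intros h d Hd Hh Hs.
  destruct (Ex h Hh) as [l Hl]; rewrite (int_half_line_eq _ _ Hl).
  replace (S / (c - rho) * d) with (S * d / (c - rho)) by (field; lra).
  apply (is_int_le_exp_decay (fun x => kcomb lam c0 c1 c2 x * h x)%C); trivial; [nra | lra |].
  intros x Hx.
  assert (Hh' := sup_on_lt _ _ d x (Hs _ ltac:(now left)) (proj2 (half_line_ge x) Hx)); simpl in Hh'.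
  assert (Hx' : Cmod (h x) <= d * exp (- c * x)).
  { assert (P := exp_pos (- c * x)).
    assert (X : exp (c * x) * exp (- c * x) = 1) by (rewrite <- exp_plus, <- exp_0; f_equal; ring).
    replace (Cmod (h x)) with (exp (c * x) * Cmod (h x) * exp (- c * x)).
    - apply Rmult_le_compat_r; lra.
    - transitivity (Cmod (h x) * (exp (c * x) * exp (- c * x))); [ring | rewrite X; ring]. }
  rewrite Cmod_mult; replace (- (c - rho) * x) with (rho * x + - c * x) by ring; rewrite exp_plus.
  replace (S * d * (exp (rho * x) * exp (- c * x))) with ((S * exp (rho * x)) * (d * exp (- c * x))) by ring.
  apply Rmult_le_compat; try apply Cmod_ge_0; trivial; now apply kcomb_bound.
Qed.

Lemma C3_extension_half_line (f g : R -> C) : schwartz g -> (forall x, half_line x -> f x = g x) ->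
  C3_extension half_line f (fun k => deriv_on whole k g).
Proof.
intros Hg E; split; [|split].
- intros k x _; now apply schwartz_derive.
- intros x; exact (is_derive_continuous_C _ _ _ (schwartz_derive g Hg 3 x)).
- intros k x _ Dx; now apply schwartz_half_deriv.
Qed.

Lemma boundary_form_vanishes (mu : C) (rho c : R) (G : nat -> R -> C) : rho < c -> Im mu <= rho ->
  (forall k, (k <= 2)%nat -> Cdecays c (G k)) ->
  filterlim (boundary_form mu G) (Rbar_locally p_infty) (locally (T := CR) (RtoC 0)).
Proof.
intros Hr Hm HG.
destruct (HG 0%nat ltac:(auto)) as (K0 & _ & H0); destruct (HG 1%nat ltac:(auto)) as (K1 & _ & H1).
destruct (HG 2%nat ltac:(auto)) as (K2 & _ & H2).
assert (M0 := Cmod_ge_0 mu).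
apply (filterlim_exp_decay _ (K2 + Cmod mu * K1 + Cmod mu * Cmod mu * K0) (c - rho)); [lra|].
intros x Hx; unfold boundary_form; rewrite Cmod_mult, Cmod_ker.
replace (- (c - rho) * x) with (rho * x + - c * x) by ring; rewrite exp_plus.
replace ((K2 + Cmod mu * K1 + Cmod mu * Cmod mu * K0) * (exp (rho * x) * exp (- c * x)))
  with (exp (rho * x) * ((K2 + Cmod mu * K1 + Cmod mu * Cmod mu * K0) * exp (- c * x))) by ring.
apply Rmult_le_compat; [left; apply exp_pos | apply Cmod_ge_0 | apply exp_le_compat; nra |].
unfold Cminus; eapply Rle_trans; [apply Cmod_triangle|].
eapply Rle_trans; [apply Rplus_le_compat_r, Cmod_triangle|].
rewrite Cmod_opp, !Cmod_mult, Cmod_Ci.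
specialize (H0 x Hx); specialize (H1 x Hx); specialize (H2 x Hx).
assert (0 <= Cmod mu * Cmod mu) by nra; nra.
Qed.

(** * Augmented eigenfunctions on a union of two contours *)

Lemma union_family_l (gp : contour) (F G : C -> functional) (lam : C) :
  on_contour gp lam -> union_family gp F G lam = F lam.
Proof. intros H; unfold union_family; now destruct (excluded_middle_informative _). Qed.

Lemma union_family_r (gp : contour) (F G : C -> functional) (lam : C) :
  ~ on_contour gp lam -> union_family gp F G lam = G lam.
Proof. intros H; unfold union_family; now destruct (excluded_middle_informative _). Qed.

Lemma typeII_union (a b : Rbar) (X : fun_space) (Phi : (R -> C) -> Prop)
    (L : (R -> C) -> (R -> C)) (gp gm : contour) (Fp Fm Rp Rm : C -> functional) (z : C -> C) :
  (forall p, In p (gp ++ gm) -> exists r : R, start p = r \/ finish p = r) ->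
  (forall lam, on_contour gp lam -> ~ on_contour gm lam) ->
  linear_operator (clitv a b) Phi X L ->
  (forall lam, on_contour gp lam ->
     bounded_functional X (Fp lam) /\ bounded_functional X (Rp lam) /\
     forall phi, Phi phi -> Fp lam (L phi) = (z lam * Fp lam phi + Rp lam phi)%C) ->
  (forall lam, on_contour gm lam ->
     bounded_functional X (Fm lam) /\ bounded_functional X (Rm lam) /\
     forall phi, Phi phi -> Fm lam (L phi) = (z lam * Fm lam phi + Rm lam phi)%C) ->
  (forall phi x, Phi phi -> itv a b x ->
     is_contour_int gp (fun lam => Cexp (Ci * lam * x) / z lam * Rp lam phi)%C (RtoC 0) /\
     is_contour_int gm (fun lam => Cexp (Ci * lam * x) / z lam * Rm lam phi)%C (RtoC 0)) ->
  typeII_augmented_eigenfunctions a b X Phi L (gp ++ gm) (union_family gp Fp Fm) z.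
Proof.
intros Hends Hdisj HL Hp Hm Hint.
assert (HX : subspace (carrier X)) by apply HL.
assert (Hdisj' : forall lam, on_contour gm lam -> ~ on_contour gp lam)
  by (intros lam H1 H2; exact (Hdisj lam H2 H1)).
split; trivial; split.
- intros lam Hlam; apply bounded_dual; trivial; apply on_contour_app in Hlam; destruct Hlam as [H|H].
  + rewrite union_family_l by trivial; apply (Hp lam H).
  + rewrite union_family_r by auto; apply (Hm lam H).
- exists (union_family gp Rp Rm); split; [|split].
  + intros lam Hlam; apply bounded_dual; trivial; apply on_contour_app in Hlam; destruct Hlam as [H|H].
    * rewrite union_family_l by trivial; apply (Hp lam H).
    * rewrite union_family_r by auto; apply (Hm lam H).
  + intros phi lam Hphi Hlam; apply on_contour_app in Hlam; destruct Hlam as [H|H].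
    * rewrite !union_family_l by trivial; now apply (Hp lam H).
    * rewrite !union_family_r by auto; now apply (Hm lam H).
  + intros phi x Hphi Hx; destruct (Hint phi x Hphi Hx) as [I1 I2].
    replace (RtoC 0) with (RtoC 0 + RtoC 0)%C by ring.
    apply is_contour_int_app.
    * apply is_contour_int_ext with (3 := I1).
      -- intros p Hin; apply Hends, in_or_app; auto.
      -- intros lam Hlam; now rewrite union_family_l.
    * apply is_contour_int_ext with (3 := I2).
      -- intros p Hin; apply Hends, in_or_app; auto.
      -- intros lam Hlam; rewrite union_family_r; auto.
Qed.

Lemma sector_boundary_cases (th1 th2 : R) (z : C) : on_contour (sector_boundary th1 th2) z ->
  (exists t, 1 <= t /\ (z = ray th1 t \/ z = ray th2 t)) \/ Cmod z = 1.
Proof.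
intros (p & [<-|[<-|[<-|[]]]] & t & Ht & ->); simpl in Ht |- *.
- left; exists t; split; [unfold clitv in Ht; simpl in Ht; tauto | now right].
- right; change (circ 1 t) with (ray t 1); apply Cmod_ray; lra.
- left; exists t; split; [unfold clitv in Ht; simpl in Ht; tauto | now left].
Qed.

Lemma sector_boundary_neq_0 (th1 th2 : R) (z : C) :
  on_contour (sector_boundary th1 th2) z -> z <> RtoC 0.
Proof.
intros H; destruct (sector_boundary_cases th1 th2 z H) as [(t & Ht & [-> | ->])|E].
- apply ray_neq_0; lra.
- apply ray_neq_0; lra.
- intros ->; rewrite Cmod_0 in E; lra.
Qed.

Lemma sector_boundary_ends (th1 th2 : R) (p : path) : In p (sector_boundary th1 th2) ->
  exists r : R, start p = r \/ finish p = r.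
Proof. intros [<-|[<-|[<-|[]]]]; simpl; eauto. Qed.

Lemma decaying_exp_integrand (g : contour) (f : C -> C) (s : R) (a b : C) :
  (forall p, In p g -> exists r : R, start p = r \/ finish p = r) ->
  (forall z, on_contour g z -> z <> RtoC 0) ->
  (forall z, z <> RtoC 0 -> f z = (Cexp (Ci * s * z) / (z * z * z) * (a + b * z))%C) ->
  is_contour_int g (decaying_exp s a b) 0 -> is_contour_int g f 0.
Proof.
intros He Hz Hf; apply is_contour_int_ext; trivial; intros z Hg.
rewrite Hf by auto; unfold decaying_exp; field; auto.
Qed.

(** * The finite interval problem *)

Lemma Delta_neq_0_ray_multiple (k : nat) (t : R) : (k <= 5)%nat -> 1 <= t ->
  Defs.Delta (ray (INR k * PI / 3) t) <> RtoC 0.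
Proof.
intros Hk Ht; rewrite ray_pair.
assert (E0 : cos 0 = 1 /\ sin 0 = 0) by (split; [apply cos_0 | apply sin_0]).
assert (C1 := cos_PI3); assert (S1 := sin_PI3).
apply Delta_neq_0_ray with t; trivial.
destruct k as [|[|[|[|[|[|k]]]]]]; try lia; simpl INR.
- replace (0 * PI / 3) with 0 by field; rewrite (proj1 E0), (proj2 E0); left; lra.
- replace (1 * PI / 3) with (PI / 3) by field; rewrite C1, S1; right; right; lra.
- replace ((1 + 1) * PI / 3) with (PI - PI / 3) by field.
  rewrite cos_minus, sin_minus, cos_PI, sin_PI, C1, S1; right; right; lra.
- replace ((1 + 1 + 1) * PI / 3) with PI by field; rewrite cos_PI, sin_PI; right; left; lra.
- replace ((1 + 1 + 1 + 1) * PI / 3) with (PI / 3 + PI) by field.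
  rewrite neg_cos, neg_sin, C1, S1; right; right; lra.
- replace ((1 + 1 + 1 + 1 + 1) * PI / 3) with (PI - PI / 3 + PI) by field.
  rewrite neg_cos, neg_sin, cos_minus, sin_minus, cos_PI, sin_PI, C1, S1; right; right; lra.
Qed.

Lemma Delta_neq_0_sector (k : nat) (th1 th2 : R) (lam : C) : (k <= 4)%nat ->
  th1 = INR k * PI / 3 -> th2 = INR (S k) * PI / 3 ->
  on_contour (sector_boundary th1 th2) lam -> Defs.Delta lam <> RtoC 0.
Proof.
intros Hk -> -> H; destruct (sector_boundary_cases _ _ _ H) as [(t & Ht & [-> | ->])|E].
- apply Delta_neq_0_ray_multiple; trivial; lia.
- apply Delta_neq_0_ray_multiple; trivial; lia.
- now apply Delta_neq_0_circle.
Qed.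

Lemma Delta_neq_0_fi_Gamma_p (lam : C) : on_contour fi_Gamma_p lam ->
  Defs.Delta lam <> RtoC 0 /\ lam <> RtoC 0.
Proof.
unfold fi_Gamma_p; rewrite on_contour_app; intros [H|H]; split;
  try exact (sector_boundary_neq_0 _ _ _ H).
- apply (Delta_neq_0_sector 0 0 (PI / 3)); try lia; try (simpl; field); trivial.
- apply (Delta_neq_0_sector 2 (2 * PI / 3) PI); try lia; try (simpl; field); trivial.
Qed.

Lemma Delta_neq_0_fi_Gamma_m (lam : C) : on_contour fi_Gamma_m lam ->
  Defs.Delta lam <> RtoC 0 /\ lam <> RtoC 0.
Proof.
intros H; split; [|exact (sector_boundary_neq_0 _ _ _ H)].
apply (Delta_neq_0_sector 4 (4 * PI / 3) (5 * PI / 3)); try lia; try (simpl; field); trivial.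
Qed.

(** What the boundary conditions leave of Green's formula. *)
Definition fi_Rp (lam : C) : functional := fun f =>
  (- (Ci / (2 * PI)) * deriv_on unit_itv 2 f 0 + - (Ci / (2 * PI)) * (Ci * lam) * deriv_on unit_itv 1 f 0)%C.

Definition fi_Rm (lam : C) : functional := fun f =>
  (- (Ci / (2 * PI)) * Cexp (- Ci * lam) * deriv_on unit_itv 2 f 1 + 0 * deriv_on unit_itv 2 f 1)%C.

Lemma green_fi (lam c0 c1 c2 : C) (phi : R -> C) : fi_Phi phi ->
  int01 (fun x => kcomb lam c0 c1 c2 x * opS unit_itv phi x)%C =
  (lam * lam * lam * int01 (fun x => kcomb lam c0 c1 c2 x * phi x)
   + Ci * (kcomb lam c0 c1 c2 1 * deriv_on unit_itv 2 phi 1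
           - (c0 + c1 + c2) * deriv_on unit_itv 2 phi 0
           - Ci * lam * (c0 + alpha * c1 + alpha * alpha * c2) * deriv_on unit_itv 1 phi 0))%C.
Proof.
intros (Sf & f0 & f1 & f1').
destruct (C3_extension_unit phi Sf) as [G HG].
assert (HE := proj2 (proj2 HG)).
assert (Hc : forall mu, filterlim (boundary_form mu G) (end_filter 1)
  (locally (T := CR) (boundary_form mu G 1))).
{ intros mu P HP; exact (locally_singleton (T := CR) _ _ HP). }
assert (Ht : forall mu, exists t, is_int 1 (fun x => ker mu x * phi x)%C t).
{ intros mu; destruct (ex_kernel_integral_fi mu 1 0 0 phi Sf) as [t H]; exists t.
  apply is_int_ext with (3 := H); [simpl; lra|]; intros x _; unfold kcomb; ring. }
destruct (green_kcomb 1 lam c0 c1 c2 unit_itv phi G (boundary_form lam G 1)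
  (boundary_form (alpha * lam) G 1) (boundary_form (alpha * alpha * lam) G 1)) as (t & T1 & T2); auto.
{ simpl; lra. }
rewrite (int01_eq _ _ T1), (int01_eq _ _ T2).
assert (G00 : G 0%nat 0 = RtoC 0) by (rewrite <- f0; symmetry; apply (HE 0%nat); [lia | apply unit_itv_0]).
assert (G01 : G 0%nat 1 = RtoC 0) by (rewrite <- f1; symmetry; apply (HE 0%nat); [lia | apply unit_itv_1]).
assert (G11 : G 1%nat 1 = RtoC 0) by (rewrite <- f1'; symmetry; apply (HE 1%nat); [lia | apply unit_itv_1]).
rewrite !(HE 2%nat), !(HE 1%nat) by (try lia; apply unit_itv_0 || apply unit_itv_1).
unfold boundary_form, kcomb; rewrite !ker_0, G00, G01, G11; ring.
Qed.

Lemma kcomb_at_1 (lam c0 c1 c2 : C) : kcomb lam c0 c1 c2 1 =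
  (c0 * Cexp (- Ci * lam) + c1 * Cexp (- Ci * alpha * lam) + c2 * Cexp (- Ci * (alpha * alpha) * lam))%C.
Proof.
unfold kcomb, ker.
replace (- Ci * lam * 1)%C with (- Ci * lam)%C by ring.
replace (- Ci * (alpha * lam) * 1)%C with (- Ci * alpha * lam)%C by ring.
now replace (- Ci * (alpha * alpha * lam) * 1)%C with (- Ci * (alpha * alpha) * lam)%C by ring.
Qed.

Lemma kcomb_unfold (lam c0 c1 c2 : C) (x : R) : kcomb lam c0 c1 c2 x =
  (c0 * Cexp (- Ci * lam * x) + c1 * Cexp (- Ci * alpha * lam * x)
   + c2 * Cexp (- Ci * (alpha * alpha) * lam * x))%C.
Proof.
unfold kcomb, ker.
replace (- Ci * (alpha * lam) * x)%C with (- Ci * alpha * lam * x)%C by ring.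
now replace (- Ci * (alpha * alpha * lam) * x)%C with (- Ci * (alpha * alpha) * lam * x)%C by ring.
Qed.

Lemma PI_neq_0_C : RtoC PI <> RtoC 0.
Proof. intros E; apply (f_equal Re) in E; simpl in E; assert (H := PI_RGT_0); lra. Qed.

Lemma two_neq_0_C : RtoC 2 <> RtoC 0.
Proof. intros E; apply (f_equal Re) in E; simpl in E; lra. Qed.

(** The coefficients satisfy c0 + c1 + c2 = c0 + alpha c1 + alpha^2 c2 = 1/(2 pi), since
    the numerators add up to Delta, and the kernel vanishes at x = 1, so that f''(1)
    disappears. *)
Lemma fi_eigen_p (lam : C) : Defs.Delta lam <> RtoC 0 ->
  bounded_functional Cinf01 (fi_F_p lam) /\
  forall phi, fi_Phi phi ->
    fi_F_p lam (opS unit_itv phi) = (lam * lam * lam * fi_F_p lam phi + fi_Rp lam phi)%C.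
Proof.
intros HD.
set (P := (/ (2 * PI * Defs.Delta lam))%C).
set (e0 := Cexp (- Ci * lam)%C); set (e1 := Cexp (- Ci * alpha * lam)%C).
set (e2 := Cexp (- Ci * (alpha * alpha) * lam)%C).
set (c0 := (P * (alpha * e1 + alpha * alpha * e2))%C).
set (c1 := (- (P * alpha * e0))%C); set (c2 := (- (P * (alpha * alpha) * e0))%C).
assert (HF : fi_F_p lam = fun f => int01 (fun x => kcomb lam c0 c1 c2 x * f x)%C).
{ apply functional_extensionality; intros f; unfold fi_F_p; f_equal.
  apply functional_extensionality; intros x; rewrite kcomb_unfold; unfold fi_phi_p.
  fold e0 e1 e2 P; unfold c0, c1, c2; ring. }
rewrite HF; split; [apply bounded_kernel_fi|]; intros phi Hphi.
rewrite (green_fi lam c0 c1 c2 phi Hphi), kcomb_at_1; fold e0 e1 e2.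
assert (A2 := alpha_sqr).
assert (HP : (P * (e0 + alpha * e1 + alpha * alpha * e2))%C = (/ (2 * PI))%C).
{ unfold P; change (e0 + alpha * e1 + alpha * alpha * e2)%C with (Defs.Delta lam); field.
  repeat split; trivial; apply PI_neq_0_C || apply two_neq_0_C. }
assert (S1 : (c0 + c1 + c2)%C = (/ (2 * PI))%C)
  by (rewrite <- HP; unfold c0, c1, c2; ring [A2]).
assert (S2 : (c0 + alpha * c1 + alpha * alpha * c2)%C = (/ (2 * PI))%C)
  by (rewrite <- HP; unfold c0, c1, c2; ring [A2]).
assert (S3 : (c0 * e0 + c1 * e1 + c2 * e2)%C = RtoC 0) by (unfold c0, c1, c2; ring).
rewrite S1, S2, S3; unfold fi_Rp; field; repeat split; apply PI_neq_0_C || apply two_neq_0_C.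
Qed.

(** Here the coefficients are proportional to 1, alpha, alpha^2: the terms at 0 cancel
    since 1 + alpha + alpha^2 = 0, and at 1 the sum multiplying - exp(- i lam) / (2 pi Delta) is Delta itself. *)
Lemma fi_eigen_m (lam : C) : Defs.Delta lam <> RtoC 0 ->
  bounded_functional Cinf01 (fi_F_m lam) /\
  forall phi, fi_Phi phi ->
    fi_F_m lam (opS unit_itv phi) = (lam * lam * lam * fi_F_m lam phi + fi_Rm lam phi)%C.
Proof.
intros HD.
set (P := (- Cexp (- Ci * lam) / (2 * PI * Defs.Delta lam))%C).
set (e0 := Cexp (- Ci * lam)%C); set (e1 := Cexp (- Ci * alpha * lam)%C).
set (e2 := Cexp (- Ci * (alpha * alpha) * lam)%C).
set (c1 := (P * alpha)%C); set (c2 := (P * (alpha * alpha))%C).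
assert (HF : fi_F_m lam = fun f => int01 (fun x => kcomb lam P c1 c2 x * f x)%C).
{ apply functional_extensionality; intros f; unfold fi_F_m; f_equal.
  apply functional_extensionality; intros x; rewrite kcomb_unfold; unfold fi_phi_m.
  fold P; unfold c1, c2; ring. }
rewrite HF; split; [apply bounded_kernel_fi|]; intros phi Hphi.
rewrite (green_fi lam P c1 c2 phi Hphi), kcomb_at_1; fold e0 e1 e2.
assert (A2 := alpha_sqr).
assert (S3 : (P * e0 + c1 * e1 + c2 * e2)%C = (- e0 / (2 * PI))%C).
{ unfold c1, c2; replace (P * e0 + P * alpha * e1 + P * (alpha * alpha) * e2)%C
    with (P * (e0 + alpha * e1 + alpha * alpha * e2))%C by ring.
  change (e0 + alpha * e1 + alpha * alpha * e2)%C with (Defs.Delta lam).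
  unfold P; fold e0; field; repeat split; trivial; apply PI_neq_0_C || apply two_neq_0_C. }
assert (S1 : (P + c1 + c2)%C = RtoC 0) by (unfold c1, c2; ring [A2]).
assert (S2 : (P + alpha * c1 + alpha * alpha * c2)%C = RtoC 0) by (unfold c1, c2; ring [A2]).
rewrite S1, S2, S3; unfold fi_Rm; fold e0; field; repeat split; apply PI_neq_0_C || apply two_neq_0_C.
Qed.

Lemma finite_interval_eigenfunctions :
  typeII_augmented_eigenfunctions 0 1 Cinf01 fi_Phi (opS unit_itv)
    (fi_Gamma_p ++ fi_Gamma_m)
    (union_family fi_Gamma_p fi_F_p fi_F_m)
    (fun lam => (lam * lam * lam)%C).
Proof.
assert (P := PI_RGT_0).
apply typeII_union with fi_Rp fi_Rm.
- intros p Hp; apply in_app_or in Hp; destruct Hp as [Hp|Hp];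
    [unfold fi_Gamma_p in Hp; apply in_app_or in Hp; destruct Hp as [Hp|Hp]|];
    exact (sector_boundary_ends _ _ _ Hp).
- intros lam H; now apply fi_Gamma_disjoint.
- apply linear_operator_fi.
- intros lam H; destruct (Delta_neq_0_fi_Gamma_p lam H) as [HD _].
  destruct (fi_eigen_p lam HD) as [B E]; split; [|split]; trivial.
  apply bounded_lin_comb; apply bounded_point_fi, unit_itv_0.
- intros lam H; destruct (Delta_neq_0_fi_Gamma_m lam H) as [HD _].
  destruct (fi_eigen_m lam HD) as [B E]; split; [|split]; trivial.
  apply bounded_lin_comb; apply bounded_point_fi, unit_itv_1.
- intros phi x Hphi [Hx0 Hx1]; simpl in Hx0, Hx1; split.
  + replace (RtoC 0) with (RtoC 0 + RtoC 0)%C by ring; apply is_contour_int_app;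
      apply (decaying_exp_integrand _ _ x (- (Ci / (2 * PI)) * deriv_on unit_itv 2 phi 0)%C
        (- (Ci / (2 * PI)) * Ci * deriv_on unit_itv 1 phi 0)%C);
      try (intros p Hp; exact (sector_boundary_ends _ _ _ Hp));
      try (intros z Hz; exact (sector_boundary_neq_0 _ _ _ Hz));
      try (intros z Hz; unfold fi_Rp; replace (Ci * z * x)%C with (Ci * x * z)%C by ring;
        apply (f_equal (Cmult _)); ring);
      apply sector_integral_zero; try lra; intros th Hth; apply Rmult_le_pos; try lra;
      apply sin_ge_0; lra.
  (* The factor exp(- i lam) of the remainder shifts x to x - 1 < 0, which makes the
     exponential bounded in the lower half-plane. *)
  + apply (decaying_exp_integrand _ _ (x - 1) (- (Ci / (2 * PI)) * deriv_on unit_itv 2 phi 1)%C 0).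
    * intros p Hp; exact (sector_boundary_ends _ _ _ Hp).
    * intros z Hz; exact (sector_boundary_neq_0 _ _ _ Hz).
    * intros z Hz; unfold fi_Rm.
      replace (Ci * (x - 1)%R * z)%C with (Ci * z * x + - Ci * z)%C by (rewrite RtoC_minus; ring).
      rewrite Cexp_plus; unfold Cdiv; ring.
    * apply sector_integral_zero; [lra|]; intros th Hth.
      assert (S : 0 <= sin (th - PI)) by (apply sin_ge_0; lra).
      assert (E : sin th = - sin (th - PI))
        by (rewrite <- neg_sin; f_equal; ring).
      rewrite E; nra.
Qed.

(** * The half-line problem *)

Definition hl_Rp (lam : C) : functional := fun f =>
  (Ci / (2 * PI) * deriv_on half_line 2 f 0 + Ci / (2 * PI) * (Ci * lam) * deriv_on half_line 1 f 0)%C.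

Definition hl_Rm (lam : C) : functional := fun f =>
  (- (Ci / (2 * PI)) * deriv_on half_line 2 f 0
   + - (Ci / (2 * PI)) * (Ci * lam) * deriv_on half_line 1 f 0)%C.

Lemma green_hl (eps rho : R) (lam c0 c1 c2 : C) (phi : R -> C) : 0 <= rho < eps -> hl_Phi eps phi ->
  (c0 = RtoC 0 \/ Im lam <= rho) -> (c1 = RtoC 0 \/ Im (alpha * lam) <= rho) ->
  (c2 = RtoC 0 \/ Im (alpha * alpha * lam) <= rho) ->
  int_half_line (fun x => kcomb lam c0 c1 c2 x * opS half_line phi x)%C =
  (lam * lam * lam * int_half_line (fun x => kcomb lam c0 c1 c2 x * phi x)
   - Ci * ((c0 + c1 + c2) * deriv_on half_line 2 phi 0
           + Ci * lam * (c0 + alpha * c1 + alpha * alpha * c2) * deriv_on half_line 1 phi 0))%C.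
Proof.
intros Hr [[Sf Of] f0] H0 H1 H2.
assert (Sf' := Sf); destruct Sf' as (g & Hg & E).
assert (HG := C3_extension_half_line phi g Hg E).
set (G := fun k => deriv_on whole k g) in *.
assert (HE := proj2 (proj2 HG)).
set (c := (rho + eps) / 2); assert (Hc : rho < c < eps) by (unfold c; lra).
assert (Dk : forall k, (k <= 2)%nat -> Cdecays c (G k)).
{ intros k Hk; destruct (Cdecays_derivatives eps phi ltac:(lra) Sf Of k c ltac:(lra)) as (K & K0 & HK).
  exists K; split; trivial; intros x Hx.
  rewrite <- HE by (lia || now apply half_line_ge); auto. }
assert (T : forall (a mu : C), a = RtoC 0 \/ Im mu <= rho -> a = RtoC 0 \/
  (filterlim (boundary_form mu G) (end_filter p_infty) (locally (T := CR) (RtoC 0)) /\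
   exists t, is_int p_infty (fun x => ker mu x * phi x)%C t)).
{ intros a mu [H|H]; [now left|right]; split.
  - apply boundary_form_vanishes with rho c; trivial; lra.
  - destruct (ex_kernel_integral_hl mu 1 0 0 rho c phi) as [t Ht]; auto; try lra.
    + apply Cdecays_of_bigO; trivial.
      apply bigO_of_Cdecays, (Cdecays_derivatives eps phi ltac:(lra) Sf Of 0 c ltac:(lra)).
    + exists t; apply is_int_ext with (3 := Ht); [exact I|]; intros x _; unfold kcomb; ring. }
destruct (green_kcomb p_infty lam c0 c1 c2 half_line phi G 0 0 0) as (t & T1 & T2); auto.
{ exact I. }
assert (D0 : half_line 0) by (apply half_line_ge; lra).
rewrite (int_half_line_eq _ _ T1), (int_half_line_eq _ _ T2).
assert (G00 : G 0%nat 0 = RtoC 0) by (rewrite <- f0; symmetry; apply (HE 0%nat); [lia | trivial]).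
rewrite (HE 2%nat), (HE 1%nat) by (trivial; lia).
unfold boundary_form; rewrite !ker_0, G00; ring.
Qed.

(** The coefficients of f''(0) and of i lam f'(0) are both (alpha + alpha^2)/(2 pi) =
    - 1/(2 pi). *)
Lemma hl_eigen_p (eps : R) (lam : C) : 0 < eps ->
  Im (alpha * lam) <= 0 -> Im (alpha * alpha * lam) <= 0 ->
  bounded_functional (Shalf eps) (hl_F_p lam) /\
  forall phi, hl_Phi eps phi ->
    hl_F_p lam (opS half_line phi) = (lam * lam * lam * hl_F_p lam phi + hl_Rp lam phi)%C.
Proof.
intros He I1 I2.
set (c1 := (/ (2 * PI) * alpha)%C); set (c2 := (/ (2 * PI) * (alpha * alpha))%C).
assert (HF : hl_F_p lam = fun f => int_half_line (fun x => kcomb lam 0 c1 c2 x * f x)%C).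
{ apply functional_extensionality; intros f; unfold hl_F_p; f_equal.
  apply functional_extensionality; intros x; rewrite kcomb_unfold; unfold hl_phi_p, c1, c2; ring. }
rewrite HF; split; [apply bounded_kernel_hl with 0; auto|]; intros phi Hphi.
rewrite (green_hl eps 0 lam 0 c1 c2 phi) by (auto; lra).
assert (A2 := alpha_sqr).
assert (S1 : (0 + c1 + c2)%C = (- / (2 * PI))%C) by (unfold c1, c2; ring [A2]).
assert (S2 : (0 + alpha * c1 + alpha * alpha * c2)%C = (- / (2 * PI))%C) by (unfold c1, c2; ring [A2]).
rewrite S1, S2; unfold hl_Rp, Cdiv; ring.
Qed.

Lemma hl_eigen_m (eps rho : R) (lam : C) : 0 < rho < eps -> Im lam <= rho ->
  bounded_functional (Shalf eps) (hl_F_m lam) /\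
  forall phi, hl_Phi eps phi ->
    hl_F_m lam (opS half_line phi) = (lam * lam * lam * hl_F_m lam phi + hl_Rm lam phi)%C.
Proof.
intros Hr I0.
assert (HF : hl_F_m lam = fun f => int_half_line (fun x => kcomb lam (/ (2 * PI)) 0 0 x * f x)%C).
{ apply functional_extensionality; intros f; unfold hl_F_m; f_equal.
  apply functional_extensionality; intros x; rewrite kcomb_unfold; unfold hl_phi_m; ring. }
rewrite HF; split; [apply bounded_kernel_hl with rho; auto; lra|]; intros phi Hphi.
rewrite (green_hl eps rho lam (/ (2 * PI)) 0 0 phi) by (auto; lra).
unfold hl_Rm, Cdiv; ring.
Qed.

Lemma Im_le_0_hl_Gamma_p (lam : C) : on_contour hl_Gamma_p lam ->
  Im (alpha * lam) <= 0 /\ Im (alpha * alpha * lam) <= 0.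
Proof.
unfold hl_Gamma_p; replace (2 * PI / 3) with (PI / 3 + PI / 3) by field; intros H.
apply on_sector_boundary in H; destruct H as [(H1 & H2 & _) _].
replace (PI / 3 + PI / 3) with (2 * PI / 3) in H2 by field.
rewrite side_PI3 in H1; rewrite side_2PI3 in H2.
rewrite alpha_sqr, alpha_pair; destruct lam as [x y]; unfold Re, Im in *; cbn [fst snd] in *.
unfold Cmult, Cminus, Cplus, Copp, RtoC; cbn [fst snd]; split; lra.
Qed.

Lemma Im_le_hl_Gamma_m (rho : R) (lam : C) : 0 < rho -> on_contour (hl_Gamma_m rho) lam ->
  Im lam <= rho /\ lam <> RtoC 0.
Proof.
intros Hr (p & [<-|[<-|[<-|[]]]] & t & Ht & ->); simpl in Ht |- *.
- split; [lra|]; intros E; apply (f_equal Re) in E; unfold Re, clitv in *; simpl in *; lra.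
- split.
  + change (Im (circ rho t) <= rho); rewrite circ_pair; simpl; assert (B := SIN_bound t); nra.
  + change (circ rho t) with (ray t rho); now apply ray_neq_0.
- split; [lra|]; intros E; apply (f_equal Re) in E; unfold Re, clitv in *; simpl in *; lra.
Qed.

Lemma half_line_eigenfunctions (eps rho : R) : 0 < eps -> 0 < rho < eps -> rho < 1 ->
  typeII_augmented_eigenfunctions 0 p_infty (Shalf eps) (hl_Phi eps) (opS half_line)
    (hl_Gamma_p ++ hl_Gamma_m rho)
    (union_family hl_Gamma_p hl_F_p hl_F_m)
    (fun lam => (lam * lam * lam)%C).
Proof.
intros He Hr Hr1; assert (P := PI_RGT_0).
assert (Hends : forall p, In p (hl_Gamma_m rho) -> exists r : R, start p = r \/ finish p = r)
  by (intros p [<-|[<-|[<-|[]]]]; simpl; eauto).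
apply typeII_union with hl_Rp hl_Rm.
- intros p Hp; apply in_app_or in Hp; destruct Hp as [Hp|Hp]; auto.
  exact (sector_boundary_ends _ _ _ Hp).
- intros lam H; apply hl_Gamma_disjoint; trivial; lra.
- now apply linear_operator_hl.
- intros lam H; destruct (Im_le_0_hl_Gamma_p lam H) as [I1 I2].
  destruct (hl_eigen_p eps lam He I1 I2) as [B E]; split; [|split]; trivial.
  apply bounded_lin_comb; apply bounded_point_hl.
- intros lam H; destruct (Im_le_hl_Gamma_m rho lam (proj1 Hr) H) as [I0 _].
  destruct (hl_eigen_m eps rho lam Hr I0) as [B E]; split; [|split]; trivial.
  apply bounded_lin_comb; apply bounded_point_hl.
- intros phi x Hphi [Hx0 _]; simpl in Hx0; split.
  + apply (decaying_exp_integrand _ _ x (Ci / (2 * PI) * deriv_on half_line 2 phi 0)%C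
      (Ci / (2 * PI) * Ci * deriv_on half_line 1 phi 0)%C).
    * intros p Hp; exact (sector_boundary_ends _ _ _ Hp).
    * intros z Hz; exact (sector_boundary_neq_0 _ _ _ Hz).
    * intros z Hz; unfold hl_Rp; replace (Ci * z * x)%C with (Ci * x * z)%C by ring.
      apply (f_equal (Cmult _)); ring.
    * apply sector_integral_zero; [lra|]; intros th Hth; apply Rmult_le_pos; try lra.
      apply sin_ge_0; lra.
  + apply (decaying_exp_integrand _ _ x (- (Ci / (2 * PI)) * deriv_on half_line 2 phi 0)%C
      (- (Ci / (2 * PI)) * Ci * deriv_on half_line 1 phi 0)%C); trivial.
    * intros z Hz; now apply (Im_le_hl_Gamma_m rho z (proj1 Hr)).
    * intros z Hz; unfold hl_Rm; replace (Ci * z * x)%C with (Ci * x * z)%C by ring.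
      apply (f_equal (Cmult _)); ring.
    * apply half_plane_integral_zero; lra.
Qed.

Theorem theorem3p3 :
  typeII_augmented_eigenfunctions 0 1 Cinf01 fi_Phi (opS unit_itv)
    (fi_Gamma_p ++ fi_Gamma_m)
    (union_family fi_Gamma_p fi_F_p fi_F_m)
    (fun lam => (lam * lam * lam)%C)
  /\
  (forall eps rho : R, 0 < eps -> 0 < rho < eps -> rho < 1 ->
     typeII_augmented_eigenfunctions 0 p_infty (Shalf eps) (hl_Phi eps) (opS half_line)
       (hl_Gamma_p ++ hl_Gamma_m rho)
       (union_family hl_Gamma_p hl_F_p hl_F_m)
       (fun lam => (lam * lam * lam)%C)).
Proof.
split; [exact finite_interval_eigenfunctions | exact half_line_eigenfunctions].
Qed.
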